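(* For $g\geq 1$, call a cell of the tropical Schottky locus $A^{\mathrm{cogr}}_g$ a $GL_g(\mathbb{Z})$-orbit of cones of the form $\sigma_A$, where $A$ is a $g\times n$ totally unimodular matrix whose column matroid is a simple cographic matroid (of rank at most $g$), and define its dimension to be the dimension of $\sigma_A$. Then: (i) $A^{\mathrm{cogr}}_3$ has $9$ cells, and the numbers of cells of dimensions $0,1,\dots,6$ are $(1,1,1,2,2,1,1)$; (ii) $A^{\mathrm{cogr}}_4$ has $25$ cells, and the numbers of cells of dimensions $0,1,\dots,9$ are $(1,1,1,2,3,4,5,4,2,2)$; (iii) $A^{\mathrm{cogr}}_5$ has $92$ cells, and the numbers of cells of dimensions $0,1,\dots,12$ are $(1,1,1,2,3,5,9,12,15,17,15,7,4)$.
   Context: A matrix is totally unimodular if every square submatrix has determinant in $\{0,1,-1\}$. A matroid is simple if it has no loops and no parallel elements; it is cographic if it is the dual $M^*(G)$ of the cycle matroid of a finite graph $G$. Cographic matroids are regular, i.e. representable by totally unimodular matrices. For a $g\times n$ totally unimodular matrix $A$ with columns $v_1,\dots,v_n$, $\sigma_A=\mathbb{R}_{>0}\langle v_1v_1^T,\dots,v_nv_n^T\rangle$, an open cone in the space of $g\times g$ real symmetric matrices, on which $X\in GL_g(\mathbb{Z})$ acts by $Q\mapsto X^TQX$. It is known that the $GL_g(\mathbb{Z})$-orbit of $\sigma_A$ depends only on the column matroid of $A$ and not on the choice of totally unimodular representing matrix (the empty matroid gives the cone $\{0\}$). *)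

(* Defs.v *)
From HB Require Import structures.
From mathcomp Require Import all_boot all_order all_algebra.
From mathcomp Require Import boolp classical_sets functions cardinality reals.

Set Implicit Arguments.
Unset Strict Implicit.
Unset Printing Implicit Defensive.

Import Order.TTheory GRing.Theory Num.Theory.

Local Open Scope ring_scope.
Local Open Scope classical_set_scope.

(* A matroid on the finite ground set E is given by its family of independent
   sets, I : {set E} -> Prop. *)
Section Matroids.
Variable E : finType.
Implicit Types (I : {set E} -> Prop) (S B : {set E}) (e f : E).

Definition basis I B := I B /\ forall S, I S -> B \subset S -> S = B.

(* The bases of the dual are the complements of the bases of I. *)
Definition dual_indep I S := exists2 B, basis I B & S \subset ~: B.

Definition is_loop I e := ~ I [set e]%SET.

Definition parallel I e f :=
  [/\ e != f, ~ is_loop I e, ~ is_loop I f & ~ I [set e; f]%SET].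

Definition simple_matroid I :=
  (forall e, ~ is_loop I e) /\ (forall e f, ~ parallel I e f).

End Matroids.

Definition matroid_iso (E F : finType) (I : {set E} -> Prop)
    (J : {set F} -> Prop) :=
  exists2 h : E -> F, bijective h & forall S : {set E}, I S <-> J (h @: S)%SET.

(* Loops and multiple edges are allowed (and are needed here); the order of the
   two ends of an edge is irrelevant. *)
Record multigraph := Multigraph {
  vertex : finType;
  edge : finType;
  ends : edge -> vertex * vertex }.

Section CycleMatroid.
Variable G : multigraph.

Definition joins (e : edge G) (x y : vertex G) :=
  (ends e == (x, y)) || (ends e == (y, x)).

(* The cycle v_1 -e_1- v_2 -e_2- ... -e_k- v_1 is encoded as the sequence of
   pairs (v_i, e_i); a loop is a cycle with k = 1, and two parallel edges form
   a cycle with k = 2. *)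
Definition graph_cycle (c : seq (vertex G * edge G)) :=
  [&& c != [::], uniq (unzip1 c), uniq (unzip2 c) &
      cycle (fun p q => joins p.2 p.1 q.1) c].

Definition cycle_indep (S : {set edge G}) :=
  forall c, graph_cycle c -> ~~ all [in S] (unzip2 c).

End CycleMatroid.

Definition cographic (E : finType) (I : {set E} -> Prop) :=
  exists G : multigraph, matroid_iso I (dual_indep (@cycle_indep G)).

Section Cones.
Variable R : realType.

Definition totally_unimodular m n (A : 'M[R]_(m, n)) :=
  forall k (f : 'I_k -> 'I_m) (h : 'I_k -> 'I_n),
    injective f -> injective h -> \det (mxsub f h A) \in [:: 0; 1; -1].

Definition column_indep m n (A : 'M[R]_(m, n)) (S : {set 'I_n}) : Prop :=
  free [seq col i A | i in S].

Definition sigma g n (A : 'M[R]_(g, n)) : set 'M[R]_g :=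
  [set Q | exists2 c : 'I_n -> R, forall i, 0 < c i &
           Q = \sum_i c i *: (col i A *m (col i A)^T)].

Definition GLZ_act g (X : 'M[int]_g) (Q : 'M[R]_g) : 'M[R]_g :=
  (map_mx intr X)^T *m Q *m map_mx intr X.

Definition GLZ_orbit g (s : set 'M[R]_g) : set (set 'M[R]_g) :=
  [set t | exists2 X : 'M[int]_g, X \in unitmx & t = GLZ_act X @` s].

(* The linear span of s, characterised as the least subspace containing s,
   has dimension d. *)
Definition cone_dim g (s : set 'M[R]_g) (d : nat) :=
  exists U : {vspace 'M[R]_g},
    [/\ s `<=` [set Q | Q \in U],
        forall W : {vspace 'M[R]_g}, s `<=` [set Q | Q \in W] -> (U <= W)%VS
      & \dim U = d].

Definition admissible g n (A : 'M[R]_(g, n)) :=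
  [/\ totally_unimodular A, simple_matroid (column_indep A)
    & cographic (column_indep A)].

Definition schottky_cells g : set (set (set 'M[R]_g)) :=
  [set C | exists n (A : 'M[R]_(g, n)),
    admissible A /\ C = GLZ_orbit (sigma A)].

Definition schottky_cells_dim g (d : nat) : set (set (set 'M[R]_g)) :=
  [set C | exists n (A : 'M[R]_(g, n)),
    [/\ admissible A, C = GLZ_orbit (sigma A) & cone_dim (sigma A) d]].

End Cones.

Arguments schottky_cells : clear implicits.
Arguments schottky_cells_dim : clear implicits.

(* Main.v *)
(* The cone of a totally unimodular matrix A determines, and up to GL_g(Z) is
   determined by, the binary code of A: the sets of columns whose sum vanishes
   mod 2.  One direction reads the columns of A, up to sign, off the extremal
   rays of the cone, the rank one forms being linearly independent.  The other
   is the uniqueness of totally unimodular representations, which reduces by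
   pivoting to Camion's theorem: two totally unimodular matrices with the same
   support differ by signs of rows and columns.

   A simple cographic matroid of rank at most g thus becomes a finite set of
   nonzero vectors of F_2^g whose code is the cut space of a graph.  This
   property is inherited by subsets (contract an edge), so the orbits of such
   sets under GL_g(F_2) can be enumerated by adding one vector at a time: for
   each known orbit and each new vector, a certificate either gives the linear
   map onto another known orbit, or embeds one of nine obstructions.  As in
   MacLane's planarity criterion, an obstruction is excluded by double counting
   the vertex stars of a putative graph. *)
Require Import Defs.
From HB Require Import structures.
From Stdlib Require Import NArith.
From mathcomp Require Import all_boot all_order all_algebra.
From mathcomp Require Import boolp reals.
From mathcomp Require Import perm zify ring lra.

Set Implicit Arguments.
Unset Strict Implicit.
Unset Printing Implicit Defensive.

Import Order.TTheory GRing.Theory Num.Theory.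

(** * Total unimodularity, pivots and signings *)

Section TotallyUnimodular.
Local Open Scope ring_scope.

(** A linear map over F_2 between two point sets has no canonical integral lift, and an arbitrary
    lift does not carry one cone to the other. So the certified maps serve only to identify codes;
    the element of GL_g(Z) comes from the uniqueness of representations. The converse half needs
    four facts about the 92 representatives. Their 0/1 lifts are totally unimodular, by
    Ghouila-Houri's criterion checked over all row sets. They are cographic: only four graphs are
    given, and every other class is, up to a linear map, a subset of a class with one more point.
    The forms v v^T are independent, so the dimension of a cone is its number of points. They are
    pairwise inequivalent, because the counts of representations of vectors as sums of two or three
    points differ. One table serves g = 3, 4 and 5: each representative contains the standard basis
    of its span, and a certified map between classes preserves F_2^g whenever the source points lie
    in it. *)

Definition tu m n (A : 'M[int]_(m, n)) :=
  forall k (f : 'I_k -> 'I_m) (h : 'I_k -> 'I_n),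
    injective f -> injective h -> \det (mxsub f h A) \in [:: 0; 1; -1].

Lemma tu_entry m n (A : 'M[int]_(m, n)) i j : tu A -> A i j \in [:: 0; 1; -1].
Proof.
move=> tuA; have inj1 T (x : T) : injective (fun _ : 'I_1 => x).
  by move=> ? ? _; rewrite !ord1.
by have := tuA 1 (fun=> i) (fun=> j) (inj1 _ _) (inj1 _ _);
  rewrite det_mx11 mxE.
Qed.

Lemma unit_int_sign (x : int) : (x \is a GRing.unit) = (x == 1) || (x == -1).
Proof. by []. Qed.

Lemma sign_int_sq (x : int) : x \in [:: 0; 1; -1] -> x != 0 -> x * x = 1.
Proof. by rewrite !inE => /or3P[] /eqP->. Qed.

Lemma sign_int_mul (x y : int) :
  x \in [:: 0; 1; -1] -> y \in [:: 0; 1; -1] -> x * y \in [:: 0; 1; -1].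
Proof. by rewrite !inE => /or3P[] /eqP-> /or3P[] /eqP->. Qed.

Lemma tu_colsub m n p (A : 'M[int]_(m, n)) (h : 'I_p -> 'I_n) :
  injective h -> tu A -> tu (colsub h A).
Proof.
move=> inj_h tuA k f h' inj_f inj_h'.
have -> : mxsub f h' (colsub h A) = mxsub f (h \o h') A.
  by apply/matrixP => i j; rewrite !mxE.
by apply: tuA => //; apply: inj_comp.
Qed.

Lemma det_signs k (d : 'rV[int]_k) :
  (forall i, d 0 i \in [:: 1; -1]) -> \det (diag_mx d) \in [:: 0; 1; -1].
Proof.
move=> sd; rewrite det_diag.
elim/big_ind: _ => // [x y|i _]; first exact: sign_int_mul.
by have := sd i; rewrite !inE => /orP[] ->; rewrite ?orbT.
Qed.

Lemma tu_scale m n (A B : 'M[int]_(m, n)) (r : 'I_m -> int) (c : 'I_n -> int) :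
  (forall i, r i \in [:: 1; -1]) -> (forall j, c j \in [:: 1; -1]) ->
  (forall i j, B i j = r i * A i j * c j) -> tu A -> tu B.
Proof.
move=> sr sc BE tuA k f h inj_f inj_h.
have -> : mxsub f h B = diag_mx (\row_i r (f i)) *m mxsub f h A
                         *m diag_mx (\row_i c (h i)).
  by rewrite mul_mx_diag mul_diag_mx; apply/matrixP => i j; rewrite !mxE.
by rewrite !det_mulmx !sign_int_mul ?det_signs ?tuA // => i; rewrite mxE.
Qed.

Lemma tu_rowperm m n (A : 'M[int]_(m, n)) s : tu A -> tu (row_perm s A).
Proof.
move=> tuA k f h inj_f inj_h.
have -> : mxsub f h (row_perm s A) = mxsub (fun x => s (f x)) h A.
  by apply/matrixP => i j; rewrite !mxE.
by apply: tuA => // x y /perm.perm_inj/inj_f.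
Qed.

(** The elementary matrix behind a pivot: left multiplication by it adds multiples of row [p] to the
    other rows and scales row [p] itself. *)
Definition colrep k (p : 'I_k) (b : 'I_k -> int) : 'M[int]_k :=
  \matrix_(i, j) if j == p then b i else (i == j)%:R.

Lemma colrep_mul k n (p : 'I_k) b (A : 'M[int]_(k, n)) i j :
  (colrep p b *m A) i j = b i * A p j + (i != p)%:R * A i j.
Proof.
rewrite mxE (bigD1 p) //= mxE eqxx; congr (_ + _).
case: (eqVneq i p) => [->|neq] /=.
  rewrite mul0r big1 // => l neq_l; rewrite mxE (negPf neq_l).
  by rewrite eq_sym (negPf neq_l) mul0r.
rewrite (bigD1 i) //= mxE (negPf neq) eqxx big1 ?addr0 // => l /andP[lp li].
by rewrite mxE (negPf lp) eq_sym (negPf li) mul0r.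
Qed.

Lemma colrep_unit k (p : 'I_k) b : b p * b p = 1 -> colrep p b \in unitmx.
Proof.
move=> bb; pose b' i := if i == p then b p else - b p * b i.
suff /mulmx1_unit[] : colrep p b *m colrep p b' = 1%:M by [].
apply/matrixP => i j; rewrite colrep_mul !mxE /b' eqxx.
case: (eqVneq j p) => [->|jp]; case: (eqVneq i p) => [->|ip] //=.
- by rewrite bb mul0r addr0.
- by rewrite mul1r mulNr mulrC addrN.
- by rewrite mulr0 mul0r addr0 eq_sym (negPf jp).
- by rewrite mulr0 add0r mul1r.
Qed.

(** Gaussian elimination turning column [c] into the unit vector of row [i]. A nonzero entry of a
    totally unimodular matrix is its own inverse, so [A i c] stands where a division by it is
    expected and everything stays integral. *)
Definition pivot m n (A : 'M[int]_(m, n)) i c : 'M[int]_(m, n) :=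
  \matrix_(k, l) if k == i then A i c * A i l
                 else A k l - A k c * A i c * A i l.

Definition pivotmx m n (A : 'M[int]_(m, n)) i c : 'M[int]_m :=
  colrep i (fun k => if k == i then A i c else - (A k c * A i c)).

Lemma pivotE m n (A : 'M[int]_(m, n)) i c : pivot A i c = pivotmx A i c *m A.
Proof.
apply/matrixP => k l; rewrite colrep_mul !mxE.
by case: eqVneq => [->|_] /=; rewrite ?mul0r ?addr0 ?mul1r // mulNr addrC.
Qed.

Lemma pivotmx_unit m n (A : 'M[int]_(m, n)) i c :
  tu A -> A i c != 0 -> pivotmx A i c \in unitmx.
Proof.
by move=> tuA Aic; apply: colrep_unit; rewrite eqxx sign_int_sq // tu_entry.
Qed.

(** A minor using row [i] changes by a unit, since the pivot acts on it by row operations. A minor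
    avoiding row [i] either contains column [c], which is then zero, or equals the minor bordered by
    row [i] and column [c], by expansion along column [c]. *)
Lemma tu_pivot m n (A : 'M[int]_(m, n)) i c :
  tu A -> A i c != 0 -> tu (pivot A i c).
Proof.
move=> tuA Aic; have AA : A i c * A i c = 1 by rewrite sign_int_sq // tu_entry.
have hit k (f : 'I_k -> 'I_m) (h : 'I_k -> 'I_n) p : injective f ->
    injective h -> f p = i -> \det (mxsub f h (pivot A i c)) \in [:: 0; 1; -1].
  move=> inj_f inj_h fp.
  pose b q := if q == p then A i c else - (A (f q) c * A i c).
  have -> : mxsub f h (pivot A i c) = colrep p b *m mxsub f h A.
    apply/matrixP => r l; rewrite colrep_mul !mxE /b -fp (inj_eq inj_f).
    by case: eqVneq => [->|_] /=; rewrite ?mul0r ?addr0 ?mul1r // mulNr addrC.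
  have := colrep_unit (p := p) (b := b); rewrite {1 2}/b eqxx => /(_ AA).
  rewrite unitmxE unit_int_sign det_mulmx => det_b.
  by apply: sign_int_mul; [rewrite !inE det_b orbT | apply: tuA].
move=> k f h inj_f inj_h.
have [[p fp]|fi] := pselect (exists p, f p = i); first exact: hit fp.
have {}fi p : f p != i by apply/eqP => fp; apply: fi; exists p.
have pc0 r : pivot A i c r c = (r == i)%:R.
  rewrite mxE; case: (eqVneq r i) => _; first by [].
  by rewrite -!mulrA AA mulr1 subrr.
have [[q hq]|hc] := pselect (exists q, h q = c).
  rewrite (expand_det_col _ q) big1 ?inE ?eqxx // => r _.
  by rewrite [X in X * _]mxE hq pc0 (negPf (fi r)) mul0r.
have {}hc q : h q != c by apply/eqP => hq; apply: hc; exists q.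
(* The bordering row and column sit in position 0, so that the cofactor sign is trivial. *)
pose f' (x : 'I_k.+1) := oapp f i (unlift ord0 x).
pose h' (x : 'I_k.+1) := oapp h c (unlift ord0 x).
have inj_f' : injective f'.
  move=> x y; rewrite /f'; case: (unliftP ord0 x) => [x'|] ->;
    case: (unliftP ord0 y) => [y'|] -> //=.
  - by move/inj_f->.
  - by move=> e; case/eqP: (fi x').
  - by move=> e; case/eqP: (fi y').
have inj_h' : injective h'.
  move=> x y; rewrite /h'; case: (unliftP ord0 x) => [x'|] ->;
    case: (unliftP ord0 y) => [y'|] -> //=.
  - by move/inj_h->.
  - by move=> e; case/eqP: (hc x').
  - by move=> e; case/eqP: (hc y').
have f'0 : f' ord0 = i by rewrite /f' unlift_none.
have := hit _ _ _ _ inj_f' inj_h' f'0.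
rewrite (expand_det_col _ ord0) (bigD1 ord0) //= big1 ?addr0 => [|r r0].
  rewrite [X in X * _]mxE f'0 /h' unlift_none pc0 eqxx mul1r /cofactor expr0
    mul1r.
  set M := row' _ _; suff -> : M = mxsub f h (pivot A i c) by [].
  by apply/matrixP => r l; rewrite !mxE /f' /h' !liftK.
rewrite [X in X * _]mxE /h' unlift_none pc0 -f'0 (inj_eq inj_f').
by rewrite (negPf r0) mul0r.
Qed.

End TotallyUnimodular.

(** * Independence over different fields and the parity code of a matrix *)

Section Independence.
Local Open Scope ring_scope.

(** Phrasing independence by kernel vectors makes sense over every field: the same integer matrix is
    to be compared over the reals and over F_2. *)
Definition kindep (F : fieldType) m n (M : 'M[F]_(m, n)) (S : {set 'I_n}) :=
  forall c : 'cV[F]_n,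
    (forall i, i \notin S -> c i 0 = 0) -> M *m c = 0 -> c = 0.

Lemma kindepE (F : fieldType) m n (M : 'M[F]_(m, n)) (S : {set 'I_n}) :
  kindep M S <->
  (forall v : 'cV[F]_#|S|, colsub enum_val M *m v = 0 -> v = 0).
Proof.
split=> [indS v Mv|indS c c0 Mc].
  pose c : 'cV[F]_n := \col_i \sum_(q < #|S| | enum_val q == i) v q 0.
  have cE q : c (enum_val q) 0 = v q 0.
    rewrite mxE (big_pred1 q) // => p /=.
    by rewrite (inj_eq (@enum_val_inj _ _)).
  have c0 i : i \notin S -> c i 0 = 0.
    move=> iS; rewrite mxE big1 // => q /eqP qi.
    by move: iS; rewrite -qi enum_valP.
  suff /indS : M *m c = 0.
    by move/(_ c0) => {}c0; apply/colP => q; rewrite -cE c0 !mxE.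
  apply/colP => r; move/colP/(_ r): Mv => <-.
  rewrite [LHS]mxE [RHS]mxE.
  rewrite (bigID (mem S)) /= [X in _ + X]big1 => [|i iS]; last first.
    by rewrite c0 ?mulr0.
  by rewrite addr0 big_enum_val /=; apply: eq_bigr => q _;
    rewrite cE [in RHS]mxE.
have /indS v0 : colsub enum_val M *m (\col_(q < #|S|) c (enum_val q) 0) = 0.
  apply/colP => r; move/colP/(_ r): Mc => <-.
  rewrite [LHS]mxE [RHS]mxE [RHS](bigID (mem S)) /=.
  rewrite [X in _ = _ + X]big1 => [|i iS]; last by rewrite c0 ?mulr0.
  by rewrite addr0 [RHS]big_enum_val /=; apply: eq_bigr => q _; rewrite !mxE.
apply/colP => i; rewrite [RHS]mxE; have [iS|/c0 //] := boolP (i \in S).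
move/colP/(_ (enum_rank_in iS i)): v0.
by rewrite !mxE enum_rankK_in.
Qed.

Lemma kindep_minor (F : fieldType) m n (M : 'M[F]_(m, n)) (S : {set 'I_n}) :
  kindep M S <->
  exists f : 'I_#|S| -> 'I_m, \det (mxsub f (@enum_val _ (mem S)) M) != 0.
Proof.
rewrite kindepE; split=> [indS|[f detf] v Mv].
  have full : row_full (colsub (@enum_val _ (mem S)) M).
    rewrite -[colsub _ _]trmxK; set N := (colsub _ _)^T.
    have: row_free N.
      apply: inj_row_free => v vN; apply: trmx_inj; rewrite trmx0.
      by apply: indS; rewrite -[colsub _ _]trmxK -trmx_mul vN trmx0.
    by rewrite /row_free /row_full mxrank_tr.
  exists (fullrankfun full).
  have := fullrowsub_full full; rewrite row_full_unit.
  set B := rowsub _ _; suff -> : mxsub (fullrankfun full) enum_val M = B.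
    by rewrite unitmxE unitfE.
  by apply/matrixP => i j; rewrite !mxE.
have: mxsub f (@enum_val _ (mem S)) M *m v = 0.
  apply/colP => r; rewrite [RHS]mxE.
  have /colP/(_ (f r)) Mr := Mv; rewrite [LHS]mxE [RHS]mxE in Mr.
  by rewrite -[RHS]Mr [LHS]mxE; apply: eq_bigr => q _; rewrite !mxE.
move=> Mv0; rewrite -[v](@mulKmx _ _ _ (mxsub f enum_val M)).
  by rewrite Mv0 mulmx0.
by rewrite unitmxE unitfE.
Qed.

Lemma column_indepP (R : realType) m n (M : 'M[R]_(m, n)) S :
  column_indep M S <-> kindep M S.
Proof.
rewrite kindepE /column_indep.
have sumE (v : 'cV[R]_#|S|) : \sum_q v q 0 *:
    [seq col i M | i in S]`_q = colsub (@enum_val _ (mem S)) M *m v.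
  apply/colP => r; rewrite summxE mxE; apply: eq_bigr => q _.
  by rewrite nth_image !mxE mulrC.
split.
  move/(@freeP _ _ _ (image_tuple (fun i => col i M) (mem S))) => fr v Mv.
  apply/colP => q; rewrite [RHS]mxE; apply: (fr (fun q => v q 0)).
  by rewrite [LHS]sumE.
move=> indS; apply/(@freeP _ _ _ (image_tuple (fun i => col i M) (mem S))) =>
  k k0 q.
have /indS/colP/(_ q) : colsub (@enum_val _ (mem S)) M *m (\col_q k q) = 0.
  by rewrite -sumE -[RHS]k0; apply: eq_bigr => p _; rewrite mxE.
by rewrite !mxE.
Qed.

(** The row choice in [kindep_minor] comes without injectivity; a repeated row or column makes the
    determinant zero, which is an allowed value. *)
Lemma tu_minor m n (A : 'M[int]_(m, n)) k (f : 'I_k -> 'I_m)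
    (h : 'I_k -> 'I_n) : tu A -> \det (mxsub f h A) \in [:: 0; 1; -1].
Proof.
move=> tuA; have [inj_f|] := pselect (injective f).
  have [inj_h|] := pselect (injective h); first exact: tuA.
  move/injectiveP/injectivePn => [x [y xy hxy]].
  rewrite -det_tr (determinant_alternate xy) ?inE ?eqxx // => z.
  by rewrite !mxE hxy.
move/injectiveP/injectivePn => [x [y xy fxy]].
by rewrite (determinant_alternate xy) ?inE ?eqxx // => z; rewrite !mxE fxy.
Qed.

(** Independence is the nonvanishing of a maximal minor, and the minors 1 and -1 stay nonzero in
    every field. This is what lets the real matroid be read off mod 2. *)
Lemma tu_kindep (E F : fieldType) m n (A : 'M[int]_(m, n)) S : tu A ->
  kindep (map_mx intr A : 'M[E]_(m, n)) S ->
  kindep (map_mx intr A : 'M[F]_(m, n)) S.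
Proof.
move=> tuA /kindep_minor[f]; rewrite -map_mxsub det_map_mx => det_f.
apply/kindep_minor; exists f; rewrite -map_mxsub det_map_mx.
move: det_f; have := tu_minor f (@enum_val _ (mem S)) tuA.
rewrite !inE => /or3P[] /eqP->; rewrite ?rmorph0 ?eqxx // ?rmorphN rmorph1.
  by rewrite !oner_eq0.
by rewrite !oppr_eq0 !oner_eq0.
Qed.

(** For totally unimodular [A] this is the binary code of [A]: the entries 0, 1, -1 reduce mod 2 to
    the indicator of being nonzero. *)
Definition even_cols m n (A : 'M[int]_(m, n)) (T : {set 'I_n}) :=
  [forall r, ~~ \big[addb/false]_(i in T) (A r i != 0)].

Lemma F2_natE (x : 'F_2) : x = (x != 0)%:R.
Proof. by case: x => [[|[|]]] // ?; apply: val_inj. Qed.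

Lemma F2_sign (x : int) : x \in [:: 0; 1; -1] -> x%:~R = (x != 0)%:R :> 'F_2.
Proof. by rewrite !inE => /or3P[] /eqP-> //; apply: val_inj. Qed.

Lemma F2_addb (I : finType) (P : pred I) (b : I -> bool) :
  \sum_(i | P i) (b i)%:R = (\big[addb/false]_(i | P i) b i)%:R :> 'F_2.
Proof.
by symmetry; apply: (big_morph (fun b : bool => b%:R : 'F_2)) => // -[] [];
  apply: val_inj.
Qed.

Lemma even_colsE m n (A : 'M[int]_(m, n)) T : tu A ->
  even_cols A T =
  (map_mx intr A *m (\col_i (i \in T)%:R) == 0 :> 'cV['F_2]_m).
Proof.
move=> tuA; have sumE r : (map_mx intr A *m (\col_i (i \in T)%:R)) r 0 =
    (\big[addb/false]_(i in T) (A r i != 0))%:R :> 'F_2.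
  rewrite mxE -F2_addb [RHS]big_mkcond /=; apply: eq_bigr => i _.
  rewrite !mxE F2_sign ?tu_entry //; case: (i \in T); last by rewrite mulr0.
  by rewrite mulr1.
apply/forallP/eqP => [ev|ev r].
  by apply/colP => r; rewrite sumE (negPf (ev r)) mxE.
move/colP/(_ r): ev; rewrite sumE mxE.
by case: (\big[_/_]_(_ in _) _).
Qed.

Lemma kindep_even m n (A : 'M[int]_(m, n)) S : tu A ->
  kindep (map_mx intr A : 'M['F_2]_(m, n)) S <->
  (forall T : {set 'I_n}, T \subset S -> even_cols A T -> T = set0).
Proof.
move=> tuA; split=> [indS T TS|evS c c0 Ac].
  rewrite even_colsE // => /eqP /indS T0.
  have {}T0 : \col_i (i \in T)%:R = 0 :> 'cV['F_2]_n.
    by apply: T0 => i; rewrite mxE;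
      case: (boolP (i \in T)) => // /(subsetP TS)->.
  apply/setP => i; move/colP/(_ i): T0; rewrite !mxE inE.
  by case: (i \in T).
have cE : c = \col_i (i \in [set i | c i 0 != 0])%:R.
  by apply/colP => i; rewrite mxE inE -F2_natE.
have T0 : [set i | c i 0 != 0] = set0.
  apply: evS; first by apply/subsetP => i; rewrite inE; apply: contraR => /c0->.
  by rewrite even_colsE // -cE Ac.
by rewrite cE T0; apply/colP => i; rewrite !mxE inE.
Qed.

Lemma column_indep_even (R : realType) m n (A : 'M[int]_(m, n)) S : tu A ->
  column_indep (map_mx intr A : 'M[R]_(m, n)) S <->
  (forall T : {set 'I_n}, T \subset S -> even_cols A T -> T = set0).
Proof.
by move=> tuA; rewrite column_indepP -kindep_even //; split; apply: tu_kindep.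
Qed.

Lemma tu_lift (R : realType) m n (A : 'M[R]_(m, n)) : totally_unimodular A ->
  exists2 B : 'M[int]_(m, n), tu B & A = map_mx intr B.
Proof.
move=> tuA; pose B : 'M[int]_(m, n) :=
  \matrix_(i, j) if A i j == 0 then 0 else if A i j == 1 then 1 else -1.
have AB : A = map_mx intr B.
  apply/matrixP => i j; rewrite !mxE.
  have inj1 T (x : T) : injective (fun _ : 'I_1 => x) by move=> ? ? _;
    rewrite !ord1.
  have := tuA 1 (fun=> i) (fun=> j) (inj1 _ _) (inj1 _ _).
  rewrite det_mx11 mxE !inE => /or3P[] /eqP->; rewrite ?eqxx ?oner_eq0 //.
  have neq : (-1 : R) == 1 = false by apply/eqP; lra.
  by rewrite oppr_eq0 oner_eq0 neq rmorphN1.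
exists B => // k f h inj_f inj_h.
have := tuA k f h inj_f inj_h; rewrite AB -map_mxsub det_map_mx !inE.
by rewrite -(rmorphN1 intr) -[1 in X in X -> _](rmorph1 intr)
  -[0 in X in X -> _](rmorph0 intr) !eqr_int.
Qed.

Lemma tu_map (R : realType) m n (B : 'M[int]_(m, n)) :
  tu B -> totally_unimodular (map_mx intr B : 'M[R]_(m, n)).
Proof.
move=> tuB k f h inj_f inj_h; rewrite -map_mxsub det_map_mx.
have := tuB k f h inj_f inj_h; rewrite !inE.
by case/or3P=> /eqP->; rewrite ?rmorph0 ?rmorph1 ?rmorphN1 eqxx ?orbT.
Qed.

End Independence.

(** * Cographic matroids and cut codes *)

Section Cuts.

Definition cut (E V : finType) (a b : E -> V) (f : V -> bool) : {set E} :=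
  [set e | f (a e) (+) f (b e)].

Variable G : multigraph.
Implicit Types (B S : {set edge G}) (f : vertex G -> bool).

Let gcut := cut (fun e : edge G => (ends e).1) (fun e => (ends e).2).
Let J (p q : vertex G * edge G) := joins p.2 p.1 q.1.
Let adj B (x y : vertex G) := [exists e in B, joins e x y].

Lemma joinsC (e : edge G) x y : joins e x y = joins e y x.
Proof. by rewrite /joins orbC. Qed.

Lemma joins_ends (e : edge G) : joins e (ends e).1 (ends e).2.
Proof. by rewrite /joins -surjective_pairing eqxx. Qed.

Lemma adj_sym B : connect_sym (adj B).
Proof.
by apply: sym_connect_sym => x y; apply: eq_existsb => e; rewrite joinsC.
Qed.

Lemma joins_cut e x y f : joins e x y -> (e \in gcut f) = f x (+) f y.
Proof. by rewrite inE /joins => /orP[] /eqP-> //=; rewrite addbC. Qed.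

Lemma path_cut x p f : path J x p ->
  \big[addb/false]_(q <- belast x p) (q.2 \in gcut f) = f x.1 (+) f (last x
    p).1.
Proof.
elim: p x => [|y p IH] x /=; first by rewrite big_nil addbb.
move=> /andP[/joins_cut xy /IH yp]; rewrite big_cons yp xy.
by rewrite addbA addbK.
Qed.

Lemma cycle_even_cut c f : graph_cycle c ->
  \big[addb/false]_(e <- unzip2 c) (e \in gcut f) = false.
Proof.
case: c => // x p /and4P[_ _ _ /(path_cut f)].
by rewrite last_rcons belast_rcons addbb big_map.
Qed.

(** The cycle that [e] closes in [e |: B] meets every cut in an even number of edges. Its other
    edges lie in [B], hence outside a cut disjoint from [B], and [e] cannot be alone in that cut. *)
Lemma exchange_cut B e f : cycle_indep B -> ~ cycle_indep (e |: B) ->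
  [disjoint gcut f & B] -> e \notin gcut f.
Proof.
move=> indB /existsNP[c /not_implyP[cyc /negP/negPn/allP inB]] disj.
have ec : e \in unzip2 c.
  apply: contraT => ec; case/negP: (indB c cyc); apply/allP => e' e'c.
  have := inB _ e'c; rewrite !inE => /orP[/eqP ee|//].
  by rewrite -ee e'c in ec.
have /and4P[_ _ uc _] := cyc.
have := cycle_even_cut f cyc; rewrite (bigD1_seq e) //= big_seq_cond big1.
  by rewrite addbF => ->.
move=> e' /andP[e'c ne].
have e'B : e' \in B by have := inB _ e'c; rewrite !inE (negPf ne).
exact: (disjointFl disj e'B).
Qed.

(** The clause placing the ends of the edges on the path yields, in the induction, that the edges
    are distinct. The last clause appends an arbitrary edge as a placeholder, because [J] looks only
    at the vertex of its second argument. *)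
Lemma path_edges B x p : path (adj B) x p -> uniq (x :: p) ->
  exists c : seq (vertex G * edge G),
    [/\ unzip1 c = belast x p, all [in B] (unzip2 c), uniq (unzip2 c),
        forall e, e \in unzip2 c ->
          ((ends e).1 \in x :: p) && ((ends e).2 \in x :: p)
      & forall e, sorted J (rcons c (last x p, e))].
Proof.
elim: p x => [|y p IH] x; first by exists [::].
case/andP=> /existsP[e1 /andP[e1B xy]] yp /andP[xp uyp].
have [c [c1 cB uc cV cJ]] := IH y yp uyp; exists ((x, e1) :: c); split.
- by rewrite /= c1.
- by rewrite /= e1B.
- rewrite /= uc andbT; apply: contra xp => /cV /andP[].
  by case/orP: xy => /eqP-> /=.
- move=> e; rewrite inE => /orP[/eqP->|/cV/andP[e1yp e2yp]].
    by case/orP: xy => /eqP-> /=; rewrite !inE !eqxx ?orbT.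
  by rewrite !(in_cons x) e1yp e2yp !orbT.
move=> e; have := cJ e; case: c c1 {cB uc cV cJ} => [|[z e2] c] /=.
  by case: p {IH yp xp uyp} => //= _ _; rewrite /J xy.
by case: p {IH yp xp uyp} => //= t p [-> _] ->; rewrite /J xy.
Qed.

Lemma connect_dep B e : e \notin B ->
  connect (adj B) (ends e).1 (ends e).2 -> ~ cycle_indep (e |: B).
Proof.
move=> eB /connectP[p0 p0P lastp0]; have := lastp0.
case/shortenP: p0P => p pP up _ lastp ind.
have [c [c1 cB uc _ cJ]] := path_edges pP up.
have cyc : graph_cycle (rcons c ((ends e).2, e)).
  apply/and4P; split; first by case: (c).
  - by rewrite /unzip1 map_rcons -/unzip1 c1 /= lastp -lastI.
  - rewrite /unzip2 map_rcons rcons_uniq uc andbT /=.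
    by apply: contra eB => /(allP cB).
  have := cJ e; rewrite -lastp.
  rewrite (cycle_path ((ends e).2, e)) last_rcons.
  case: c c1 {cB uc cJ} => [|z c] /=; last first.
    move=> c1; case: p c1 {pP up lastp} => //= t p [-> _] ->.
    by rewrite andbT /J /= joinsC joins_ends.
  case: p lastp {pP up} => //= lastp _ _; rewrite /J /= andbT.
  by rewrite [X in joins _ X _]lastp joins_ends.
case/negP: (ind _ cyc); rewrite /unzip2 map_rcons all_rcons !inE eqxx /=.
by apply/allP => e' /(allP cB) e'B; rewrite !inE e'B orbT.
Qed.

Lemma cycle_indepS B S : B \subset S -> cycle_indep S -> cycle_indep B.
Proof.
move=> BS indS c cyc; apply: contra (indS c cyc) => /allP cB.
by apply/allP => e /cB /(subsetP BS).
Qed.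

(** A basis avoiding [S] meets every nonempty cut. Conversely, a maximal forest [B] off [S] connects
    the ends of every edge off [S]; if an edge of [S] could still be added to it, the cut around a
    component of [B] would be a nonempty cut inside [S]. *)
Lemma dual_indep_cut S : dual_indep (@cycle_indep G) S <->
  forall f, gcut f \subset S -> gcut f = set0.
Proof.
split=> [[B [indB maxB] SB] f fS|freeS].
  apply/eqP/set0Pn => -[e ef]; have eB : e \notin B.
    by have := subsetP SB _ (subsetP fS _ ef); rewrite inE.
  suff : e \notin gcut f by rewrite ef.
  apply: (@exchange_cut B) => // [ind|].
    have /setP/(_ e) := maxB _ ind (subsetUr _ _).
    by rewrite !inE eqxx (negPf eB).
  by rewrite disjoints_subset; apply: subset_trans fS SB.
pose P (A : {set edge G}) := `[< cycle_indep A >] && (A \subset ~: S).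
have P0 : P set0.
  rewrite /P sub0set andbT; apply/asboolP => c /and4P[c0 _ _ _].
  by case: c c0 => //= x c _; rewrite inE.
have [B /maxsetP[/andP[/asboolP indB BS] maxB] _] := maxset_exists P0.
have linked e : e \notin S -> connect (adj B) (ends e).1 (ends e).2.
  move=> eS; have [eB|eB] := boolP (e \in B).
    by apply/connect1/existsP; exists e; rewrite eB joins_ends.
  have := @exchange_cut B e (connect (adj B) (ends e).1) indB.
  rewrite inE connect0 /= negbK; apply.
    move=> ind; suff BE : e |: B = B by rewrite -BE !inE eqxx in eB.
    apply: maxB; rewrite ?subsetUr // /P subUset sub1set !inE eS BS !andbT.
    exact/asboolP.
  rewrite disjoint_sym disjoint_subset; apply/subsetP => e' e'B.
  have e'12 : connect (adj B) (ends e').1 (ends e').2.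
    by apply/connect1/existsP; exists e'; rewrite e'B joins_ends.
  by rewrite !inE (same_connect_r (adj_sym B) e'12) addbb.
exists B; last by rewrite -disjoints_subset disjoint_sym disjoints_subset.
split=> // S' indS' BS'; apply/eqP; rewrite eqEsubset BS' andbT.
apply/subsetP => e eS'; apply: contraT => eB.
have ind : cycle_indep (e |: B).
  by apply: cycle_indepS indS'; rewrite subUset sub1set eS'.
exfalso; have [eS|eS] := boolP (e \in S); last first.
  suff BE : e |: B = B by rewrite -BE !inE eqxx in eB.
  apply: maxB; rewrite ?subsetUr // /P subUset sub1set !inE eS BS !andbT.
  exact/asboolP.
(* By [linked], only edges of [S] can leave the component of [B] at the first end of [e]. *)
have f0 : gcut (connect (adj B) (ends e).1) = set0.
  apply: freeS; apply/subsetP => e'; rewrite inE;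
    apply: contraLR => /linked e'12.
  by rewrite (same_connect_r (adj_sym B) e'12) addbb.
apply: (connect_dep eB) ind.
by have /setP/(_ e) := f0; rewrite !inE connect0 /= => /negbFE.
Qed.

End Cuts.

(** * A binary code is determined by its matroid *)

Section BinaryCodes.
Variable T : finType.
Implicit Types (X Y S : {set T}) (C D : {set T} -> Prop).

Definition symdiff X Y := [set x | (x \in X) (+) (x \in Y)].

Definition code_free C S := forall X, X \subset S -> C X -> X = set0.

(** A minimal set that is not free is itself a codeword, and it is one for both codes since they
    have the same free sets. Subtracting such a word, contained in [X], from [X] leaves a smaller
    word of [C]. *)
Lemma binary_code_sub C D :
  (forall X Y, C X -> C Y -> C (symdiff X Y)) ->
  D set0 -> (forall X Y, D X -> D Y -> D (symdiff X Y)) ->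
  (forall S, code_free C S <-> code_free D S) ->
  forall X, C X -> D X.
Proof.
move=> CS D0 DS CD X; have [m] := ubnP #|X|; elim: m X => // m IH X Xm CX.
have [->//|X0] := eqVneq X set0.
pose P A := `[< ~ code_free C A >].
have PX : P X by apply/asboolP => /(_ X (subxx _) CX) /eqP; rewrite (negPf X0).
have [A /minsetP[/asboolP nfA minA] AX] := minset_exists PX.
(* Minimality of [A] forces every nonzero codeword inside it to be [A] itself; this is stated for a
   code [E] with the free sets of [C], to be applied to [C] and to [D]. *)
have nf E : (forall S, ~ code_free C S -> ~ code_free E S) ->
    (forall S, ~ code_free E S -> ~ code_free C S) -> E A /\ A != set0.
  move=> CE EC; move/CE/existsNP: nfA => [Y /not_implyP[YA /not_implyP[EY Y0]]].
  suff <- : Y = A by split => //; apply/eqP.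
  apply: minA => //; apply/asboolP/EC => /(_ Y (subxx _) EY) //.
have [CA A0] := nf C (fun _ => id) (fun _ => id).
have [DA _] := nf D (fun S nfC fD => nfC (proj2 (CD S) fD))
  (fun S nfC fD => nfC (proj1 (CD S) fD)).
have -> : X = symdiff (symdiff X A) A by apply/setP => x; rewrite !inE addbK.
apply: DS => //; apply: IH; last exact: CS.
rewrite ltnS in Xm; apply: leq_trans Xm; apply: proper_card; rewrite properE.
have [x xA] := set0Pn _ A0; have xX := subsetP AX x xA; apply/andP; split.
  by apply/subsetP => y; rewrite inE;
    case: (boolP (y \in A)) => [/(subsetP AX)->|]; rewrite ?addbF.
by apply/subsetPn; exists x => //; rewrite inE xX xA.
Qed.

Lemma binary_code_eq C D :
  C set0 -> (forall X Y, C X -> C Y -> C (symdiff X Y)) ->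
  D set0 -> (forall X Y, D X -> D Y -> D (symdiff X Y)) ->
  (forall S, code_free C S <-> code_free D S) ->
  forall X, C X <-> D X.
Proof.
move=> C0 CS D0 DS CD X; split; apply: binary_code_sub => // S.
by split => /CD.
Qed.

End BinaryCodes.

Section Cographic.

Definition cut_code (E V : finType) (a b : E -> V) (T : {set E}) :=
  exists f : V -> bool, T = cut a b f.

Lemma cut_code0 (E V : finType) (a b : E -> V) : cut_code a b set0.
Proof. by exists xpred0; apply/setP => e; rewrite !inE. Qed.

Lemma cut_codeD (E V : finType) (a b : E -> V) X Y :
  cut_code a b X -> cut_code a b Y -> cut_code a b (symdiff X Y).
Proof.
move=> [f ->] [g ->]; exists (fun x => f x (+) g x); apply/setP => e.
by rewrite !inE addbACA.
Qed.

Lemma even_cols0 m n (A : 'M[int]_(m, n)) : even_cols A set0.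
Proof. by apply/forallP => r; rewrite big_set0. Qed.

Lemma big_addb_symdiff (T : finType) (b : T -> bool) (X Y : {set T}) :
  \big[addb/false]_(i in symdiff X Y) b i =
  \big[addb/false]_(i in X) b i (+) \big[addb/false]_(i in Y) b i.
Proof.
rewrite big_mkcond [in RHS]big_mkcond [X in _ (+) X]big_mkcond -big_split /=.
by apply: eq_bigr => i _; rewrite inE; case: (i \in X); case: (i \in Y);
  rewrite /= ?addbb ?addbF.
Qed.

Lemma even_colsD m n (A : 'M[int]_(m, n)) X Y :
  even_cols A X -> even_cols A Y -> even_cols A (symdiff X Y).
Proof.
move=> /forallP eX /forallP eY; apply/forallP => r.
by rewrite big_addb_symdiff (negPf (eX r)) (negPf (eY r)).
Qed.

(** The independent sets of both matroids are the free sets of a binary code: the parity code for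
    the columns, the cut space for the dual of a cycle matroid. Equal free sets give equal codes.
    Conversely, [a] and [b] are the end maps of a multigraph whose edges are the columns. *)
Lemma cographic_cut_code (R : realType) m n (A : 'M[int]_(m, n)) : tu A ->
  cographic (column_indep (map_mx intr A : 'M[R]_(m, n))) <->
  exists (V : finType) (a b : 'I_n -> V),
    forall T, even_cols A T <-> cut_code a b T.
Proof.
move=> tuA; split=> [[G [h bij_h hP]]|[V [a [b abP]]]].
  exists (vertex G), (fun i => (ends (h i)).1), (fun i => (ends (h i)).2).
  apply: binary_code_eq.
  - exact: even_cols0.
  - exact: even_colsD.
  - exact: cut_code0.
  - exact: cut_codeD.
  have [k hK kK] := bij_h; have inj_h := can_inj hK.
  move=> S; rewrite /code_free -(@column_indep_even R) // hP dual_indep_cut.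
  have cutE f : cut (fun e => (ends e).1) (fun e => (ends e).2) f =
      h @: cut (fun i => (ends (h i)).1) (fun i => (ends (h i)).2) f.
    by apply/setP => e; rewrite -[e]kK mem_imset // !inE.
  split=> [freeS X XS [f XE]|freeS f].
    have := freeS f; rewrite cutE -XE imsetS // => /(_ isT) /eqP.
    by rewrite imset_eq0 => /eqP.
  rewrite cutE => fS; rewrite (freeS (cut _ _ f)) ?imset0 //; last by exists f.
  apply/subsetP => i fi; have := subsetP fS (h i); rewrite !mem_imset //.
  exact.
exists (Multigraph (fun i => (a i, b i))), id; first by exists id.
move=> S; rewrite imset_id dual_indep_cut column_indep_even //.
split=> [freeS f fS|freeS T TS /abP[f TE]].
  by apply: freeS => //; apply/abP; exists f.
by rewrite TE; apply: freeS; rewrite -TE.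
Qed.

End Cographic.

(** * Uniqueness of totally unimodular representations *)

Section UniqueSigning.
Local Open Scope ring_scope.

(** A walk between rows in the bipartite graph of nonzero entries, restricted to the columns below
    [k]; each step records the column used and the row reached. *)
Fixpoint row_chain m n (A : 'M[int]_(m, n)) k i (p : seq ('I_n * 'I_m)) :=
  if p is (c, r) :: p' then
    [&& (c < k)%N, A i c != 0, A r c != 0 & row_chain A k r p']
  else true.

Lemma row_chain_catr m n (A : 'M[int]_(m, n)) k i p c r q :
  row_chain A k i (p ++ (c, r) :: q) ->
  [/\ (c < k)%N, A r c != 0 & row_chain A k r q].
Proof.
elim: p i => [|[c' r'] p IH] i /=; first by case/and4P.
by case/and4P=> _ _ _ /IH.
Qed.

Lemma eq_row_chain m n (A B : 'M[int]_(m, n)) k i p :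
  (forall q l, q \in p -> A l q.1 = B l q.1) ->
  row_chain A k i p -> row_chain B k i p.
Proof.
elim: p i => [|[c r] p IH] i //= AB /and4P[ck Aic Arc chain].
rewrite ck -!(AB (c, r)) ?mem_head // Aic Arc /=; apply: IH => // q l qp.
by apply: AB; rewrite inE qp orbT.
Qed.

Lemma sign_opp_sub (x y t : int) :
  x \in [:: 0; 1; -1] -> y \in [:: 0; 1; -1] -> t \in [:: 0; 1; -1] ->
  x - t \in [:: 0; 1; -1] -> y - t \in [:: 0; 1; -1] ->
  x != 0 -> x = - y -> t = 0.
Proof.
by rewrite !inE => /or3P[] /eqP-> /or3P[] /eqP-> /or3P[] /eqP->.
Qed.

Lemma sign_sub_parity (x y t : int) :
  x \in [:: 0; 1; -1] -> y \in [:: 0; 1; -1] -> t \in [:: 0; 1; -1] ->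
  x - t \in [:: 0; 1; -1] -> y - t \in [:: 0; 1; -1] ->
  (x != 0) = (y != 0) -> (x - t != 0) = (y - t != 0).
Proof.
by rewrite !inE => /or3P[] /eqP-> /or3P[] /eqP-> /or3P[] /eqP->.
Qed.

(* Pivoting on the first entry of a chordless chain of rows joining an agreement
   to a disagreement of the columns [c0] shortens the chain; at length one an
   entry of absolute value two appears. *)
Lemma no_chain m n (c0 : 'I_n) k p : forall (A B : 'M[int]_(m, n)) i,
  tu A -> tu B -> (forall i (j : 'I_n), (j < k)%N -> A i j = B i j) ->
  (forall i, (A i c0 != 0) = (B i c0 != 0)) ->
  A i c0 != 0 -> A i c0 = B i c0 -> row_chain A k i p ->
  let j := last i (unzip2 p) in A j c0 != 0 -> A j c0 = - B j c0 -> False.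
Proof.
have [s] := ubnP (size p); elim: s p => // s IH [|[c r] p] ps A B i tuA tuB AB
  eq0 Ai ABi /=; first by move=> _ Aj; rewrite -ABi => e; move: Aj; lia.
case/and4P=> ck Aic Arc chain Aj ABj.
have [Ar_ok|Ar_bad] := boolP ((A r c0 != 0) && (A r c0 == B r c0)).
  case/andP: Ar_ok => Ar /eqP ABr.
  exact: (IH p ps A B r tuA tuB AB eq0 Ar ABr chain Aj ABj).
(* If a later column of the chain meets row [i], the part before it can be skipped. Otherwise those
   columns vanish in row [i], and the pivot leaves them unchanged. *)
have [/hasP[[c' r'] qp /= Aic']|noshort] := boolP (has (fun q =>
  A i q.1 != 0) p).
  move: ps chain Aj ABj; case/splitPr: qp => p1 p2 ps chain Aj ABj.
  have [c'k Ar'c' chain'] := row_chain_catr chain.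
  apply: (IH ((c', r') :: p2) _ A B i tuA tuB AB eq0 Ai ABi _ _ _).
  - by move: ps; rewrite /= size_cat /=; lia.
  - by rewrite /= c'k Aic' Ar'c'.
  - by move: Aj; rewrite /unzip2 map_cat last_cat.
  - by move: ABj; rewrite /unzip2 map_cat last_cat.
have Bic : B i c != 0 by rewrite -AB.
have tuA' := tu_pivot tuA Aic; have tuB' := tu_pivot tuB Bic.
have ri : r != i.
  by apply: contraNneq Ar_bad => ->; rewrite Ai ABi eqxx.
have ji : last r (unzip2 p) != i.
  by apply/eqP => e; move: Ai ABj; rewrite e -ABi; lia.
have Ae l : A l c0 \in [:: 0; 1; -1] by exact: tu_entry.
have Be l : B l c0 \in [:: 0; 1; -1] by exact: tu_entry.
have A'e l := tu_entry l c0 tuA'; have B'e l := tu_entry l c0 tuB'.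
pose t l := A l c * A i c * A i c0.
have te l : t l \in [:: 0; 1; -1] by rewrite !sign_int_mul // tu_entry.
have A'E l : l != i -> pivot A i c l c0 = A l c0 - t l.
  by move=> li; rewrite mxE (negPf li).
have B'E l : l != i -> pivot B i c l c0 = B l c0 - t l.
  by move=> li; rewrite mxE (negPf li) -!(AB _ c) // -ABi.
(* At a disagreement the pivoted entries are [x - t] and [-x - t] with [x] nonzero; one of them has
   absolute value two unless [t] vanishes. *)
have bad l : l != i -> A l c0 != 0 -> A l c0 = - B l c0 -> A l c = 0.
  move=> li Al ABl; have /eqP : t l = 0.
    apply: (sign_opp_sub (Ae l) (Be l)) => //; first by rewrite -A'E.
    by rewrite -B'E.
  by rewrite !mulf_eq0 (negPf Aic) (negPf Ai) !orbF => /eqP.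
(* As [A r c] is nonzero, row [r] is no disagreement, and it is no agreement by [Ar_bad]. After the
   pivot both matrices have the same nonzero entry there, so [r] starts the shorter chain. *)
have Ar0 : A r c0 = 0.
  apply/eqP; apply: contraT => Ar; move: Arc; rewrite (bad r) ?eqxx //.
  have := eq0 r; rewrite Ar => /esym Br; move: Ar_bad; rewrite Ar /=.
  by have := Ae r; have := Be r; move: Ar Br; rewrite !inE; lia.
have Br0 : B r c0 = 0 by apply/eqP; rewrite -[_ == _]negbK -eq0 Ar0 eqxx.
have A'r : pivot A i c r c0 != 0.
  by rewrite A'E // Ar0 sub0r oppr_eq0 !mulf_neq0.
apply: (IH p ps (pivot A i c) (pivot B i c) r) => //.
- by move=> l j jk; rewrite !mxE !(AB _ j) // -!(AB _ c).
- move=> l; have [->|li] := eqVneq l i;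
  first by rewrite !mxE eqxx -(AB _ c) // -ABi.
  rewrite A'E // B'E //; apply: sign_sub_parity => //; first by rewrite -A'E.
  by rewrite -B'E.
- by rewrite A'E // B'E // Ar0 Br0.
- apply: eq_row_chain chain => q l qp.
  have Aiq : A i q.1 = 0.
    by apply/eqP; apply: contraNT noshort => Aiq; apply/hasP; exists q.
  by rewrite mxE Aiq !mulr0 subr0; case: eqP => // ->.
- by rewrite A'E // /t (bad _ ji Aj ABj) !mul0r subr0.
- by rewrite A'E // B'E // /t (bad _ ji Aj ABj) !mul0r !subr0.
Qed.

(** [K] collects the rows linked, through earlier columns, to a row where column [c0] agrees; by
    [no_chain] it contains no disagreement. Changing the signs of the rows outside [K] and of the
    earlier columns not meeting [K] corrects column [c0] and keeps the earlier ones, since none of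
    them meets both [K] and its complement. *)
Lemma agree_step m n (c0 : 'I_n) (A B : 'M[int]_(m, n)) :
  tu A -> tu B -> (forall i (j : 'I_n), (j < c0)%N -> A i j = B i j) ->
  (forall i, (A i c0 != 0) = (B i c0 != 0)) ->
  exists r : 'I_m -> int, exists d : 'I_n -> int,
    [/\ forall i, r i \in [:: 1; -1], forall j, d j \in [:: 1; -1]
      & forall i (j : 'I_n), (j <= c0)%N -> B i j = r i * A i j * d j].
Proof.
move=> tuA tuB AB eq0.
pose adj i r := [exists c : 'I_n, [&& (c < c0)%N, A i c != 0 & A r c != 0]].
pose K i := [exists i0, [&& A i0 c0 != 0,
  A i0 c0 == B i0 c0 & connect adj i0 i]].
pose d (j : 'I_n) : int :=
  if (j == c0) || [exists i, K i && (A i j != 0)] then 1 else -1.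
exists (fun i => if K i then 1 else -1), d; split=> [i|j|i j].
- by case: (K i).
- by rewrite /d; case: ifP.
have [->{j} _|jc jc0] := eqVneq j c0.
  rewrite /d eqxx /= mulr1; have [Ai|Ai] := eqVneq (A i c0) 0.
    by rewrite Ai mulr0; apply/eqP; rewrite -[_ == _]negbK -eq0 Ai eqxx.
  have Bi : B i c0 != 0 by rewrite -eq0.
  have ABi : A i c0 = B i c0 \/ A i c0 = - B i c0.
    have := tu_entry i c0 tuA; have := tu_entry i c0 tuB.
    by move: Ai Bi; rewrite !inE; lia.
  have [/existsP[i0 /and3P[Ai0 /eqP ABi0 /connectP[p pP ip]]]|nK] := boolP (K
    i).
    rewrite mul1r; case: ABi => // ABi; exfalso.
    have [q qP iq] : exists2 q, row_chain A c0 i0 q & last i0 (unzip2 q) = i.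
      rewrite {}ip {ABi Bi Ai Ai0 ABi0 i}.
      elim: p i0 pP => [|r p IH] i0 /=; first by exists [::].
      case/andP=> /existsP[c cP] /IH[q qP <-]; exists ((c, r) :: q) => //=.
      by case/and3P: cP => -> -> ->.
    by apply: (no_chain tuA tuB AB eq0 Ai0 ABi0 qP); rewrite iq.
  case: ABi => [ABi|->]; last by rewrite mulN1r opprK.
  case/negP: nK; apply/existsP; exists i.
  by rewrite Ai ABi eqxx connect0.
have {}jc0 : (j < c0)%N by rewrite ltn_neqAle jc0 andbT.
rewrite -AB //; have [->|Aij] := eqVneq (A i j) 0; first by rewrite mulr0 mul0r.
rewrite /d (negPf jc) /=; have [Ki|nK] := boolP (K i).
  by rewrite ifT ?mul1r ?mulr1 //; apply/existsP; exists i; rewrite Ki.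
rewrite ifF; first by rewrite mulN1r mulrN1 opprK.
apply: contraNF nK => /existsP[r /andP[/existsP[i0 /and3P[Ai0 ABi0 con]] Arj]].
apply/existsP; exists i0; rewrite Ai0 ABi0; apply: connect_trans con _.
by apply/connect1/existsP; exists j; rewrite jc0 Arj.
Qed.

(* Camion's theorem. *)
Lemma tu_signing m n (A B : 'M[int]_(m, n)) :
  tu A -> tu B -> (forall i j, (A i j != 0) = (B i j != 0)) ->
  exists r : 'I_m -> int, exists d : 'I_n -> int,
    [/\ forall i, r i \in [:: 1; -1], forall j, d j \in [:: 1; -1]
      & forall i j, B i j = r i * A i j * d j].
Proof.
move=> tuA tuB eq0.
have sneq0 (x : int) : x \in [:: 1;
  -1] -> x != 0 by rewrite !inE => /orP[] /eqP->.
suff /(_ n) : forall k, (k <= n)%N -> exists r : 'I_m -> int,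
    exists d : 'I_n -> int,
    [/\ forall i, r i \in [:: 1; -1], forall j, d j \in [:: 1; -1]
      & forall i (j : 'I_n), (j < k)%N -> B i j = r i * A i j * d j].
  by case=> // r [d [sr sd BE]]; exists r, d; split=> // i j; apply: BE.
elim=> [_|k IH kn]; first by exists (fun=> 1), (fun=> 1); split.
have [r [d [sr sd BE]]] := IH (ltnW kn).
pose A1 : 'M[int]_(m, n) := \matrix_(i, j) (r i * A i j * d j).
have tuA1 : tu A1 by apply: (tu_scale sr sd) tuA => i j; rewrite mxE.
have [||r1 [d1 [sr1 sd1 BE1]]] := @agree_step _ _ (Ordinal kn) A1 B tuA1 tuB.
- by move=> i j /= jk; rewrite mxE BE.
- move=> i; rewrite mxE -eq0 !mulf_eq0 !negb_or andbC andbA.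
  by rewrite (sneq0 _ (sr _)) (sneq0 _ (sd _)).
exists (fun i => r1 i * r i), (fun j => d j * d1 j).
have smul (x y : int) : x \in [:: 1; -1] -> y \in [:: 1;
  -1] -> x * y \in [:: 1; -1].
  by rewrite !inE => /orP[] /eqP-> /orP[] /eqP->.
split=> [i|j|i j jk]; [exact: smul|exact: smul|].
by rewrite BE1 // mxE !mulrA.
Qed.

End UniqueSigning.

(** * Simultaneous elimination of two matrices with the same code, and a signing test for total
    unimodularity *)

Section UniqueRepresentation.
Local Open Scope ring_scope.

Lemma even_cols_mul m n (X : 'M[int]_m) (A : 'M[int]_(m, n)) T :
  X \in unitmx -> tu A -> tu (X *m A) -> even_cols (X *m A) T = even_cols A T.
Proof.
move=> unitX tuA tuXA; rewrite (even_colsE _ tuA) (even_colsE _ tuXA).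
set v := (\col_i _); have -> : map_mx intr (X *m A) *m v =
    map_mx intr X *m (map_mx intr A *m v) by rewrite mulmxA -map_mxM.
apply/eqP/eqP => [XA0|->]; last by rewrite mulmx0.
rewrite -[LHS]mul1mx -[1%:M](map_mx1 intr) -(mulVmx unitX).
by rewrite map_mxM -mulmxA XA0 mulmx0.
Qed.

(** The state of the elimination after [k] pivots: the first [k] unit vectors occupy the columns
    [s t]. *)
Definition unit_cols m n (A : 'M[int]_(m, n)) k (s : 'I_m -> 'I_n) :=
  forall i t : 'I_m, (t < k)%N -> A i (s t) = (i == t)%:R.

Lemma unit_cols_inj m n (A : 'M[int]_(m, n)) k s (t u : 'I_m) :
  unit_cols A k s -> (t < k)%N -> (u < k)%N -> s t = s u -> t = u.
Proof.
move=> uc tk uk stu; have := uc t t tk; rewrite stu uc // eqxx.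
by case: eqP.
Qed.

Lemma unit_cols_even m n (A : 'M[int]_(m, n)) k s c (U : {set 'I_m}) r :
  unit_cols A k s -> (forall t, t \in U -> (t < k)%N) ->
  \big[addb/false]_(j in symdiff [set c] (s @: U)) (A r j != 0) =
  (A r c != 0) (+) (r \in U).
Proof.
move=> uc Uk; rewrite big_addb_symdiff big_set1; congr (_ (+) _).
rewrite big_imset /=; last first.
  by move=> t u tU uU; apply: (unit_cols_inj uc); apply: Uk.
have [rU|rU] := boolP (r \in U).
  rewrite (bigD1 r) //= uc ?Uk // eqxx big1 ?addbF // => t /andP[tU tr].
  by rewrite uc ?Uk // [r == t]eq_sym (negPf tr).
rewrite big1 // => t tU; rewrite uc ?Uk //; case: (eqVneq r t) => // rt.
by rewrite rt tU in rU.
Qed.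

(** Column [c] of [A] is, mod 2, a sum of unit columns. This relation is a word of the common code,
    and read in [B] it gives the support of column [c] there. *)
Lemma same_even_zero m n (A B : 'M[int]_(m, n)) k s c :
  unit_cols A k s -> unit_cols B k s ->
  (forall T, even_cols A T = even_cols B T) ->
  (forall i : 'I_m, (k <= i)%N -> A i c = 0) ->
  forall i, (A i c != 0) = (B i c != 0).
Proof.
move=> ucA ucB AB A0 i.
pose U := [set t : 'I_m | (t < k)%N & A t c != 0].
have Uk t : t \in U -> (t < k)%N by rewrite inE => /andP[].
have : even_cols B (symdiff [set c] (s @: U)).
  rewrite -AB; apply/forallP => r; rewrite (unit_cols_even _ _ ucA) // inE.
  by case: ltnP => [|/A0->]; rewrite ?eqxx ?addbb.
move/forallP/(_ i); rewrite (unit_cols_even _ _ ucB) // inE.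
case: ltnP => [_|/A0->] /=; last by rewrite addbF => /negPf->.
by case: (A i c != 0) (B i c != 0) => [] [].
Qed.

(** Since [k <= i], row [i] vanishes on the unit columns already present and the pivot does not
    disturb them; the transposition brings the new unit vector to position [k]. *)
Lemma unit_cols_pivot m n (A : 'M[int]_(m, n)) k s c (i k' : 'I_m) :
  tu A -> unit_cols A k s -> k = k' :> nat -> (k <= i)%N -> A i c != 0 ->
  unit_cols (row_perm (tperm i k') (pivot A i c)) k.+1
    (fun t => if t == k' then c else s t).
Proof.
move=> tuA uc kk' ki Aic j t.
have AA : A i c * A i c = 1 by rewrite sign_int_sq // tu_entry.
rewrite mxE ltnS leq_eqVlt {1}kk' val_eqE.
have [-> _|tk' /= tk] := eqVneq t k'.
  have -> : (j == k') = (tperm i k' j == i).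
    by rewrite -(inj_eq (@perm_inj _ (tperm i k')) j k') tpermR.
  rewrite mxE; case: (eqVneq (tperm i k' j) i) => _; first by rewrite AA.
  by rewrite -mulrA AA mulr1 subrr.
have it : (i == t) = false by apply: contraTF tk => /eqP<-; rewrite -leqNgt.
have -> : (j == t) = (tperm i k' j == t).
  rewrite -(inj_eq (@perm_inj _ (tperm i k')) j t) [tperm i k' t]tpermD ?it //.
  by rewrite eq_sym.
have Ais : A i (s t) = 0 by rewrite uc // it.
rewrite mxE Ais !mulr0 subr0 uc //.
by case: (eqVneq (tperm i k' j) i) => [->|_]; rewrite ?it.
Qed.

Lemma same_support_equiv m n (A B : 'M[int]_(m, n)) :
  tu A -> tu B -> (forall i j, (A i j != 0) = (B i j != 0)) ->
  exists X : 'M[int]_m, exists d : 'rV[int]_n,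
    [/\ X \in unitmx, forall j, d 0 j \in [:: 1; -1]
      & B = X *m A *m diag_mx d].
Proof.
move=> tuA tuB eq0; have [r [d [sr sd BE]]] := tu_signing tuA tuB eq0.
exists (diag_mx (\row_i r i)), (\row_j d j); split=> [|j|].
- rewrite unitmxE det_diag unitr_prod // => i _; rewrite mxE unit_int_sign.
  by have := sr i; rewrite !inE.
- by rewrite mxE.
- by apply/matrixP => i j; rewrite mul_mx_diag mul_diag_mx !mxE BE.
Qed.

(** Both matrices are pivoted in the same columns, possibly in different rows. When no pivot
    remains, [same_even_zero] applies to every column, the supports coincide, and [tu_signing]
    concludes. In [gen], [q] bounds the number of pivots left. *)
Lemma same_code_equiv m n (A B : 'M[int]_(m, n)) :
  tu A -> tu B -> (forall T, even_cols A T = even_cols B T) ->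
  exists X : 'M[int]_m, exists d : 'rV[int]_n,
    [/\ X \in unitmx, forall j, d 0 j \in [:: 1; -1]
      & B = X *m A *m diag_mx d].
Proof.
move=> tuA tuB AB.
suff gen q : forall k (A B : 'M[int]_(m, n)) s, (m <= k + q)%N ->
    tu A -> tu B -> (forall T, even_cols A T = even_cols B T) ->
    unit_cols A k s -> unit_cols B k s ->
    exists X : 'M[int]_m, exists d : 'rV[int]_n,
    [/\ X \in unitmx, forall j, d 0 j \in [:: 1; -1]
      & B = X *m A *m diag_mx d].
  (* With [k = 0] any [s] will do, here a constant one; without columns there is no entry to
     compare. *)
  have [c _|n0] := pickP (fun _ : 'I_n => true).
    by apply: (gen m 0 A B (fun=> c)) => // i t.
  by apply: same_support_equiv => // i j; have := n0 j.
elim: q => [|q IH] k {}A {}B s mkq {}tuA {}tuB {}AB ucA ucB.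
  apply: same_support_equiv => // i j; apply: (same_even_zero ucA ucB) => // l.
  by have := ltn_ord l; rewrite addn0 in mkq; lia.
have [/existsP[i /existsP[c /andP[ki Aic]]]|none] :=
    boolP [exists i : 'I_m, exists c, (k <= i)%N && (A i c != 0)]; last first.
  apply: same_support_equiv => // i j;
    apply: (same_even_zero ucA ucB) => // l kl.
  apply/eqP; apply: contraNT none => Alj.
  by apply/existsP; exists l; apply/existsP; exists j; rewrite kl.
(* If column [c] of [B] vanished in all rows from [k] on, its support would agree with that of
   column [c] of [A], against [A i c] being nonzero. *)
have [i' ki' Bic] : exists2 i' : 'I_m, (k <= i')%N & B i' c != 0.
  apply: contrapT => nB; move: Aic.
  rewrite -(same_even_zero ucB ucA (c := c)) // => [Bic|l kl].
    by apply: nB; exists i.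
  by apply/eqP; apply: contraT => Blc; exfalso; apply: nB; exists l.
pose k' := Ordinal (leq_ltn_trans ki (ltn_ord i)).
have red (M : 'M[int]_(m, n)) r : tu M -> M r c != 0 -> exists2 Y : 'M[int]_m,
    Y \in unitmx & row_perm (tperm r k') (pivot M r c) = Y *m M.
  move=> tuM Mrc; exists (perm_mx (tperm r k') *m pivotmx M r c).
    by rewrite unitmx_mul unitmx_perm pivotmx_unit.
  by rewrite row_permE pivotE mulmxA.
have ucA1 := unit_cols_pivot tuA ucA (erefl : k = k' :> nat) ki Aic.
have ucB1 := unit_cols_pivot tuB ucB (erefl : k = k' :> nat) ki' Bic.
have tuA1 := tu_rowperm (tperm i k') (tu_pivot tuA Aic).
have tuB1 := tu_rowperm (tperm i' k') (tu_pivot tuB Bic).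
have [Y unitY YA] := red A i tuA Aic; have [Z unitZ ZB] := red B i' tuB Bic.
rewrite YA in ucA1 tuA1; rewrite ZB in ucB1 tuB1.
have [||X [d [unitX sd BE]]] := IH _ _ _ _ _ tuA1 tuB1 _ ucA1 ucB1.
- by rewrite addSnnS.
- by move=> T; rewrite !even_cols_mul.
exists (invmx Z *m X *m Y), d; split=> //.
  by rewrite !unitmx_mul unitmx_inv unitX unitY unitZ.
by rewrite -[LHS](mulKmx unitZ) BE !mulmxA.
Qed.

(* Ghouila-Houri's criterion. *)
Lemma row_sum_tu m n (A : 'M[int]_(m, n)) :
  (forall U : {set 'I_m}, exists y : 'rV[int]_m,
     [/\ forall i, y 0 i \in [:: 0; 1; -1],
        forall i, (y 0 i != 0) = (i \in U)
      & forall j, (y *m A) 0 j \in [:: 0; 1; -1]]) ->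
  tu A.
Proof.
move=> sgn; elim=> [|k IH] f h inj_f inj_h;
  first by rewrite det_mx00 !inE eqxx ?orbT.
set B := mxsub f h A; set d := \det B.
(* The first row of the adjugate satisfies [b B = d e_0], and its entries are signed smaller minors,
   hence in {0, 1, -1} by induction. *)
pose b : 'rV[int]_k.+1 := row 0 (\adj B).
have bB : b *m B = d *: delta_mx 0 0.
  rewrite /b -row_mul mul_adj_mx -/d; apply/rowP => j; rewrite !mxE eqxx /=.
  by rewrite eq_sym mulr_natr.
have bs i : b 0 i \in [:: 0; 1; -1].
  rewrite !mxE /cofactor; apply: sign_int_mul.
    by rewrite -signr_odd; case: odd.
  have -> : row' i (col' 0 B) = mxsub (f \o lift i) (h \o lift 0) A.
    by apply/matrixP => r l; rewrite !mxE.
  by apply: IH; apply: inj_comp => //; apply: lift_inj.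
(* The signing of the support of [b] gives a vector [z] with that same support, hence congruent to
   [b] mod 2. So [z B] is even off column 0 and, being bounded by 1, vanishes there. Then
   [d z = t b] with [t] in {0, 1, -1}, and [d] is [t] up to sign. *)
have [y [ys yU yA]] := sgn [set f i | i in [set i | b 0 i != 0]].
pose z : 'rV[int]_k.+1 := \row_i y 0 (f i).
have zb i : (z 0 i != 0) = (b 0 i != 0) by rewrite mxE yU mem_imset // inE.
have zs i : z 0 i \in [:: 0; 1; -1] by rewrite mxE.
have zB j : (z *m B) 0 j = (y *m A) 0 (h j).
  rewrite !mxE [RHS](bigID (mem (f @: setT))) /= [X in _ = _ + X]big1 ?addr0.
    rewrite big_imset /=; last by move=> ? ? _ _; apply: inj_f.
    by apply: eq_big => [i|i _]; rewrite ?inE ?mxE.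
  move=> r rf; have [->|yr] := eqVneq (y 0 r) 0; first by rewrite mul0r.
  move: yr; rewrite yU => /imsetP[i _ ri].
  by move: rf; rewrite ri mem_imset // inE.
have [d0|d0] := eqVneq d 0; first by rewrite d0 !inE eqxx.
pose w : 'rV[int]_k.+1 := \row_i (if z 0 i == b 0 i then 0 else z 0 i).
have zw : z = b + w + w.
  apply/rowP => i; rewrite [RHS]mxE [(b + w) 0 i]mxE [w 0 i]mxE.
  move: (zs i) (bs i) (zb i); move: (z 0 i) (b 0 i) => x x'.
  by rewrite !inE => /or3P[] /eqP-> /or3P[] /eqP->.
have zB0 j : j != 0 -> (z *m B) 0 j = 0.
  move=> j0; have : (z *m B) 0 j \in [:: 0; 1; -1] by rewrite zB.
  rewrite zw !mulmxDl bB !mxE (negPf j0) andbF mulr0 add0r !inE.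
  by move: (\sum__ _); lia.
have zBE : z *m B = (z *m B) 0 0 *: delta_mx 0 0.
  apply/rowP => j; rewrite [RHS]mxE [delta_mx _ _ _ _]mxE /=.
  by have [->|/zB0->] := eqVneq j 0; rewrite ?mulr1 ?mulr0.
have dz : d *: z = (z *m B) 0 0 *: b.
  have := congr1 (mulmx^~ (\adj B)) zBE; rewrite -mulmxA mul_mx_adj.
  by rewrite mul_mx_scalar -scalemxAl -rowE.
have [i bi] : exists i, b 0 i != 0.
  apply/existsP; apply: contraNT d0; rewrite negb_exists => /forallP b0.
  have b00 : b = 0 by apply/rowP => i; rewrite [RHS]mxE; apply/eqP/negPn/b0.
  by move/rowP/(_ 0): bB; rewrite b00 mul0mx !mxE /= mulr1 => <-.
have := zB 0; move/rowP/(_ i): dz; rewrite mxE [RHS]mxE => dzi zB00.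
move: dzi; have := yA (h 0); rewrite -zB00.
have := zb i; rewrite bi; move: bi (zs i) (bs i).
move: (z 0 i) (b 0 i) ((z *m B) 0 0) => x x' t.
rewrite !inE => x'0 /or3P[] /eqP-> /or3P[] x'E //; move/eqP: x'E x'0 => ->// _;
  by move=> _ /or3P[] /eqP->; lia.
Qed.

End UniqueRepresentation.

(** * Binary point sets *)

HB.instance Definition _ :=
  Monoid.isComLaw.Build N 0%num N.lxor (fun x y z => esym (N.lxor_assoc x y z))
    N.lxor_comm N.lxor_0_l.

Section BitVectors.

Definition bit (x : N) (i : nat) := N.testbit x (N.of_nat i).

(* Vectors of F_2^g are encoded as bit masks. *)
Definition small g (x : N) := N.shiftr x (N.of_nat g) == 0%num.

Lemma bitD x y i : bit (N.lxor x y) i = bit x i (+) bit y i.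
Proof. by rewrite /bit N.lxor_spec; case: N.testbit; case: N.testbit. Qed.

Lemma bit0 i : bit 0%num i = false.
Proof. exact: N.bits_0. Qed.

Lemma bit_pow i j : bit (N.shiftl 1 (N.of_nat i)) j = (i == j).
Proof.
rewrite /bit N.shiftl_1_l N.pow2_bits_eqb; apply/N.eqb_spec/eqP; lia.
Qed.

Lemma smallD g x y : small g x -> small g y -> small g (N.lxor x y).
Proof. by rewrite /small N.shiftr_lxor => /eqP-> /eqP->. Qed.

Lemma small0 g : small g 0%num.
Proof. by rewrite /small N.shiftr_0_l. Qed.

Lemma bit_small g x i : small g x -> (g <= i)%N -> bit x i = false.
Proof.
move=> /eqP xg gi; have := N.shiftr_spec x (N.of_nat g) (N.of_nat (i - g)).
have -> : (N.of_nat (i - g) + N.of_nat g)%num = N.of_nat i by lia.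
by rewrite xg N.bits_0 /bit => <- //; apply: N.le_0_l.
Qed.

Lemma smallP g x : reflect (forall i, (g <= i)%N ->
  bit x i = false) (small g x).
Proof.
apply: (iffP idP) => [xg i|x0]; first exact: bit_small.
apply/eqP/N.bits_inj => i; rewrite N.bits_0 N.shiftr_spec; last lia.
have := x0 (N.to_nat i + g)%N (leq_addl _ _); rewrite /bit => <-.
by congr (N.testbit x _); lia.
Qed.

Lemma bit_inj g x y : small g x -> small g y ->
  (forall i, (i < g)%N -> bit x i = bit y i) -> x = y.
Proof.
move=> xg yg xy; apply/N.bits_inj => i; rewrite -[i]Nnat.N2Nat.id.
have [/xy//|gi] := ltnP (N.to_nat i) g.
by have := bit_small xg gi; have := bit_small yg gi; rewrite /bit => -> ->.
Qed.

Lemma small_pow g i : (i < g)%N -> small g (N.shiftl 1 (N.of_nat i)).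
Proof. by move=> ig; apply/smallP => j gj; rewrite bit_pow; lia. Qed.

Lemma lxor_eq0 x y : (N.lxor x y == 0%num) = (x == y).
Proof. by apply/eqP/eqP => [/N.lxor_eq|->]; rewrite ?N.lxor_nilpotent. Qed.

Lemma bit_big (I : Type) (r : seq I) (P : pred I) (F : I -> N) i :
  bit (\big[N.lxor/0%num]_(j <- r | P j) F j) i =
  \big[addb/false]_(j <- r | P j) bit (F j) i.
Proof.
by apply: (big_morph (bit^~ i)) => [x y|]; rewrite ?bit0 ?bitD.
Qed.

Lemma small_big g (I : Type) (r : seq I) (P : pred I) (F : I -> N) :
  (forall j, P j -> small g (F j)) ->
  small g (\big[N.lxor/0%num]_(j <- r | P j) F j).
Proof.
move=> sF; elim/big_ind: _ => [|x y|j /sF //]; first exact: small0.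
exact: smallD.
Qed.

Definition points g := [seq N.of_nat i | i <- iota 0 (2 ^ g)].

Lemma of_nat_pow2 g : N.of_nat (2 ^ g) = (2 ^ N.of_nat g)%num.
Proof.
elim: g => // g IH; rewrite Nnat.Nat2N.inj_succ N.pow_succ_r' -IH expnS; lia.
Qed.

Lemma small_ltn g x : small g x = (N.to_nat x < 2 ^ g)%N.
Proof.
have pow0 : (2 ^ N.of_nat g)%num <> 0%num by apply: N.pow_nonzero.
rewrite /small N.shiftr_div_pow2; apply/eqP/idP.
  by move/(N.div_small_iff _ _ pow0); rewrite -of_nat_pow2; lia.
by move=> xg; apply/(N.div_small_iff _ _ pow0); rewrite -of_nat_pow2; lia.
Qed.

Lemma mem_points g x : (x \in points g) = small g x.
Proof.
rewrite small_ltn; apply/mapP/idP => [[i + ->]|xg].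
  by rewrite mem_iota Nnat.Nat2N.id.
by exists (N.to_nat x); rewrite ?mem_iota ?Nnat.N2Nat.id.
Qed.

Lemma points_uniq g : uniq (points g).
Proof. by rewrite map_inj_uniq ?iota_uniq //; apply: Nnat.Nat2N.inj. Qed.

End BitVectors.

(** * Point sets whose code is a cut space *)

Section CutCodes.
Implicit Types (s t u : seq N) (T : pred N).

Definition xorsum T s := \big[N.lxor/0%num]_(x <- s | T x) x.

(* The sets of points of [s] with zero sum are the cuts of a graph whose edges
   are the points of [s]. *)
Definition cutlike s := exists (V : finType) (a b : N -> V), forall T,
  xorsum T s = 0%num <->
  exists f : V -> bool, {in s, forall x, T x = f (a x) (+) f (b x)}.

Lemma cutlike_perm s t : perm_eq s t -> cutlike s -> cutlike t.
Proof.
move=> st [V [a [b ab]]]; exists V, a, b => T.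
rewrite /xorsum -(perm_big _ st) /= -/(xorsum T s) ab.
by split=> -[f fP]; exists f => x; have := fP x; rewrite (perm_mem st).
Qed.

(** Contraction of the edge [w], here by sending the end [b w] to [a w]: the cuts of the contraction
    are the cuts not containing [w], and these are the zero sums avoiding [w]. *)
Lemma cutlike_behead w s : uniq (w :: s) -> cutlike (w :: s) -> cutlike s.
Proof.
move=> /andP[ws us] [V [a [b ab]]].
pose h z := if z == b w then a w else z.
exists V, (h \o a), (h \o b) => T.
have sw x : x \in s -> (x != w).
  by move=> xs; apply: contraNneq ws => <-.
have -> : xorsum T s = xorsum (fun x => (x != w) && T x) (w :: s).
  rewrite /xorsum big_cons eqxx /= big_seq_cond [RHS]big_seq_cond.
  by apply: eq_bigl => x; case: (boolP (x \in s)) => // /sw->.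
rewrite ab; split=> -[f fP]; [exists f|exists (f \o h)] => x xs.
  have := fP x; rewrite inE xs orbT sw //= => -> //.
  have : f (a w) = f (b w).
    by have := fP w (mem_head _ _); rewrite eqxx /=; do 2?case: (f _).
  by rewrite /h => fw; do 2?[case: eqP => [->|_]]; rewrite ?fw.
move: xs; rewrite inE => /orP[/eqP->|xs].
  by rewrite eqxx /= /h eqxx; case: eqP => _; rewrite addbb.
by rewrite sw //= fP.
Qed.

Lemma cutlike_sub s t :
  uniq s -> uniq t -> {subset t <= s} -> cutlike s -> cutlike t.
Proof.
move=> us ut ts.
have st : perm_eq s ([seq x <- s | x \notin t] ++ t).
  rewrite uniq_perm ?cat_uniq ?filter_uniq ?ut //= ?andbT.
    by apply/hasPn => x xt; rewrite mem_filter xt.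
  move=> x; rewrite mem_cat mem_filter.
  by case: (boolP (x \in t)) => [/ts->|]; rewrite ?orbF.
move/(cutlike_perm st); have := us; rewrite (perm_uniq st).
elim: [seq _ <- _ | _] => // w r IH /= uwr /(cutlike_behead uwr) /IH.
by apply; case/andP: uwr.
Qed.

(** The maps in use read finitely many bits, so injectivity can only be asked on F_2^g. *)
Definition xlinear g (Y : N -> N) :=
  {morph Y : x y / N.lxor x y} /\
  forall x, small g x -> Y x = 0%num -> x = 0%num.

Lemma xlinear0 g Y : xlinear g Y -> Y 0%num = 0%num.
Proof. by case=> YD _; have := YD 0%num 0%num; rewrite !N.lxor_nilpotent. Qed.

Lemma xlinear_inj g Y : xlinear g Y -> {in small g &, injective Y}.
Proof.
move=> [YD Y0] x y xg yg Yxy; apply/eqP; rewrite -lxor_eq0; apply/eqP.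
by apply: Y0; [exact: smallD | rewrite YD Yxy N.lxor_nilpotent].
Qed.

Lemma xorsum_map g Y T s : xlinear g Y -> all (small g) s ->
  xorsum T (map Y s) = 0%num <-> xorsum (T \o Y) s = 0%num.
Proof.
move=> linY /allP sg; have [YD Y0] := linY.
rewrite /xorsum big_map -(big_morph Y YD (xlinear0 linY)).
split=> [|->]; last exact: (xlinear0 linY).
apply: Y0; rewrite big_seq_cond; apply: small_big => x.
by case/andP=> /sg.
Qed.

Lemma cutlike_map g Y s : xlinear g Y -> all (small g) s -> uniq s ->
  cutlike s <-> cutlike (map Y s).
Proof.
move=> linY sg us; have inj_Y : {in s &, injective Y}.
  by move=> x y /(allP sg) xg /(allP sg) yg; apply: (xlinear_inj linY).
pose Z y := nth 0%num s (index y (map Y s)).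
have YK : {in s, cancel Y Z}.
  by move=> x xs; rewrite /Z nth_index_map.
split=> -[V [a [b ab]]].
  exists V, (a \o Z), (b \o Z) => T; rewrite (xorsum_map _ linY sg) ab.
  split=> -[f fP]; exists f => x.
    by case/mapP=> z zs ->; rewrite /= YK // -fP.
  by move=> xs; rewrite /= fP ?map_f //= YK.
exists V, (a \o Y), (b \o Y) => T.
have -> : xorsum T s = xorsum ((T \o Z) \o Y) s.
  rewrite /xorsum big_seq_cond [RHS]big_seq_cond; apply: eq_bigl => x /=.
  by case: (boolP (x \in s)) => // xs; rewrite YK.
rewrite -(xorsum_map _ linY sg) ab; split=> -[f fP]; exists f => x.
  by move=> xs; rewrite -[in LHS](YK x) //; apply: fP (map_f _ _).
by case/mapP=> z zs ->; rewrite /= YK // fP.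
Qed.

Fixpoint sublists s : seq (seq N) :=
  if s is x :: s' then let r := sublists s' in map (cons x) r ++ r else [::
    [::]].

Lemma mem_sublists s u : (u \in sublists s) = subseq u s.
Proof.
elim: s u => [|x s IH] [|y u] //=; rewrite mem_cat ?IH.
  by rewrite sub0seq orbT.
have -> : (y :: u \in map (cons x) (sublists s)) = (y == x) && subseq u s.
  apply/mapP/andP => [[v + [-> ->]]|[/eqP-> us]]; first by rewrite IH.
  by exists u; rewrite ?IH.
case: eqP => //= _; rewrite orb_idr // => /cons_subseq.
exact.
Qed.

Lemma sublists_uniq s : uniq s -> uniq (sublists s).
Proof.
elim: s => //= x s IH /andP[xs /IH us].
rewrite cat_uniq us map_inj_uniq ?us => [|u v [] //]; rewrite andbT /=.
apply/hasPn => u; rewrite mem_sublists => us'; apply/mapP => -[v _ uv].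
by move: us'; rewrite uv => /mem_subseq /(_ _ (mem_head _ _));
  rewrite (negPf xs).
Qed.

Definition codewords s := [seq u <- sublists s | foldr N.lxor 0%num u == 0%num].

Lemma codewordP s u : uniq s -> u \in codewords s ->
  [/\ u = [seq x <- s | x \in u] & xorsum (mem u) s = 0%num].
Proof.
move=> us; rewrite mem_filter mem_sublists =>
  /andP[/eqP u0 /(subseq_uniqP us) uE].
split=> //; have -> : xorsum (mem u) s = \big[N.lxor/0%num]_(x <- [seq x <- s |
  x \in u]) x.
  by rewrite /xorsum big_filter.
by rewrite -uE -[RHS]u0 unlock; elim: (u) => //= x v ->.
Qed.

Lemma filter_codeword s T : uniq s -> xorsum T s = 0%num ->
  [seq x <- s | T x] \in codewords s.
Proof.
move=> us T0; rewrite mem_filter mem_sublists filter_subseq andbT.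
by apply/eqP; rewrite -[RHS]T0 /xorsum -big_filter unlock;
  elim: filter => //= x v ->.
Qed.

(* The nonzero vertex stars of a graph with cut code [codewords s] number at
   least one more than the dimension of the code, and each element of [K] lies
   in at most two of them. *)
Definition star_obstruction s K m :=
  let c := codewords s in
  [&& uniq s, 0 < m, all (fun u => nilp u || (m <= count (mem K) u)) c
    & 2 ^ (2 * size K %/ m).-1 < size c].

Lemma star_obstructionP s K m : star_obstruction s K m -> ~ cutlike s.
Proof.
move=> /and4P[us m0 /allP Km big] [V [a [b ab]]].
(* The exclusive or keeps loops out of the stars; [W] is then the set of vertices with a nonempty
   star. *)
pose D x e := (a e == x) (+) (b e == x).
pose W := [set x | has (D x) s].
have starP x : x \in W -> m <= count (mem K) [seq e <- s | D x e].
  rewrite inE => xW; have := Km [seq e <- s | D x e].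
  rewrite /nilp size_filter -leqn0 leqNgt -has_count xW /=; apply.
  by apply: filter_codeword => //; apply/ab; exists (pred1 x).
have cardW : #|W| <= 2 * size K %/ m.
  rewrite leq_divRL // -sum_nat_const.
  apply: (leq_trans (n := \sum_(x in W) count (mem K) [seq e <- s | D x e])).
    exact: leq_sum.
  have cE x : count (mem K) [seq e <- s | D x e] = \sum_(e <- s | e \in K) D x
    e.
    rewrite count_filter -sum1_count big_mkcond [RHS]big_mkcond /=.
    by apply: eq_bigr => e _; case: (e \in K); case: (D x e).
  under eq_bigr do rewrite cE; rewrite exchange_big /=.
  apply: (leq_trans (n := \sum_(e <- s | e \in K) 2)).
    apply: leq_sum => e _; apply: (leq_trans (n := \sum_(x in [set a e;
      b e]) 1)).
      rewrite big_mkcond [X in _ <= X]big_mkcond /=; apply: leq_sum => x _.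
      case: (x \in W) => //; rewrite !inE /D (eq_sym (a e)) (eq_sym (b e)).
      by case: (x == a e); case: (x == b e).
    by rewrite sum1_card cards2; case: (_ != _).
  rewrite big_const_seq iter_addn_0.
  rewrite leq_mul2l /= -size_filter uniq_leq_size ?filter_uniq // => e.
  by rewrite mem_filter => /andP[].
(* Adding a constant to [f] does not change its cut, so [f] may be taken to vanish at one chosen
   vertex of [W]. Every codeword is then the cut of a subset of [W']. *)
pose W' := if [pick x in W] is Some x0 then W :\ x0 else W.
have cardW' : #|W'| = #|W|.-1.
  rewrite /W'; case: pickP => [x xW|W0]; first by rewrite (cardsD1 x W) xW.
  by rewrite eq_card0.
pose F (U : {set V}) := [seq e <- s | (a e \in U) (+) (b e \in U)].
have : {subset codewords s <= [seq F U | U <- enum (powerset W')]}.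
  move=> u uc; have [uE /ab[f fP]] := codewordP us uc.
  pose f' x := f x (+) (if [pick x in W] is Some x0 then f x0 else false).
  apply/mapP; exists [set x in W | f' x].
    rewrite mem_enum inE /W' /f'; apply/subsetP => x.
    case: pickP => [x0 x0W|W0]; rewrite !inE => /andP[-> //=].
    by rewrite andbT; apply: contraTneq => ->; rewrite addbb.
  rewrite {1}uE; apply: eq_in_filter => e es.
  have -> : (e \in u) = f (a e) (+) f (b e) by exact: fP.
  rewrite !inE.
  have [->|abe] := eqVneq (a e) (b e); first by rewrite !addbb.
  have -> : has (D (a e)) s.
    by apply/hasP; exists e => //; rewrite /D eqxx eq_sym (negPf abe).
  have -> : has (D (b e)) s.
    by apply/hasP; exists e => //; rewrite /D eqxx (negPf abe).
  by rewrite /f' addbACA addbb addbF.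
move/(uniq_leq_size (filter_uniq _ (sublists_uniq us))).
rewrite size_map -cardE card_powerset cardW' leqNgt (leq_ltn_trans _ big) //.
by rewrite leq_exp2l // -!subn1 leq_sub2r.
Qed.

End CutCodes.

(** Ordered by number of points; the last four have 12. Each list starts with the standard basis of
    its span, so that lying in F_2^g is the same as having rank at most g. *)
Definition classes : seq (seq N) := ([::
  [::]; [:: 1]; [:: 1; 2]; [:: 1; 2; 3]; [:: 1; 2; 4]; [:: 1; 2; 4; 3];
  [:: 1; 2; 4; 7]; [:: 1; 2; 4; 8]; [:: 1; 2; 4; 3; 5]; [:: 1; 2; 4; 8; 7];
  [:: 1; 2; 4; 8; 3]; [:: 1; 2; 4; 8; 15]; [:: 1; 2; 4; 8; 16];
  [:: 1; 2; 4; 3; 5; 7]; [:: 1; 2; 4; 8; 7; 12]; [:: 1; 2; 4; 8; 3; 5];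
  [:: 1; 2; 4; 8; 6; 9]; [:: 1; 2; 4; 8; 7; 13]; [:: 1; 2; 4; 8; 16; 11];
  [:: 1; 2; 4; 8; 16; 15]; [:: 1; 2; 4; 8; 16; 31]; [:: 1; 2; 4; 8; 16; 3];
  [:: 1; 2; 4; 8; 3; 6; 9]; [:: 1; 2; 4; 8; 3; 5; 7];
  [:: 1; 2; 4; 8; 3; 5; 9]; [:: 1; 2; 4; 8; 3; 7; 14];
  [:: 1; 2; 4; 8; 16; 15; 23]; [:: 1; 2; 4; 8; 16; 3; 6];
  [:: 1; 2; 4; 8; 16; 6; 21]; [:: 1; 2; 4; 8; 16; 11; 26];
  [:: 1; 2; 4; 8; 16; 5; 10]; [:: 1; 2; 4; 8; 16; 7; 25];
  [:: 1; 2; 4; 8; 16; 13; 18]; [:: 1; 2; 4; 8; 16; 15; 31];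
  [:: 1; 2; 4; 8; 5; 6; 7; 10]; [:: 1; 2; 4; 8; 5; 7; 10; 11];
  [:: 1; 2; 4; 8; 16; 5; 7; 20]; [:: 1; 2; 4; 8; 16; 7; 11; 15];
  [:: 1; 2; 4; 8; 16; 3; 9; 20]; [:: 1; 2; 4; 8; 16; 7; 15; 19];
  [:: 1; 2; 4; 8; 16; 3; 10; 11]; [:: 1; 2; 4; 8; 16; 12; 19; 28];
  [:: 1; 2; 4; 8; 16; 10; 12; 31]; [:: 1; 2; 4; 8; 16; 5; 6; 12];
  [:: 1; 2; 4; 8; 16; 7; 14; 22]; [:: 1; 2; 4; 8; 16; 3; 15; 24];
  [:: 1; 2; 4; 8; 16; 6; 15; 22]; [:: 1; 2; 4; 8; 16; 7; 25; 29];
  [:: 1; 2; 4; 8; 16; 11; 19; 22]; [:: 1; 2; 4; 8; 3; 5; 10; 11; 15];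
  [:: 1; 2; 4; 8; 3; 5; 10; 12; 15]; [:: 1; 2; 4; 8; 16; 3; 7; 11; 20];
  [:: 1; 2; 4; 8; 16; 3; 10; 21; 31]; [:: 1; 2; 4; 8; 16; 6; 10; 11; 14];
  [:: 1; 2; 4; 8; 16; 6; 19; 22; 26]; [:: 1; 2; 4; 8; 16; 3; 12; 14; 26];
  [:: 1; 2; 4; 8; 16; 10; 27; 30; 31]; [:: 1; 2; 4; 8; 16; 19; 22; 24; 28];
  [:: 1; 2; 4; 8; 16; 6; 7; 10; 17]; [:: 1; 2; 4; 8; 16; 5; 6; 21; 23];
  [:: 1; 2; 4; 8; 16; 6; 11; 23; 31]; [:: 1; 2; 4; 8; 16; 7; 18; 24; 26];
  [:: 1; 2; 4; 8; 16; 6; 18; 19; 24]; [:: 1; 2; 4; 8; 16; 5; 6; 12; 20];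
  [:: 1; 2; 4; 8; 16; 11; 12; 13; 28]; [:: 1; 2; 4; 8; 16; 3; 12; 18; 19];
  [:: 1; 2; 4; 8; 16; 3; 10; 11; 14; 30];
  [:: 1; 2; 4; 8; 16; 12; 20; 22; 29; 30];
  [:: 1; 2; 4; 8; 16; 3; 6; 9; 24; 28];
  [:: 1; 2; 4; 8; 16; 10; 12; 24; 26; 27];
  [:: 1; 2; 4; 8; 16; 5; 11; 13; 15; 31];
  [:: 1; 2; 4; 8; 16; 6; 20; 21; 22; 25];
  [:: 1; 2; 4; 8; 16; 5; 6; 7; 22; 23];
  [:: 1; 2; 4; 8; 16; 5; 11; 13; 27; 31];
  [:: 1; 2; 4; 8; 16; 5; 6; 20; 24; 28];
  [:: 1; 2; 4; 8; 16; 3; 11; 14; 20; 30];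
  [:: 1; 2; 4; 8; 16; 17; 21; 22; 23; 24];
  [:: 1; 2; 4; 8; 16; 3; 6; 12; 18; 22];
  [:: 1; 2; 4; 8; 16; 11; 12; 19; 20; 31];
  [:: 1; 2; 4; 8; 16; 3; 7; 18; 22; 23];
  [:: 1; 2; 4; 8; 16; 14; 15; 24; 27; 31];
  [:: 1; 2; 4; 8; 16; 3; 7; 10; 11; 26; 27];
  [:: 1; 2; 4; 8; 16; 5; 6; 7; 10; 14; 20];
  [:: 1; 2; 4; 8; 16; 9; 10; 12; 13; 26; 30];
  [:: 1; 2; 4; 8; 16; 3; 9; 12; 13; 18; 19];
  [:: 1; 2; 4; 8; 16; 6; 14; 24; 26; 27; 31];
  [:: 1; 2; 4; 8; 16; 5; 6; 10; 15; 25; 31];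
  [:: 1; 2; 4; 8; 16; 3; 6; 17; 20; 23; 25];
  [:: 1; 2; 4; 8; 16; 3; 17; 19; 20; 23; 25; 27];
  [:: 1; 2; 4; 8; 16; 9; 10; 13; 14; 15; 17; 31];
  [:: 1; 2; 4; 8; 16; 5; 10; 21; 25; 26; 27; 29];
  [:: 1; 2; 4; 8; 16; 6; 7; 10; 15; 20; 30; 31]])%num.

(* Each entry is a point set [s] with the [K] and [m] of [star_obstruction]; the
   first two point sets are the Fano plane and its dual. *)
Definition obstructions : seq (seq N * seq N * nat) := ([::
  ([:: 1; 2; 3; 4; 5; 6; 7], [:: 1; 2; 3; 4; 5; 6; 7], 3%N);
  ([:: 1; 2; 4; 7; 8; 13; 14], [:: 1; 2; 4; 7; 8; 13; 14], 4%N);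
  ([:: 1; 2; 4; 6; 8; 10; 13; 14], [:: 1; 2; 4; 6; 8; 10; 14], 3%N);
  ([:: 1; 2; 4; 8; 16; 19; 29; 30], [:: 1; 2; 4; 16; 19; 29; 30], 4%N);
  ([:: 1; 2; 4; 8; 14; 16; 22; 25; 30], [:: 1; 2; 8; 14; 16; 22; 30], 3%N);
  ([:: 1; 2; 4; 6; 8; 16; 20; 22; 27], [:: 1; 2; 4; 6; 16; 20; 22], 3%N);
  ([:: 1; 2; 4; 8; 11; 13; 16; 22; 28], [:: 1; 2; 4; 8; 11; 13; 16; 22;
    28], 4%N);
  ([:: 1; 2; 4; 5; 6; 7; 8; 9; 12; 14], [:: 1; 2; 4; 5; 6; 7; 8; 9; 12;
    14], 3%N);
  ([:: 1; 2; 4; 5; 8; 9; 13; 16; 24; 25; 31], [:: 1; 2; 4; 5; 8; 9; 13; 16; 24;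
    25], 3%N)])%num.

(* One row per class [p], with one certificate for each nonzero vector [w]
   outside [p], in increasing order.  A certificate is [j * 2 ^ 25 + c], where
   [c] encodes an invertible matrix mapping [w :: p] onto the [j]-th class, or,
   when [j >= 92], onto a superset of the obstruction of index [j - 92]. *)
Definition certificates : seq (seq N) := ([::
  [:: 50597953; 50597922; 50597986; 50594946; 50596994; 50599042; 50601090;
  50372738; 50438274; 50503810; 50569346; 50634882; 50700418; 50765954;
  50831490; 35135618; 37232770; 39329922; 41427074; 43524226; 45621378;
  47718530; 49815682; 51912834; 54009986; 56107138; 58204290; 60301442;
  62398594; 64495746; 66592898];
  [:: 84152354; 84152418; 84149378; 84151426; 84153474; 84155522; 83927170;
  83992706; 84058242; 84123778; 84189314; 84254850; 84320386; 84385922;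
  68690050; 70787202; 72884354; 74981506; 77078658; 79175810; 81272962;
  83370114; 85467266; 87564418; 89661570; 91758722; 93855874; 95953026;
  98050178; 100147330];
  [:: 117706850; 151258242; 151260290; 151262338; 151264386; 151036034;
  151101570; 151167106; 151232642; 151298178; 151363714; 151429250;
  151494786; 135798914; 137896066; 139993218; 142090370; 144187522;
  146284674; 148381826; 150478978; 152576130; 154673282; 156770434;
  158867586; 160964738; 163061890; 165159042; 167256194];
  [:: 184815681; 184816705; 184817729; 184818753; 184688705; 184721473;
  184754241; 184787009; 184950849; 184983617; 185016385; 185049153;
  172499009; 173547585; 174596161; 175644737; 180887617; 181936193;
  182984769; 184033345; 189276225; 190324801; 191373377; 192421953;
  197664833; 198713409; 199761985; 200810561];
  [:: 184815714; 184814722; 184814660; 218373250; 251699330; 251764866;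
  251830402; 251895938; 251961474; 252027010; 252092546; 252158082;
  236462210; 238559362; 240656514; 242753666; 244850818; 246947970;
  249045122; 251142274; 253239426; 255336578; 257433730; 259530882;
  261628034; 263725186; 265822338; 267919490];
  [:: 285478017; 285477924; 285478052; 352460865; 352493633; 352526401;
  352559169; 352723009; 352755777; 352788545; 352821313; 340271169;
  341319745; 342368321; 343416897; 348659777; 349708353; 350756929;
  351805505; 357048385; 358096961; 359145537; 360194113; 365436993;
  366485569; 367534145; 368582721];
  [:: 285479010; 285478018; 285480066; 319033409; 319066177; 319098945;
  319131713; 319164481; 319197249; 319230017; 319262785; 310906945;
  311955521; 313004097; 314052673; 315101249; 316149825; 317198401;
  318246977; 327684161; 328732737; 329781313; 330829889; 331878465;
  332927041; 333975617; 335024193];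
  [:: 352587874; 352586882; 352586820; 319036546; 352428162; 352428100;
  319004802; 352422148; 319000834; 319000648; 386375810; 404234370;
  406331522; 408428674; 410525826; 412622978; 414720130; 416817282;
  418914434; 421011586; 423108738; 425205890; 427303042; 429400194;
  431497346; 433594498; 435691650];
  [:: 453250119; 453251143; 520360001; 520392769; 520425537; 520458305;
  520491073; 520523841; 520556609; 520589377; 512233537; 513282113;
  514330689; 515379265; 516427841; 517476417; 518524993; 519573569;
  529010753; 530059329; 531107905; 532156481; 533205057; 534253633;
  535302209; 536350785];
  [:: 520360034; 520359042; 520361090; 486934564; 486934657; 587342050;
  486936641; 587341058; 587347202; 486939713; 608706625; 609755201;
  610803777; 611852353; 617095233; 618143809; 619192385; 620240961;
  625483841; 626532417; 627580993; 628629569; 633872449; 634921025;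
  635969601; 637018177];
  [:: 520359041; 520358948; 520359076; 520200321; 520200228; 520200356;
  553951362; 486770948; 486770824; 486771080; 709369921; 710418497;
  711467073; 712515649; 717758529; 718807105; 719855681; 720904257;
  726147137; 727195713; 728244289; 729292865; 734535745; 735584321;
  736632897; 737681473];
  [:: 486606216; 486617128; 486617345; 486808641; 486934568; 486934785;
  486776897; 486940737; 486770945; 486770728; 654577729; 655626305;
  656674881; 657723457; 658772033; 659820609; 660869185; 661917761;
  662966337; 664014913; 665063489; 666112065; 667160641; 668209217;
  669257793; 670306369];
  [:: 721686626; 721685634; 721685572; 620899586; 721526914; 721526852;
  621121794; 721520900; 621125762; 621125700; 654811266; 708321410;
  708321348; 616042754; 708315396; 616046722; 616046660; 653795458;
  707870980; 615792770; 615792708; 653541506; 615778820; 653529602;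
  653529168; 704127106];
  [:: 3104052354; 788795457; 788828225; 788860993; 788893761; 788926529;
  788959297; 788992065; 789024833; 780668993; 781717569; 782766145;
  783814721; 784863297; 785911873; 786960449; 788009025; 797446209;
  798494785; 799543361; 800591937; 801640513; 802689089; 803737665;
  804786241];
  [:: 755108136; 755108099; 755107944; 855740674; 855740488; 855871944;
  855871746; 855871560; 855740872; 947982849; 949031425; 964760065;
  965808641; 952177153; 953225729; 968954369; 970002945; 950080001;
  951128577; 966857217; 967905793; 954274305; 955322881; 971051521;
  972100097];
  [:: 788794439; 788795463; 822190209; 755179585; 755179617; 755173633;
  755174657; 856103971; 856100899; 914886690; 916983842; 915935266;
  918032418; 919080994; 921178146; 920129570; 922226722; 931663906;
  933761058; 932712482; 934809634; 935858210; 937955362; 936906786;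
  939003938];
  [:: 755241025; 755239041; 755243137; 755048484; 755179556; 755041540;
  755172612; 755013768; 755180804; 1023549505; 1024598081; 1025646657;
  1026695233; 1031938113; 1032986689; 1034035265; 1035083841; 1027743809;
  1028792385; 1029840961; 1030889537; 1036132417; 1037180993; 1038229569;
  1039278145];
  [:: 855907393; 822348930; 855907457; 855710977; 855717928; 3137577090;
  855776513; 3137773698; 855783464; 977808449; 978857025; 979905601;
  980954177; 989342785; 988294209; 987245633; 986197057; 994585665;
  995634241; 996682817; 997731393; 1006120001; 1005071425; 1004022849;
  1002974273];
  [:: 922886241; 948443172; 948443265; 977808642; 922853505; 922951809;
  948050433; 977546754; 978136578; 948607489; 946348068; 946348161;
  985141506; 1092894849; 1048056065; 1048055848; 877136360; 945955329;
  984879618; 985469442; 946512385; 1047564808; 877103624; 877365768;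
  1048351240];
  [:: 948438210; 948443170; 948443201; 948000257; 948125730; 948125761;
  948603393; 948111873; 948617281; 948617250; 1139935279; 1139935713;
  888211184; 1139948609; 888233008; 888233473; 888672321; 1140297793;
  888899632; 888900097; 888291393; 888913985; 888277505; 888277040;
  1140068417];
  [:: 1111558128; 1111587888; 1111588353; 1057234050; 1112508464; 1112508929;
  1057202306; 1112522817; 1057198338; 1045217538; 1124339777; 1139935280;
  1139935745; 1048060034; 1139949633; 1048056066; 1066549506; 1116213313;
  1140330561; 1047675138; 1066930434; 1115832385; 1066934402; 1115818497;
  1115818032];
  [:: 923012226; 923012164; 923012292; 922853506; 922853444; 922853572;
  1023578370; 948617284; 948617346; 948617410; 909648002; 909647940;
  909648068; 1012404482; 961822788; 961822850; 961822914; 1012023554;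
  962076740; 962076802; 962076866; 1087640066; 1115818511; 1115818480;
  1115818992];
  [:: 1157896418; 1157891298; 1157832775; 1157668935; 1191347522; 1191413058;
  1191357762; 1191423298; 1216874660; 1221068964; 1222117540; 1217923236;
  1218971812; 1223166116; 1224214692; 1220020388; 1233651876; 1237846180;
  1238894756; 1234700452; 1235749028; 1239943332; 1240991908; 1236797604];
  [:: 3104052354; 1157962882; 1157956676; 1157960900; 1157957668; 1157961892;
  3171328130; 1157962881; 1346907201; 1347955777; 1349004353; 1350052929;
  1358441537; 1357392961; 1356344385; 1355295809; 1363684417; 1364732993;
  1365781569; 1366830145; 1375218753; 1374170177; 1373121601; 1372073025];
  [:: 1157895298; 1157897346; 1157800066; 1157865602; 1157796098; 1157861634;
  3137572938; 3137769546; 1459882020; 1464076324; 1460930596; 1465124900;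
  1461979172; 1466173476; 1463027748; 1467222052; 1468270628; 1472464932;
  1469319204; 1473513508; 1470367780; 1474562084; 1471416356; 1475610660];
  [:: 3170933060; 1157897380; 1191321829; 1191548232; 3137583234; 1191318856;
  3137779842; 1191551205; 1258332516; 1262526820; 1269866852; 1274061156;
  1266721124; 1270915428; 1261478244; 1265672548; 1259381092; 1263575396;
  1268818276; 1273012580; 1267769700; 1271964004; 1260429668; 1264623972];
  [:: 1325437416; 1325448328; 1325448452; 1560362241; 1586273373; 1586274210;
  1585509602; 1586296034; 1585487778; 1585486941; 1603542109; 1603542946;
  1578398946; 1603564770; 1578377122; 1578376285; 1419869697; 3208126594;
  3208126532; 3218606340; 3208120580; 3218612292; 3218612354; 1413578241];
  [:: 1359088898; 1359097090; 1217005732; 1459789954; 1216594049; 1216582800;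
  1258364388; 1216578704; 1258365412; 1229195428; 1448616066; 1215578241;
  1215566992; 1244143076; 1215562896; 1244144100; 1296572450; 1395724688;
  1559511234; 1395724700; 1395736964; 1442328834; 1395749252; 1442320642];
  [:: 1243095531; 1225004097; 1243095275; 1514933288; 1378107777; 1585702017;
  1552030209; 1325473028; 1378108289; 1579684769; 1229198416; 1253581281;
  1244143841; 1209275472; 1253581025; 1244144097; 1513169412; 1328618768;
  1578361992; 1584927650; 1312890128; 1525752324; 1578636194; 1594090632];
  [:: 1242841444; 1325480999; 1325546721; 1619548769; 1242939652; 1451442241;
  1325644929; 1619646977; 1493638402; 1325480996; 1253130276; 1253294209;
  3128377474; 1316601345; 1630918913; 1630623784; 3218711041; 1250148481;
  3134668930; 1249984548; 1627478056; 3219759617; 1313455617; 1627773185];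
  [:: 1216430244; 1216877698; 1216879746; 1216528452; 1216593988; 1216516176;
  1216486914; 1216581712; 1216598096; 1278746753; 1278492708; 1525727336;
  1278739592; 1278747784; 1526205697; 1526204673; 1278263556; 1525792808;
  1278525700; 1525760040; 1525784624; 1525942785; 1525751856; 1525768240];
  [:: 1377866640; 1377890448; 1377869968; 1380845616; 1586268289; 1619628112;
  1586270273; 1619626128; 1619646608; 1579303169; 1405225008; 1603537025;
  1630802000; 1603539009; 1630800016; 1630820496; 1581334785; 1384253488;
  1622413392; 1594099841; 1622411408; 1594101825; 1594104897; 1622431888];
  [:: 1379992976; 1292110978; 1380008321; 1317538017; 1291952258; 1380452737;
  1317093601; 1292148866; 1317650657; 1380551041; 1388381328; 1384187024;
  1388396673; 1316489473; 1384202369; 1324878081; 1388841089; 1316045057;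
  1384646785; 1324433665; 1316602113; 1388939393; 1324990721; 1384745089];
  [:: 1511494416; 1511514256; 1511514628; 1380863041; 1511799952; 1511800324;
  1380577345; 1511801316; 1380551553; 1380550716; 1418706986; 1418707265;
  1581785314; 1418701313; 1581784322; 1581784136; 1422228993; 1418034689;
  1581498626; 1581498440; 1422895617; 1581484552; 1422901569; 1422901290];
  [:: 3104051298; 3137472837; 3137472847; 1661020207; 1661015087; 1661052975;
  1661047855; 1795197254; 1801488710; 1805683014; 1807780166; 1797294406;
  1799391558; 1803585862; 1809877318; 1796245830; 1802537286; 1806731590;
  1808828742; 1798342982; 1800440134; 1804634438; 1810925894];
  [:: 1661077866; 3137472623; 3137472805; 1694599656; 3137573122; 3137769730;
  1661077992; 1988630690; 1990727842; 1993873570; 1995970722; 1994922146;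
  1992824994; 1991776418; 1989679266; 2005407906; 2007505058; 2010650786;
  2012747938; 2011699362; 2009602210; 2008553634; 2006456482];
  [:: 1779968196; 1779968260; 2088976418; 1955104804; 1847396494; 1719733767;
  1728123143; 1847396622; 1955104996; 1785215012; 1985238167; 1986267671;
  1787312164; 1996772503; 1984170519; 1947769092; 1850552366; 1746406056;
  1777870952; 1954060548; 1854746670; 1748503208; 1767385192];
  [:: 1795623265; 1988629222; 1988155110; 1988248294; 1988789990; 3171094945;
  3137573122; 3137769730; 1887569418; 1887569232; 1832586056; 1848773456;
  1933460162; 1932792514; 1849107280; 1848709968; 1933079234; 1932665538;
  1848916816; 3247972482; 3197026369; 3197059137; 2176976226];
  [:: 1728319523; 1955072193; 1955072225; 2189529168; 2190053456; 1954744833;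
  1954777601; 1882040383; 1881286719; 1715748899; 1948786881; 1948786913;
  1732526115; 1957175489; 1957175521; 1948459521; 1948492289; 1890420799;
  1889667135; 1956848129; 1956880897; 1888323647; 1887569983];
  [:: 1720196161; 1862312388; 1862312078; 1914460240; 1914460674; 1820856929;
  1820529249; 1914591746; 1914591312; 1910588257; 1883325281; 1849729872;
  3128430850; 3134722306; 1860215632; 1930189409; 3207664592; 3218150352;
  1915509345; 1915640417; 3218346960; 3207861200; 1930320481];
  [:: 1795370058; 1795632450; 1795632386; 3103891586; 1795501126; 3171366018;
  1795632258; 1795632322; 1790132298; 1790394690; 1790394626; 2194153537;
  2054427138; 2055016528; 2055017040; 1790263366; 3168223362; 1790394498;
  1790394562; 2054230536; 3283624066; 2055017232; 2055016720];
  [:: 1952784944; 1767114881; 1767114788; 1917076065; 1766924417; 1766924324;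
  1917330017; 2152611917; 2152612258; 1860274000; 1952784903; 1952784624;
  2049198209; 1917075510; 1917076161; 1767115268; 2049515649; 1917329462;
  1917330113; 1766924804; 1860273668; 1860273296; 2152612194];
  [:: 1749384259; 1749355491; 3263699073; 3192311298; 3191993858; 1749374211;
  1749361315; 2051303937; 1882165296; 1888456738; 1748335684; 1761681444;
  1777412196; 1761674500; 3190214148; 3196188164; 3189896708; 3196505604;
  1777403140; 1761683556; 1777410084; 1761967172; 1896845346];
  [:: 1795205250; 1795205570; 1795303458; 1795303489; 3137579138; 1795631138;
  1795631169; 3137775746; 1732512804; 1732512897; 2159554817; 2119700738;
  1732512807; 1732512993; 2159554689; 1732381953; 2159292929; 2159292464;
  3197013505; 1732480257; 2159161857; 2159161392; 3197046273];
  [:: 1820383362; 1820365506; 2130974785; 1820478498; 1820475457; 3137583234;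
  1821065281; 3137779842; 1821068322; 1816415266; 1816412225; 3128440962;
  1835286593; 3134732418; 1835289634; 1816226049; 3128060418; 3128041552;
  3218615553; 3134333008; 3219664129; 1835100417; 3134351874];
  [:: 1881504639; 1881504763; 1962971464; 1846624396; 1846624644; 2089292385;
  1954615856; 1881490427; 1881490303; 1756008546; 1756008515; 1858355297;
  1911716098; 2038415430; 2038415554; 1907507458; 1778028642; 1778028611;
  1849966689; 1907521794; 2022686790; 2022686914; 1911701762];
  [:: 1847081352; 1847079368; 1720191015; 1720322096; 1846819216; 1847407056;
  1846817232; 1847409040; 1719896112; 1858604072; 2072136193; 3207756290;
  2074233345; 3218242050; 1860701224; 1858341936; 1861028912; 3207690756;
  3218373124; 3218176516; 3207887364; 1860439088; 1858931760];
  [:: 1761749089; 1873293358; 1761749249; 1753339009; 2030248001; 3218724944;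
  3208573072; 1942700066; 3191962544; 2024889857; 1748259969; 2020089921;
  3208566864; 3218731152; 1936605218; 3189930928; 2015747585; 1848676878;
  1932567234; 3196222384; 3225499702; 3196222064; 1932567426];
  [:: 2152204705; 1914761924; 1916838402; 3135773826; 1915618820; 1914963460;
  3219673153; 3305480322; 3305545858; 3218627649; 3244361160; 2151760129;
  1916858882; 3135779970; 1914741444; 1917716162; 3128049922; 3134341378;
  1917060802; 3305566338; 3218612289; 3219660865; 3305500802];
  [:: 3137803394; 3338935426; 3103891586; 3137813634; 3137573346; 3104215298;
  2424396929; 2425445505; 2428591233; 2429639809; 2448514177; 2447465601;
  2444319873; 2443271297; 2426494081; 2427542657; 2430688385; 2431736961;
  2446417025; 2445368449; 2442222721; 2441174145];
  [:: 3137770626; 3137641602; 3137451138; 3137584258; 3137573346; 3137617090;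
  2659801153; 2660849729; 2661898305; 2662946881; 2682869825; 2683918401;
  2680772673; 2681821249; 2678675521; 2679724097; 2676578369; 2677626945;
  2663995457; 2665044033; 2666092609; 2667141185];
  [:: 2585004754; 2585004630; 2231449953; 2231646561; 2585332104; 3137573122;
  3137769730; 2585463176; 2354591076; 2354590859; 2504093857; 2357736804;
  2357736587; 2491510945; 2354198512; 3190402000; 3190729680; 2354427888;
  2357344240; 3192495056; 3192822736; 2357573616];
  [:: 2292059266; 3192817776; 2452594817; 3196686866; 2408653520; 2686958088;
  3192490416; 3192490520; 2466285741; 2285773954; 3190722672; 2458880129;
  2575377073; 3196686768; 2408653441; 2699528712; 3192818200; 3190395416;
  2451620013; 2619704976; 3197014128; 3197014546];
  [:: 2424527909; 2424833732; 3137805442; 2424527906; 3103952968; 3137811586;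
  2424833730; 2246412334; 2587052104; 2408733185; 2587560520; 2408661697;
  2328635457; 3196712449; 2596421825; 2409105537; 2488951298; 2246412324;
  3168014416; 3196713473; 2596870657; 2409304129];
  [:: 2269182220; 2250286028; 3135773826; 2528774180; 2269542657; 3135488130;
  2250646465; 3148059138; 3129184336; 3198785680; 2269182224; 2504090113;
  3163039873; 3135779970; 2250286032; 2269673729; 3135684738; 2529101860;
  3129380944; 3199113360; 2250777537; 3148255746];
  [:: 3191948752; 3155433616; 3191963088; 2249853188; 2584952968; 2249853196;
  2390808086; 2390808070; 2463481989; 2360517104; 2463481985; 2552978952;
  3207741762; 3128168528; 3207872708; 2350031344; 2451947649; 2451947653;
  3134459984; 3189923280; 2555076104; 3218227522];
  [:: 2451849380; 3156122116; 2452099944; 3196210256; 2451751172; 2555119873;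
  2452460040; 3196144784; 2555118850; 3134951938; 2555140373; 2538021377;
  2451766539; 2574015748; 3128857090; 2451746079; 3196155024; 2538086849;
  2451864747; 2219778561; 2451844287; 3196220496];
  [:: 2454695336; 2461536321; 3218032132; 3135773826; 3208162224; 2265057665;
  3292807243; 3162705968; 3198241936; 3135475792; 3198448784; 2454695329;
  2362708048; 2399866920; 3135779970; 2461536328; 3292807245; 3135672400;
  3219106416; 3198438544; 2629455105; 3211750914];
  [:: 2585024642; 2319493960; 2366014639; 2365850799; 2231470350; 2558614256;
  2231732494; 2559236848; 2362977765; 2357734885; 2572437015; 2552514071;
  2226655688; 2218267080; 2290882689; 2291931265; 2291013761; 2292062337;
  2463661925; 2458419045; 2463498085; 2458255205];
  [:: 3129479266; 2440300741; 2574010032; 2358219233; 3190047137; 2358230146;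
  2361373858; 2553037860; 2251198736; 2421430788; 3129479458; 3128438914;
  3134730370; 2675198082; 2567722724; 2251202718; 3190047169; 3218360833;
  3219409409; 2361365921; 2637238920; 2574013986];
  [:: 2452468897; 3218818128; 2482353409; 2452463807; 2687469032; 3192881072;
  3219832900; 3219832962; 2482345218; 2709652936; 3218213776; 3208346704;
  2451051938; 3207742210; 2451055039; 3220160772; 3220029508; 3220029570;
  2693643298; 3207676676; 3218358852; 3218150224];
  [:: 2215756100; 2215770448; 2215743824; 3204551106; 3091316808; 3158786125;
  3204549060; 3158801488; 3158783056; 3204555204; 2404065429; 2399871125;
  2404078728; 2399888520; 2399884424; 2404082824; 2385191061; 2389385365;
  2385204360; 2389402760; 2389398664; 2385208456];
  [:: 2588148816; 2567199797; 2567198773; 2551947797; 2590508104; 2551915012;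
  2551961128; 2700550660; 2551943720; 2700567044; 2585829520; 2585837768;
  2567198756; 2588164289; 2567199780; 2551915029; 2590704712; 2551947780;
  2551928360; 2700124676; 2551910952; 2700141060];
  [:: 2485162768; 2485162896; 2485915696; 2485916161; 3137579138; 2486046768;
  2486047233; 3137775746; 2508263472; 2508263937; 3128436866; 2512457776;
  2512458241; 3134728322; 2508722241; 3128044034; 3128043600; 3218607361;
  2512916545; 3134335490; 3134335056; 3219655937];
  [:: 2366015524; 3171162148; 2365952034; 3137608834; 2316648578; 2366015748;
  3137614978; 2365952258; 2385151236; 3208739329; 3296870754; 2384990465;
  3128365570; 3317842338; 3196155393; 2405961985; 3134657026; 3296870818;
  3211884033; 2406122756; 3196156417; 3317842274];
  [:: 2218276906; 2223520065; 2223520097; 2218213418; 2223456577; 2223456609;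
  2218737706; 2223980865; 2223980897; 3090686082; 2225616931; 3169334402;
  2223519809; 2223519841; 2225553443; 3169239170; 2223456321; 2223456353;
  2226077731; 3169763458; 2223980609; 2223980641];
  [:: 2722996746; 2722144592; 3137805442; 3103891586; 2722439227; 3137811586;
  2722636641; 2795960616; 2795927817; 3190723184; 2823402050; 2802121132;
  2802088333; 3178709122; 2795796877; 3168223362; 2822162824; 2795829676;
  2802219273; 3197014640; 2802252072];
  [:: 2853334800; 3134328322; 3134327888; 3218230786; 3293492316; 3129053264;
  3151216770; 2859273200; 3218165252; 3134963842; 2877425712; 3361218690;
  3128868994; 3293492296; 3145121922; 3129249872; 3128043010; 3128042576;
  3209118498; 2766217264; 2885512400];
  [:: 2802655524; 3192720914; 2787403913; 3218201168; 2786333514; 3192867341;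
  3190699540; 2902956106; 3190772227; 3190454384; 2891283650; 3190689300;
  2894151654; 2891417823; 3190454704; 2786372420; 2787452058; 3190772237;
  3192731154; 3219079766; 2903484486];
  [:: 2720108912; 3219559937; 2726651940; 3305319496; 3134308482; 2719060240;
  3219563009; 2726641700; 3305321544; 2729545808; 3090301000; 3128213634;
  2729787460; 3305321564; 3128234064; 3218547201; 2726400048; 2729797700;
  3305319516; 3134525520; 3218545153];
  [:: 2927739076; 3137803394; 3137608834; 2722966608; 2768484520; 3137813634;
  3137614978; 3207872658; 2798741904; 3208452610; 2794988482; 3318071373;
  3128823888; 3208518148; 3219003908; 3135115344; 3297099853; 2799182786;
  3218938370; 2794547600; 3218358418];
  [:: 3202498658; 3162544644; 3134725250; 2789748778; 3202433124; 3169423440;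
  2798588194; 3129184770; 3292971906; 3219757200; 2719100418; 3090681928;
  3128439938; 3372310573; 2793484730; 3169226832; 3199124036; 3129381378;
  2798129442; 3218160151; 3292906370];
  [:: 3104051298; 2759469316; 2746452074; 3171324354; 2734918913; 2734917889;
  2753178050; 2753176002; 3090690306; 3331854594; 3128438914; 3134730370;
  3134732418; 2721301354; 3169243650; 3373240737; 3218360833; 3219409409;
  3219410433; 2726555137; 2726554113];
  [:: 2902792228; 3196193872; 3137608834; 2802230217; 2853442050; 3171166244;
  3137614978; 2799182786; 3207872658; 2861558209; 3208452610; 3161231408;
  3219222020; 3128823888; 3208518148; 3212523600; 3135115344; 3297099853;
  3219287554; 2888612912; 3218358418];
  [:: 2821195144; 2821195176; 3124865538; 3124865104; 3191945840; 3091302920;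
  3125062146; 3125061712; 3191946160; 2753794570; 2753794384; 3128436866;
  2753794574; 2753794512; 3134728322; 2756940298; 2756940112; 3145214082;
  2756940302; 2756940240; 3151505538];
  [:: 2861555770; 2860671809; 3137805442; 3171091780; 2823397954; 2860653377;
  3137811586; 2861537338; 3124564482; 3123974224; 3190723184; 2861547578;
  2860663617; 3145154690; 3130265680; 3190395824; 3169718785; 3130855938;
  2860661569; 3151446146; 2861545530];
  [:: 3125289027; 3125289033; 2721214280; 3134725250; 2798029316; 2892989922;
  3202977872; 2858704932; 3202975888; 2857351682; 3203309712; 2937327110;
  3128439938; 2721188683; 2797636100; 2892793314; 3203305552; 2857363974;
  3203303568; 2858712098; 3198227376];
  [:: 2760380485; 2759331912; 2798985370; 2752841872; 2786922754; 2798723226;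
  2752776336; 2787053826; 2728528954; 2728528955; 3092779080; 3128430914;
  3134722370; 3125946448; 3207670224; 2727183460; 3210229954; 3136432208;
  3216521412; 2727150692; 3216521410];
  [:: 2925562664; 3218607234; 3218607172; 3134327408; 2887227184; 2886931248;
  3213475970; 3213475908; 3129022160; 2901448496; 2892010288; 3208396930;
  3208396868; 3129032400; 3208200452; 3128049922; 3134341378; 3206416644;
  3128036144; 3216711748; 3216711810];
  [:: 3129478338; 3134722210; 2923204657; 2944176673; 2941032961; 2941043842;
  3190044193; 3219407745; 2936855682; 3124240514; 3128440962; 3130531970;
  3134732418; 2937901090; 3201567233; 2936855586; 3218361857; 3202615809;
  3219410433; 2924272705; 2926366785];
  [:: 2896430911; 3201849431; 2896264993; 3192868354; 3219865687; 2902428449;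
  3212442114; 2891057968; 3192878594; 3191349378; 3191349316; 3208482896;
  3191343364; 3207872642; 3201835138; 3218161924; 2890973986; 2901935906;
  3219287120; 3218358340; 3218358402];
  [:: 2973822515; 2979058195; 3103891586; 2961723426; 3137573122; 3137769730;
  2961726498; 3090563330; 3134341506; 3128377474; 3191474318; 3169465858;
  3169484290; 3191480462; 3331604610; 3134668930; 3318232194; 3218346704;
  3218213712; 3318230146];
  [:: 3104051298; 3137448066; 3137583234; 3103952968; 3137644674; 3338811465;
  2957823056; 3302889858; 3128436866; 2977746000; 3300792706; 3134728322;
  3124930640; 3207674000; 2976959560; 3125520898; 3125258320; 3218159760;
  2957036616; 3125717506];
  [:: 3317766409; 3103919362; 3129085008; 3137674370; 3219772930; 2979548212;
  3137680514; 3211999318; 2974386312; 3296936011; 3129091152; 3167894018;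
  3128299600; 3218817284; 3134591056; 3220106754; 3142658566; 3000023312;
  3219353090; 3153144326];
  [:: 3103919362; 3137473610; 3137479754; 2979123283; 2979549267; 2979778643;
  2979156051; 3090686082; 3190950414; 3169334402; 3144751626; 3151043082;
  3125952586; 3136438346; 2979549459; 2979123475; 3126476874; 3136962634;
  2979156243; 2979778835];
  [:: 3151499362; 3146255490; 3192868354; 3124884994; 3297146274; 3134820866;
  3124857328; 3192878594; 3062103012; 3025668356; 3125053616; 3208565250;
  3190033924; 3128726018; 3128168528; 3125075458; 3305539964; 3146261634;
  3145208098; 2957641768];
  [:: 3137769570; 3192671746; 3003426952; 3137581186; 3137777794; 3137573154;
  3205332098; 3086098511; 3204581930; 3208581200; 3205317762; 3208579216;
  3158759937; 3125042690; 3086452996; 3209853442; 3204611810; 3216144898;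
  3204807748; 3125048834];
  [:: 3134721154; 3136822402; 3002632449; 3198683684; 3219755088; 3192407114;
  3219753104; 2997395748; 3129105922; 3126342786; 3128435842; 3128430978;
  3136823490; 3003091201; 3220082768; 3198684132; 3220080784; 3192421450;
  3129112066; 2997389732];
  [:: 3125284098; 3131576482; 3091728744; 3126968642; 3099705416; 3129196674;
  3312350338; 3196698754; 3145961552; 3134327536; 3092783234; 3292603309;
  3131576802; 3301359688; 3129393282; 3128036272; 3146158160; 3175572560;
  3199109636];
  [:: 3137478754; 3137539330; 3137478946; 3137739906; 3137582210; 3137746050;
  3191083088; 3128836226; 3126792706; 3208382608; 3124844042; 3124854282;
  3190890640; 3214819396; 3137278466; 3218630734; 3135127682; 3204797518;
  3092168962];
  [:: 3129098338; 3148354690; 3196210690; 3216085506; 3134439554; 3135378946;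
  3129184770; 3202501346; 3129709058; 3301274701; 3129098530; 3128344706;
  3135389186; 3210121730; 3135403088; 3301346218; 3129381378; 3148364930;
  3293064098];
  [:: 3137769570; 3218214402; 3137446018; 3192515074; 3137642626; 3137573154;
  3218625666; 3124498946; 3134327184; 3207738882; 3128889858; 3218608898;
  3134355970; 3221162500; 3128064514; 3130790402; 3135181314; 3128035728;
  3214873090]
])%num.

(* The ends of the edges of the four simple 3-edge-connected cubic graphs with 8
   vertices, whose cographic matroids are the four classes with 12 points. *)
Definition graphs : seq (seq (N * N)) := ([::
  [:: (3, 4); (3, 6); (1, 2); (5, 7); (1, 4); (0, 3); (7, 4); (2, 5); (0, 1);
  (2, 0); (7, 6); (5, 6)];
  [:: (4, 1); (5, 7); (6, 3); (4, 7); (2, 1); (4, 6); (3, 7); (5, 6); (0, 3);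
  (5, 2); (0, 1); (0, 2)];
  [:: (1, 4); (2, 6); (1, 0); (3, 6); (5, 7); (1, 5); (6, 7); (5, 3); (0, 2);
  (4, 7); (2, 4); (3, 0)];
  [:: (1, 5); (7, 6); (2, 6); (7, 3); (2, 0); (5, 6); (3, 5); (7, 4); (3, 0);
  (2, 4); (4, 1); (0, 1)]])%num.

(** * Boolean checks of the tables *)

Section Checks.
Implicit Types (p q s : seq N) (c w x y z : N).

Definition columns c :=
  [seq N.land (N.shiftr c (N.of_nat (5 * i))) 31 | i <- iota 0 5]%num.

Fixpoint combine (ys : seq N) x : N :=
  if ys is y :: ys' then
    let z := combine ys' (N.div2 x) in if N.odd x then N.lxor y z else z
  else 0%num.

(* The base 32 digits of [c] are the columns of a 5x5 matrix over F_2. *)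
Definition apply_mx c := combine (columns c).

Definition targets := classes ++ map (fun o => o.1.1) obstructions.

(** Nonvanishing on the 31 nonzero vectors is injectivity. For a class, equality of sizes makes the
    image exactly [q], and the last test makes the map restrict to F_2^g: if [w :: p] lies there, so
    do [q] and the images of the first [g] basis vectors. For an obstruction, inclusion in the image
    is enough. *)
Definition certified p w c :=
  let j := N.to_nat (N.shiftr c 25) in
  let q := nth [::] targets j in
  let ys := columns c in
  let im := [seq combine ys x | x <- w :: p] in
  [&& j < size targets, all (fun x =>
    combine ys x != 0%num) (behead (points 5)),
      all [in im] q &
      (j < size classes) ==> [&& size q == (size p).+1 &
        all (fun g => all (small g) (w :: p) ==>
          (all (small g) q && all (small g) (take g ys))) [:: 3; 4; 5]]].

Definition extensions p := [seq w <- behead (points 5) | w \notin p].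

Definition classes_certified :=
  all (fun pc => (size pc.2 == size (extensions pc.1)) &&
     all (fun wc => certified pc.1 wc.1 wc.2) (zip (extensions pc.1) pc.2))
   (zip classes certificates).

Definition obstructions_ok :=
  all (fun o => star_obstruction o.1.1 o.1.2 o.2) obstructions.

Definition classes_wf :=
  all (fun p => [&& uniq p, all (small 5) p & 0%num \notin p]) classes.

Definition cutset (ab : N -> N * N) (v p : seq N) :=
  [seq x <- p | ((ab x).1 \in v) (+) ((ab x).2 \in v)].

Definition graph_ok p (es : seq (N * N)) :=
  let ab x := nth (0, 0)%num es (index x p) in
  let cuts := [seq cutset ab v p | v <- sublists (points 3)] in
  let cw := codewords p in
  [&& all (fun e => small 3 e.1 && small 3 e.2) es,
    all [in cw] cuts & all [in cuts] cw].

Definition graphs_ok :=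
  all (fun pe => graph_ok pe.1 pe.2) (zip (drop 88 classes) graphs).

(* Each of the first 88 classes extends to a class with one more point. *)
Definition faces_ok :=
  all (has (fun c => N.ltb (N.shiftr c 25) 92)) (take 88 certificates).

Fixpoint pos_popcount (x : positive) : nat :=
  match x with
  | xH => 1 | xO x' => pos_popcount x' | xI x' => (pos_popcount x').+1
  end.

Definition popcount x := if x is N.pos x' then pos_popcount x' else 0.

Definition popcount_ok :=
  all (fun x => popcount x == count (bit x) (iota 0 5)) (points 5).

Definition signings :=
  [seq (r, [seq s <- points 5 | N.land s r == s]) | r <- points 5].

(** Ghouila-Houri's condition for 0/1 columns: every row set splits into two parts in which each
    column has equally many ones, up to one. *)
Definition signing_ok p :=
  all (fun rs : N * seq N => has (fun s : N => all (fun x =>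
      let a := popcount (N.land x s) in
      let b := popcount (N.land x (N.lxor rs.1 s)) in
      (a <= b.+1) && (b <= a.+1)) p) rs.2).

(* [(u, v)] encodes the functional with coefficients 1 on [u] and -1 on [v]. *)
Definition functionals : seq (N * N) :=
  [:: (16, 0); (8, 16); (8, 0); (4, 8); (4, 16); (4, 0); (2, 4); (2, 8);
    (2, 16);
      (2, 0); (1, 2); (1, 4); (1, 8); (1, 16); (1, 0); (19, 4); (12, 16);
        (3, 8);
      (20, 8); (18, 4); (1, 30); (17, 2)]%num.

(* Evaluating a relation between the forms v v^T on two functionals that are
   both nonzero at no other point of [p] than [x] isolates the coefficient of
   [x]. *)
Definition separated p :=
  let supp := [seq [seq x <- p | popcount (N.land x y.1) != popcount (N.land x
    y.2)]
                 | y : N * N <- functionals] in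
  all (fun x => let sx := [seq s <- supp | x \in s] in
    has (fun s => has (fun t => all (fun y =>
      (y == x) || (y \notin t)) s) sx) sx) p.

(* The multiset over all vectors [z] of the numbers of ways to write [z] as a sum
   of two, respectively three, points of [p]. *)
Definition sum_profile g p :=
  let c2 := [seq count (fun x => N.lxor z x \in p) p | z <- points g] in
  let c3 z := sumn [seq nth 0 c2 (N.to_nat (N.lxor z x)) | x <- p] in
  sort N.leb [seq N.add (N.of_nat (nth 0 c2 (N.to_nat z))) (N.mul 1024 (N.of_nat
    (c3 z))) | z <- points g].

Definition classes_of g := [seq p <- classes | all (small g) p].

Lemma classes_certifiedT : classes_certified.
Proof. by vm_compute. Qed.

Lemma popcount_okT : popcount_ok.
Proof. by vm_compute. Qed.

Lemma obstructions_okT : obstructions_ok.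
Proof. by vm_compute. Qed.

Lemma classes_wfT : classes_wf.
Proof. by vm_compute. Qed.

Lemma graphs_okT : graphs_ok.
Proof. by vm_compute. Qed.

Lemma faces_okT : faces_ok.
Proof. by vm_compute. Qed.

Lemma signings_okT : let sg := signings in all (fun p =>
  signing_ok p sg) classes.
Proof. by vm_compute. Qed.

Lemma separatedT : all separated classes.
Proof. by vm_compute. Qed.

Lemma sum_profiles_uniq :
  all (fun g => uniq [seq sum_profile g p | p <- classes_of g]) [:: 3; 4; 5].
Proof. by vm_compute. Qed.

End Checks.

(* Keeps simplification from unfolding the tables. *)
Opaque classes obstructions certificates graphs.

(** * Classification of the cut-like point sets *)

Section Classification.
Implicit Types (p q s u v : seq N) (c w x y z : N).

Lemma bit_div2 x i : bit (N.div2 x) i = bit x i.+1.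
Proof.
rewrite /bit N.div2_spec N.shiftr_spec; last exact: N.le_0_l.
by congr (N.testbit x _); lia.
Qed.

Lemma bit_odd x : N.odd x = bit x 0.
Proof. by rewrite /bit N.bit0_odd. Qed.

Lemma combineD ys : {morph combine ys : x y / N.lxor x y}.
Proof.
elim: ys => [|c ys IH] x y //=.
have -> : N.div2 (N.lxor x y) = N.lxor (N.div2 x) (N.div2 y).
  by rewrite !N.div2_spec N.shiftr_lxor.
rewrite IH !bit_odd bitD; move: (combine ys _) (combine ys _) => a b.
case: (bit x 0); case: (bit y 0) => //=; apply/N.bits_inj => i;
  by rewrite !N.lxor_spec; do 3 case: N.testbit.
Qed.

Lemma combine_small g k ys x : small k x -> all (small g) (take k ys) ->
  small g (combine ys x).
Proof.
elim: ys k x => [|c ys IH] [|k] x //= xk; try by rewrite small0.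
  move=> _; have -> : x = 0%num.
    by apply: (@bit_inj 0) => //; apply: small0.
  by rewrite /= (_ : combine ys 0%num = 0%num) ?small0 //; elim: (ys).
case/andP=> cg /(IH k (N.div2 x)) sm.
have {}sm : small g (combine ys (N.div2 x)).
  by apply: sm; apply/smallP => i ki; rewrite bit_div2 (bit_small xk).
by case: ifP => // _; apply: smallD.
Qed.

Lemma mem_behead_points g x : (x \in behead (points g)) = (x != 0%num) && small
  g x.
Proof.
have pE : points g = 0%num :: behead (points g).
  by rewrite /points; case: (2 ^ g) (expn_gt0 2 g).
have := points_uniq g; rewrite pE /= => /andP[n0 _].
rewrite -mem_points pE inE; case: eqP => [->|//] /=.
exact/negbTE.
Qed.

Lemma small_leq g h x : g <= h -> small g x -> small h x.
Proof.
by move=> gh /smallP xg; apply/smallP => i hi; apply/xg/(leq_trans gh hi).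
Qed.

Lemma small_le5 g x : g \in [:: 3; 4; 5] -> small g x -> small 5 x.
Proof. by move=> g5; apply: small_leq; move: g5; rewrite !inE; lia. Qed.

Lemma mem_zipl (S T : eqType) (s : seq S) (t : seq T) (x : S) :
  size s = size t -> x \in s -> exists2 y, y \in t & (x, y) \in zip s t.
Proof.
elim: s t => // a s IH [|b t] //= [st]; rewrite inE => /orP[/eqP->|].
  by exists b; rewrite inE eqxx.
by case/(IH t st) => y yt xy; exists y; rewrite inE ?yt ?xy orbT.
Qed.

Lemma class_wf p : p \in classes ->
  [/\ uniq p, all (small 5) p & 0%num \notin p].
Proof. by move/(allP classes_wfT)/and3P. Qed.

Lemma certifiedP p w c : p \in classes -> w \notin p -> w != 0%num ->
  small 5 w -> certified p w c ->
  let j := N.to_nat (N.shiftr c 25) in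
  xlinear 5 (apply_mx c) /\
  if j < size classes then
    let q := nth [::] classes j in
    [/\ size q = (size p).+1, perm_eq (map (apply_mx c) (w :: p)) q
      & forall g, g \in [:: 3; 4; 5] -> all (small g) (w :: p) ->
          all (small g) q /\ forall x, small g x -> small g (apply_mx c x)]
  else ~ cutlike (w :: p).
Proof.
move=> pC wp w0 w5 + j; have [up p5 p0] := class_wf pC.
rewrite /certified -/j => /and4P[jT /allP nz /allP sub good].
have lin : xlinear 5 (apply_mx c).
  split=> [|x x5 /eqP Y0]; first exact: combineD.
  apply/eqP; apply: contraTT Y0 => x0; apply: nz.
  by rewrite mem_behead_points x0.
have uwp : uniq (w :: p) by rewrite /= wp.
have swp : all (small 5) (w :: p) by rewrite /= w5.
have uim : uniq (map (apply_mx c) (w :: p)).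
  rewrite map_inj_in_uniq // => x y xs ys.
  by apply: (xlinear_inj lin); apply: (allP swp).
split=> //; case: ltnP good => [jc|jc _].
  have -> : nth [::] targets j = nth [::] classes j by rewrite nth_cat jc.
  rewrite implyTb => /andP[/eqP sq /allP good]; split=> //.
    have qC : nth [::] classes j \in classes by exact: mem_nth.
    have [uq _ _] := class_wf qC.
    have sub' : {subset nth [::] classes j <= map (apply_mx c) (w :: p)}.
      by move=> x xq; apply: sub; rewrite nth_cat jc.
    (* The image of [w :: p] contains [q] and has as many elements, hence equals it. *)
    have := uniq_min_size uq sub'; rewrite size_map sq leqnn => /(_ isT)[_ e].
    by apply: uniq_perm => // x; rewrite e.
  move=> g g3 sg; have := good g g3; rewrite sg implyTb => /andP[-> small_c].
  by split=> // x xg; apply: combine_small xg _.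
move=> /(cutlike_map lin swp uwp); set im := map _ _ => cut_im.
pose o := nth ([::], [::], 0) obstructions (j - size classes).
have qE : nth [::] targets j = o.1.1.
  rewrite nth_cat ltnNge jc /o (nth_map ([::], [::], 0)) //.
  by rewrite ltn_subLR //; move: jT; rewrite size_cat size_map.
have oO : o \in obstructions.
  by rewrite mem_nth // ltn_subLR //; move: jT; rewrite size_cat size_map.
have obs := allP obstructions_okT _ oO.
apply: (star_obstructionP obs); apply: cutlike_sub cut_im => //.
  by have /and4P[] := obs.
by move=> x; rewrite -qE => /sub.
Qed.

Lemma certificates_size : size classes = size certificates.
Proof. by vm_compute. Qed.

Lemma class_certificates p : p \in classes -> exists2 cs, cs \in certificates &
  size cs = size (extensions p) /\
  {in zip (extensions p) cs, forall wc, certified p wc.1 wc.2}.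
Proof.
case/(mem_zipl certificates_size) => cs csC.
by move/(allP classes_certifiedT) => /= /andP[/eqP sz /allP]; exists cs.
Qed.

Lemma mem_extensions p w :
  (w \in extensions p) = [&& w \notin p, w != 0%num & small 5 w].
Proof. by rewrite mem_filter mem_behead_points. Qed.

Lemma class_extension g p w : g \in [:: 3; 4; 5] -> p \in classes ->
  all (small g) (w :: p) -> w \notin p -> w != 0%num -> cutlike (w :: p) ->
  exists Y q, [/\ q \in classes, all (small g) q, xlinear 5 Y,
    forall h, h \in [:: g; 5] -> forall x, small h x -> small h (Y x)
    & perm_eq (map Y (w :: p)) q].
Proof.
move=> g3 pC swp wp w0 cut; have w5 : small 5 w.
  by case/andP: swp => wg _; apply: small_le5 wg.
have swp5 : all (small 5) (w :: p).
  by apply: sub_all swp => x; apply: small_le5.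
have [cs _ [sz cert]] := class_certificates pC.
have [|c _ wc] := @mem_zipl _ _ (extensions p) cs w (esym sz).
  by rewrite mem_extensions wp w0.
have [lin] := certifiedP pC wp w0 w5 (cert _ wc).
case: ltnP => // jc [_ pq good]; exists (apply_mx c).
exists (nth [::] classes (N.to_nat (N.shiftr c 25))).
have [sq _] := good g g3 swp; split=> //; first exact: mem_nth.
move=> h; rewrite !inE => /orP[] /eqP->; first exact: (good g g3 swp).2.
by have [] := good 5 isT swp5.
Qed.

(** Induction on the points: the tail is already mapped onto a class [p], and the image of [w]
    extends [p], so a certificate applies. The map has to preserve F_2^g, for the class to count for
    [g], and F_2^5, where the certified matrices are injective and can be composed. *)
Theorem classification g s : g \in [:: 3; 4; 5] -> uniq s ->
  all (small g) s -> 0%num \notin s -> cutlike s ->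
  exists Y q, [/\ q \in classes, all (small g) q, xlinear 5 Y,
    forall h, h \in [:: g; 5] -> forall x, small h x -> small h (Y x)
    & perm_eq (map Y s) q].
Proof.
move=> g3; elim: s => [_ _ _ _|w s IH us sg s0 cut].
  by exists id, [::]; split=> //; rewrite mem_head.
have [ws us'] := andP us; have [wg sg'] := andP sg.
have [w0 s0'] : (w != 0%num) /\ 0%num \notin s.
  by move: s0; rewrite inE negb_or eq_sym => /andP.
have [Y [p [pC pg lin Ysm sp]]] := IH us' sg' s0' (cutlike_behead us cut).
have s5 : all (small 5) (w :: s) by apply: sub_all sg => x; apply: small_le5.
have swp : perm_eq (map Y (w :: s)) (Y w :: p) by rewrite /= perm_cons.
have uYs : uniq (map Y (w :: s)).
  rewrite map_inj_in_uniq // => x y xs ys.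
  by apply: (xlinear_inj lin); apply: (allP s5).
have [||||Z [q [qC qg linZ Zsm pq]]] := class_extension g3 pC (w := Y w).
- by rewrite /= pg andbT; apply: Ysm => //; rewrite mem_head.
- by have := uYs; rewrite (perm_uniq swp) => /andP[].
- apply: contraNneq w0 => /(proj2 lin) -> //.
  exact: (allP s5) (mem_head _ _).
- by apply: cutlike_perm swp _; apply/(cutlike_map lin s5 us).
exists (Z \o Y), q; split=> //.
- split=> [x y|x x5 /(proj2 linZ) Yx];
  first by rewrite /= (proj1 lin) (proj1 linZ).
  by apply: (proj2 lin) => //; apply: Yx; apply: Ysm x5; rewrite !inE orbT.
- by move=> h hg x xh; apply/Zsm/Ysm.
by rewrite map_comp; apply: perm_trans pq; apply: perm_map.
Qed.

End Classification.

(** * The tabulated classes are cut-like, totally unimodular, with independent forms, and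
    inequivalent *)

Section ClassFacts.
Implicit Types (p q s u v : seq N) (c w x y z : N).

Lemma filter_codewordE s (T : pred N) : uniq s ->
  xorsum T s = 0%num <-> [seq x <- s | T x] \in codewords s.
Proof.
move=> us; split; first exact: filter_codeword.
case/(codewordP us) => _ <-; rewrite /xorsum big_seq_cond [RHS]big_seq_cond.
apply: eq_bigl => x; rewrite inE /= mem_filter.
by case: (x \in s); rewrite ?andbT.
Qed.

Lemma graph_okP p es : uniq p -> graph_ok p es -> cutlike p.
Proof.
move=> up /and3P[/allP es3 /allP cuts_cw /allP cw_cuts].
pose ab x := nth (0, 0)%num es (index x p).
have ab3 x : small 3 (ab x).1 && small 3 (ab x).2.
  rewrite /ab; have [lt|ge] := ltnP (index x p) (size es).
    by apply/es3/mem_nth.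
  by rewrite nth_default // !small0.
pose code (x : N) : 'I_8 := inord (N.to_nat x).
have codeK x : small 3 x -> N.of_nat (code x) = x.
  by rewrite small_ltn => x8; rewrite inordK // Nnat.N2Nat.id.
have in_cuts v : v \in sublists (points 3) ->
    cutset ab v p \in [seq cutset ab v p | v <- sublists (points 3)].
  by move=> vs; apply/mapP; exists v.
exists 'I_8, (fun x => code (ab x).1), (fun x => code (ab x).2) => T.
split=> [/(filter_codewordE _ up)/cw_cuts/mapP[v _ uE]|[f fP]].
  exists (fun i : 'I_8 => N.of_nat i \in v) => x xp.
  have /andP[x1 x2] := ab3 x; rewrite !codeK //.
  have := congr1 (fun u => x \in u) uE; rewrite !mem_filter xp !andbT.
  exact.
apply/(filter_codewordE _ up).
pose v := [seq x <- points 3 | f (code x)].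
have vs : v \in sublists (points 3) by rewrite mem_sublists filter_subseq.
have -> : [seq x <- p | T x] = cutset ab v p.
  apply: eq_in_filter => x xp; rewrite fP // !mem_filter !mem_points.
  by have /andP[-> ->] := ab3 x; rewrite !andbT.
exact/cuts_cw/in_cuts.
Qed.

Lemma classes_size : size classes = 92.
Proof. by vm_compute. Qed.

Lemma classes_size12 : all (fun p => size p <= 12) classes.
Proof. by vm_compute. Qed.

Lemma graphs_size : size (drop 88 classes) = size graphs.
Proof. by vm_compute. Qed.

Lemma faces_size : size (take 88 classes) = size (take 88 certificates).
Proof. by vm_compute. Qed.

(** Descending induction on the number of points. The classes with 12 points are checked against
    explicit graphs; any other class becomes equivalent to a larger class after adding a point, and
    removing that point contracts an edge. *)
Lemma class_cutlike p : p \in classes -> cutlike p.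
Proof.
suff gen n : forall p, p \in classes -> 12 < size p + n -> cutlike p.
  by move=> pC; apply: (gen 13) => //; rewrite addnC ltn_addr.
elim: n => [|n IH] {}p pC; have := allP classes_size12 p pC.
  by rewrite addn0 leqNgt => /negPf->.
move=> _ sz; have [up p5 p0] := class_wf pC.
have pC' := pC; move: pC'; rewrite -{1}(cat_take_drop 88 classes) mem_cat.
case/orP=> [|/(mem_zipl graphs_size)[es _ pes]]; last first.
  by have := allP graphs_okT _ pes; apply: graph_okP.
case/(mem_zipl faces_size) => cs csT pcs.
have pcs' : (p, cs) \in zip classes certificates.
  rewrite -(cat_take_drop 88 classes) -(cat_take_drop 88 certificates).
  by rewrite zip_cat ?faces_size // mem_cat pcs.
have /hasP[c cc c92] := allP faces_okT _ csT.
have /andP[/eqP sz_cs /allP cert] := allP classes_certifiedT _ pcs'.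
have [w wp wc] : exists2 w, w \in extensions p & (w,
  c) \in zip (extensions p) cs.
  pose i := index c cs; have ic : i < size cs by rewrite index_mem.
  exists (nth 0%num (extensions p) i); first by rewrite mem_nth // -sz_cs.
  apply/(nthP (0%num, 0%num)); exists i; first by rewrite size_zip -sz_cs minnn.
  by rewrite nth_zip // nth_index.
move: wp; rewrite mem_extensions => /and3P[wp w0 w5].
have [lin] := certifiedP pC wp w0 w5 (cert _ wc).
have jC : N.to_nat (N.shiftr c 25) < size classes.
  by rewrite classes_size; move/N.ltb_spec0: c92; move: (N.shiftr c 25) => j;
    lia.
rewrite jC.
set q := nth [::] classes _ => -[sq pq _].
have qC : q \in classes by exact: mem_nth.
have swp : all (small 5) (w :: p) by rewrite /= w5.
have uwp : uniq (w :: p) by rewrite /= wp.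
apply: (cutlike_behead uwp); apply/(cutlike_map lin swp uwp).
apply: (@cutlike_perm q); first by rewrite perm_sym.
by apply: IH => //; rewrite sq addSnnS.
Qed.

Local Open Scope ring_scope.

(** Lifting bits to the integers 0 and 1 depends on the coordinates: the cycle matroid of K_4
    written as 1, 2, 4, 3, 5, 6 gives a minor of absolute value 2, while the tabulated 1, 2, 4, 3,
    5, 7 gives a totally unimodular matrix. *)
Definition class_mx g p : 'M[int]_(g, size p) :=
  \matrix_(i, j) (bit (nth 0%num p j) i)%:Z.

Lemma popcountE x : small 5 x -> popcount x = (\sum_(i < 5) bit x i)%N.
Proof.
move=> x5; have := allP popcount_okT x; rewrite mem_points => /(_ x5) /eqP ->.
by rewrite -sum1_count big_mkcond -[iota 0 5]/(index_iota 0 5) big_mkord.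
Qed.

Lemma bit_land x y i : bit (N.land x y) i = bit x i && bit y i.
Proof. exact: N.land_spec. Qed.

Lemma land_small g x y : small g x -> small g (N.land x y).
Proof.
by move=> /smallP xg; apply/smallP => i gi; rewrite bit_land xg.
Qed.

Lemma popcount_land x y : small 5 x ->
  (popcount (N.land x y))%:Z = \sum_(i < 5) (bit x i)%:Z * (bit y i)%:Z.
Proof.
move=> x5; rewrite popcountE ?land_small // (big_morph _ PoszD (erefl (Posz
  0))).
by apply: eq_bigr => i _; rewrite bit_land; case: bit; case: bit.
Qed.

Lemma nth_small g p j : all (small g) p -> small g (nth 0%num p j).
Proof.
move=> /allP pg; have [jp|pj] := ltnP j (size p); first exact/pg/mem_nth.
by rewrite nth_default // small0.
Qed.

Lemma class_mx5_tu p : p \in classes -> tu (class_mx 5 p).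
Proof.
move=> pC; have [_ p5 _] := class_wf pC; apply: row_sum_tu => U.
pose r := \big[N.lxor/0%num]_(i in U) N.shiftl 1 (N.of_nat i).
have r5 : small 5 r by apply: small_big => i _; apply: small_pow.
have rU (i : 'I_5) : bit r i = (i \in U).
  rewrite bit_big; have [iU|iU] := boolP (i \in U).
    rewrite (bigD1 i) // bit_pow eqxx big1 // => j /andP[_ ji].
    by rewrite bit_pow; apply/negbTE.
  rewrite big1 // => j jU; rewrite bit_pow; apply/negbTE.
  by apply: contraNneq iU => /val_inj <-.
have /allP/(_ (r, [seq s <- points 5 | N.land s r == s])) := allP signings_okT _
  pC.
case/(_ _)/hasP.
  by apply/mapP; exists r; rewrite ?mem_points.
move=> s; rewrite mem_filter mem_points => /andP[/eqP sr s5] /allP ok.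
have srE i : bit s i -> bit r i.
  by rewrite -{1}sr bit_land => /andP[].
(* The rows in [s] get -1 and the other rows of [r] get 1, so each column sum is a difference of two
   values of [popcount]. *)
exists (\row_i ((bit (N.lxor r s) i)%:Z - (bit s i)%:Z)); split=> [i|i|j].
- by rewrite mxE bitD; have := srE i; case: (bit r i);
  case: (bit s i) => // /(_ isT).
- rewrite mxE bitD -rU; have := srE i.
  by case: (bit r i); case: (bit s i) => // /(_ isT).
have -> : (\row_i ((bit (N.lxor r s) i)%:Z - (bit s i)%:Z) *m class_mx 5 p) 0 j
  =
    (popcount (N.land (nth 0%num p j) (N.lxor r s)))%:Z -
    (popcount (N.land (nth 0%num p j) s))%:Z.
  rewrite !popcount_land ?nth_small // mxE -sumrB; apply: eq_bigr => i _.
  by rewrite !mxE mulrBl ![_ * (bit (nth _ _ _) _)%:Z]mulrC.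
have := ok (nth 0%num p j) (mem_nth _ (ltn_ord j)).
rewrite /= !inE; move: (popcount _) (popcount _); lia.
Qed.

Lemma class_mx_tu g p : g \in [:: 3; 4; 5]%N -> p \in classes ->
  tu (class_mx g p).
Proof.
move=> g3 /class_mx5_tu tup; have g5 : (g <= 5)%N by move: g3; rewrite !inE;
  lia.
move=> k f h inj_f inj_h.
have -> : mxsub f h (class_mx g p) = mxsub (widen_ord g5 \o f) h (class_mx 5 p).
  by apply/matrixP => i j; rewrite !mxE.
by apply: tup => // x y /(congr1 val) /= /val_inj /inj_f.
Qed.

(** A relation between the forms, evaluated as a bilinear form on two functionals, becomes a
    relation between products of their values ([sum0]); the pair supplied by [separated] leaves a
    single term. *)
Lemma class_forms_free (R : realFieldType) p (c : 'I_(size p) -> R) :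
  p \in classes ->
  (forall k l : 'I_5,
     \sum_j c j * (class_mx 5 p k j)%:~R * (class_mx 5 p l j)%:~R = 0) ->
  forall j, c j = 0.
Proof.
move=> pC c0 j0; have [up p5 _] := class_wf pC.
pose ev (y : N * N) (x : N) : int :=
  (popcount (N.land x y.1))%:Z - (popcount (N.land x y.2))%:Z.
have evE (y : N * N) (j : 'I_(size p)) : ev y (nth 0%num p j) =
    \sum_(k < 5) ((bit y.1 k)%:Z - (bit y.2 k)%:Z) * class_mx 5 p k j.
  rewrite /ev !popcount_land ?nth_small // -sumrB; apply: eq_bigr => k _.
  by rewrite mxE mulrBl ![_ * (bit (nth _ _ _) _)%:Z]mulrC.
have sum0 (y z : N * N) : \sum_j c j * (ev y (nth 0%num p j))%:~R *
    (ev z (nth 0%num p j))%:~R = 0.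
  pose yk (y : N * N) k : R := ((bit y.1 k)%:Z - (bit y.2 k)%:Z)%:~R.
  transitivity (\sum_(k < 5) \sum_(l < 5) yk y k * yk z l *
      \sum_j c j * (class_mx 5 p k j)%:~R * (class_mx 5 p l j)%:~R).
    under [RHS]eq_bigr do under eq_bigr do rewrite mulr_sumr.
    under [RHS]eq_bigr do rewrite exchange_big /=.
    rewrite [RHS]exchange_big /=; apply: eq_bigr => j _; rewrite !evE.
    rewrite !(rmorph_sum intr) /= -mulrA big_distrlr mulr_sumr;
      apply: eq_bigr => k _.
    rewrite mulr_sumr; apply: eq_bigr => l _; rewrite !(rmorphM intr) /yk /=.
    ring.
  by rewrite big1 // => k _; rewrite big1 // => l _; rewrite c0 mulr0.
set x := nth 0%num p j0; have xp : x \in p by apply: mem_nth.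
have /allP/(_ x xp)/hasP[s] := allP separatedT _ pC.
rewrite mem_filter => /andP[xs /mapP[y _ sE]] /hasP[t].
rewrite mem_filter => /andP[xt /mapP[z _ tE]] /allP sep.
have neq0 (y' : N * N) x' : (ev y' x' == 0) =
    (popcount (N.land x' y'.1) == popcount (N.land x' y'.2)).
  by rewrite subr_eq0 eqz_nat.
move: xs xt; rewrite sE tE !mem_filter -!neq0 => /andP[y0 _] /andP[z0 _].
have := sum0 y z; rewrite (bigD1 j0) //= big1 ?addr0 => [|j jj0].
  by move/eqP; rewrite !mulf_eq0 !intr_eq0 (negPf y0) (negPf z0) !orbF => /eqP.
have jx : nth 0%num p j != x by rewrite nth_uniq.
have [->|yj] := eqVneq (ev y (nth 0%num p j)) 0; first by rewrite mulr0 mul0r.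
have [->|zj] := eqVneq (ev z (nth 0%num p j)) 0; first by rewrite mulr0.
have := sep (nth 0%num p j); rewrite sE tE !mem_filter -!neq0 yj zj (negPf jx).
by rewrite mem_nth //= => /(_ isT).
Qed.

(** An injective linear map of F_2^g permutes the vectors and carries the representations of [z] as
    sums of points of [p] to those of [Y z]. Only the order of the entries changes, and sorting
    removes it. *)
Lemma sum_profile_linear g Y p q : xlinear g Y ->
  (forall x, small g x -> small g (Y x)) -> all (small g) p ->
  perm_eq (map Y p) q -> sum_profile g p = sum_profile g q.
Proof.
move=> lin Ysm pg pq; have inj := xlinear_inj lin.
have qg : all (small g) q.
  rewrite -(perm_all _ pq) all_map; apply: sub_all pg => x; exact: Ysm.
pose c2 p z := count (fun x => N.lxor z x \in p) p.
pose c3 p z := sumn [seq c2 p (N.lxor z x) | x <- p].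
have nth2 s z : small g z ->
    nth 0%N [seq count (fun x =>
      N.lxor z x \in s) s | z <- points g] (N.to_nat z) = c2 s z.
  move=> zg; have zs : (N.to_nat z < size (points g))%N.
    by rewrite size_map size_iota -small_ltn.
  rewrite (nth_map 0%num) // (nth_map 0%N) ?size_iota -?small_ltn //.
  by rewrite nth_iota -?small_ltn // Nnat.N2Nat.id.
have invE s : all (small g) s -> sum_profile g s =
    sort N.leb [seq N.add (N.of_nat (c2 s z)) (N.mul 1024 (N.of_nat (c3 s z))) |
      z <- points g].
  move=> sg; congr sort; apply/eq_in_map => z; rewrite mem_points => zg.
  rewrite nth2 //; congr (N.add _ (N.mul _ (N.of_nat (sumn _)))).
  by apply/eq_in_map => x /(allP sg) xg; rewrite nth2 // smallD.
rewrite !invE //; apply/perm_sortP.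
- by move=> x y; case: (N.leb_spec x y) => //= xy; apply/N.leb_le; lia.
- by move=> y x z /N.leb_le xy /N.leb_le yz; apply/N.leb_le; lia.
- by move=> x y /andP[/N.leb_le xy /N.leb_le yx]; lia.
have Ypts : perm_eq (map Y (points g)) (points g).
  have u : uniq (map Y (points g)).
    rewrite map_inj_in_uniq ?points_uniq // => x y; rewrite !mem_points.
    exact: inj.
  have sub : {subset map Y (points g) <= points g}.
    by move=> y /mapP[x]; rewrite !mem_points => xg ->; apply: Ysm.
  have [|_ e] := uniq_min_size u sub; first by rewrite (size_map Y).
  by apply: uniq_perm => //; apply: points_uniq.
have c2Y z : small g z -> c2 q (Y z) = c2 p z.
  move=> zg; rewrite /c2 -(seq.permP pq) count_map;
    apply: eq_in_count => x xp /=.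
  have xg := allP pg x xp; rewrite -(perm_mem pq) -(proj1 lin).
  apply/mapP/idP => [[y yp /inj Exy]|zx]; last by exists (N.lxor z x).
  by rewrite Exy //; [exact: smallD | exact: (allP pg)].
have c3Y z : small g z -> c3 q (Y z) = c3 p z.
  move=> zg; rewrite /c3 -(perm_sumn (perm_map _ pq)) -map_comp; congr sumn.
  apply/eq_in_map => x xp /=; rewrite -(proj1 lin) c2Y //.
  by apply: smallD => //; apply: (allP pg).
rewrite perm_sym; apply: perm_trans (perm_map _ _) _;
  first by rewrite perm_sym; exact: Ypts.
rewrite -map_comp; apply/seq.permP => a; congr count; apply/eq_in_map => z.
by rewrite mem_points => zg /=; rewrite c2Y // c3Y.
Qed.

Lemma sum_profile_inj g p q : g \in [:: 3; 4; 5]%N ->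
  p \in classes_of g -> q \in classes_of g ->
    sum_profile g p = sum_profile g q -> p = q.
Proof.
move=> g3 pC qC; have /(uniqP [::]) inj := allP sum_profiles_uniq g g3.
have nthE s : s \in classes_of g -> sum_profile g s =
    nth [::] [seq sum_profile g s | s <- classes_of g] (index s (classes_of g)).
  by move=> sC; rewrite (nth_map [::]) ?index_mem // nth_index.
rewrite (nthE p) // (nthE q) // => /inj; rewrite !inE size_map !index_mem.
move=> /(_ pC qC) /(congr1 (nth [::] (classes_of g))).
by rewrite !nth_index.
Qed.

End ClassFacts.

(** * Columns mod 2 as bit masks *)

Section BinaryVectors.
Local Open Scope ring_scope.
Variable g : nat.
Implicit Types (u v : 'cV['F_2]_g) (x y : N).

Definition vec x : 'cV['F_2]_g := \col_i (bit x i)%:R.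

Definition num v : N :=
  \big[N.lxor/0%num]_(i < g | v i 0 != 0) N.shiftl 1 (N.of_nat i).

Lemma num_small v : small g (num v).
Proof. by apply: small_big => i _; apply: small_pow. Qed.

Lemma bit_num v (i : 'I_g) : bit (num v) i = (v i 0 != 0).
Proof.
rewrite bit_big; have [vi|vi] := boolP (v i 0 != 0).
  rewrite (bigD1 i) // bit_pow eqxx big1 // => j /andP[_ ji].
  by rewrite bit_pow; apply/negbTE.
rewrite big1 // => j vj; rewrite bit_pow; apply/negbTE.
by apply: contraNneq vi => /val_inj <-.
Qed.

Lemma F2_addE (a b : 'F_2) : (a + b != 0) = (a != 0) (+) (b != 0).
Proof. by case: a => [[|[|]]] // ?; case: b => [[|[|]]]. Qed.

Lemma num_inj v (x : N) : small g x ->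
  (forall i : 'I_g, bit x i = (v i 0 != 0)) ->
  x = num v.
Proof.
move=> xg xv; apply: (bit_inj xg (num_small v)) => i ig.
by rewrite (xv (Ordinal ig)) -bit_num.
Qed.

Lemma numD : {morph num : u v / u + v >-> N.lxor u v}.
Proof.
move=> u v; apply/esym/num_inj => [|i]; first by rewrite smallD ?num_small.
by rewrite bitD !bit_num mxE F2_addE.
Qed.

Lemma num0 : num 0 = 0%num.
Proof. by apply/esym/num_inj => [|i]; rewrite ?small0 // bit0 mxE eqxx. Qed.

Lemma num_eq0 v : num v = 0%num -> v = 0.
Proof.
move=> v0; apply/colP => i; rewrite [RHS]mxE; apply/eqP; rewrite -[_ == _]negbK.
by rewrite -bit_num v0 bit0.
Qed.

Lemma vecK x : small g x -> num (vec x) = x.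
Proof.
move=> xg; apply/esym/num_inj => // i; rewrite mxE.
by case: (bit x i); rewrite ?oner_eq0 ?eqxx.
Qed.

Lemma vecD x y : vec (N.lxor x y) = vec x + vec y.
Proof.
by apply/colP => i; rewrite !mxE bitD; case: (bit x i); case: (bit y i);
  apply: val_inj.
Qed.

Lemma mulmx_xlinear (X : 'M['F_2]_g) :
  X \in unitmx -> xlinear g (fun x => num (X *m vec x)).
Proof.
move=> uX; split=> [x y|x xg /num_eq0 Xx]; first by rewrite vecD mulmxDr numD.
by rewrite -(vecK xg) -[vec x](mulKmx uX) Xx mulmx0 num0.
Qed.

Definition colnum n (A : 'M[int]_(g, n)) j := num (col j (map_mx intr A)).

Lemma even_cols_colnum n (A : 'M[int]_(g, n)) (T : {set 'I_n}) : tu A ->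
  even_cols A T = (\big[N.lxor/0%num]_(j in T) colnum A j == 0%num).
Proof.
move=> tuA; rewrite even_colsE //.
have -> : map_mx intr A *m \col_i (i \in T)%:R =
    \sum_(j in T) col j (map_mx intr A) :> 'cV['F_2]_g.
  apply/colP => i; rewrite summxE mxE [RHS]big_mkcond; apply: eq_bigr => j _.
  by rewrite !mxE; case: (j \in T); rewrite ?mulr1 ?mulr0.
rewrite /colnum -(big_morph num numD num0).
by apply/eqP/eqP => [->|/num_eq0 //]; rewrite num0.
Qed.

Lemma colnum_class p (j : 'I_(size p)) : all (small g) p ->
  colnum (class_mx g p) j = nth 0%num p j.
Proof.
move=> pg; apply/esym/num_inj => [|i]; first exact: nth_small.
by rewrite !mxE; case: bit; rewrite ?eqxx.
Qed.

(** By [column_indep_even], a loop is a column vanishing mod 2, and two nonzero columns are parallel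
    when they are equal mod 2. *)
Lemma simple_colnum (R : realType) n (A : 'M[int]_(g, n)) : tu A ->
  simple_matroid (column_indep (map_mx intr A : 'M[R]_(g, n))) <->
  (forall j, colnum A j != 0%num) /\ injective (colnum A).
Proof.
move=> tuA.
have I1 e : column_indep (map_mx intr A : 'M[R]_(g,
  n)) [set e]%SET <-> colnum A e != 0%num.
  rewrite column_indep_even //; split=> [free|e0 T].
    apply/eqP => e0; have ev : even_cols A [set e]%SET.
      by rewrite even_cols_colnum // big_set1 e0.
    by have /setP/(_ e) := free _ (subxx _) ev; rewrite !inE eqxx.
  rewrite subset1 => /orP[] /eqP-> //.
  by rewrite even_cols_colnum // big_set1 (negPf e0).
have I2 e f : e != f -> colnum A e != 0%num -> colnum A f != 0%num ->
    column_indep (map_mx intr A : 'M[R]_(g, n)) [set e;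
      f]%SET <-> colnum A e != colnum A f.
  move=> ef e0 f0; have sum2 : even_cols A [set e; f]%SET =
      (colnum A e == colnum A f).
    rewrite even_cols_colnum // big_setU1 ?inE //= big_set1.
    exact: lxor_eq0.
  rewrite column_indep_even //; split=> [free|nef T].
    apply/eqP => Eef; have ev : even_cols A [set e; f]%SET by rewrite sum2 Eef.
    by have /setP/(_ e) := free _ (subxx _) ev; rewrite !inE eqxx.
  move=> TS evT; have TE z : (z \in T) = (z == e) && (e \in T) || (z == f) && (f
    \in T).
    apply/idP/idP => [zT|]; last by case/orP=> /andP[/eqP->].
    have := subsetP TS _ zT; move: zT; rewrite !inE => + /orP[] /eqP zE.
      by rewrite zE eqxx => ->.
    by rewrite zE eqxx orbC => ->.
  case: (boolP (e \in T)) (boolP (f \in T)) TE => eT [] fT TE.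
  - have T2 : T = [set e; f]%SET by apply/setP => z; rewrite TE !inE !andbT.
    by move: evT; rewrite T2 sum2 (negPf nef).
  - have T1 : T = [set e]%SET by apply/setP => z;
    rewrite TE !inE andbT andbF orbF.
    by move: evT; rewrite T1 even_cols_colnum // big_set1 (negPf e0).
  - have T1 : T = [set f]%SET by apply/setP => z; rewrite TE !inE andbT andbF.
    by move: evT; rewrite T1 even_cols_colnum // big_set1 (negPf f0).
  by apply/setP => z; rewrite TE !inE !andbF.
rewrite /simple_matroid /parallel /is_loop; split=> [[noloop nopar]|[nz inj]].
  have nz e : colnum A e != 0%num by apply: (proj1 (I1 e)); apply: contrapT;
    exact: (noloop e).
  split=> // e f Eef; apply: contrapT => /eqP ef; apply: (nopar e f).
  by split=> // /(I2 _ _ ef (nz e) (nz f)); rewrite Eef eqxx.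
split=> [e|e f [ef _ _]]; first by case; apply/I1.
by case; apply/(I2 _ _ ef (nz e) (nz f)); rewrite (inj_eq inj).
Qed.

End BinaryVectors.

From mathcomp Require Import classical_sets functions cardinality.

(** * Cones and orbits *)

Section Cones.
Local Open Scope ring_scope.
Local Open Scope classical_set_scope.
Variable R : realType.

Definition real_mx m n (A : 'M[int]_(m, n)) : 'M[R]_(m, n) := map_mx intr A.

Lemma real_mxE m n (A : 'M[int]_(m, n)) i j : real_mx A i j = (A i j)%:~R.
Proof. by rewrite mxE. Qed.

Definition form m n (A : 'M[R]_(m, n)) (c : 'rV[R]_n) := A *m diag_mx c *m A^T.

Lemma formE m n (A : 'M[R]_(m, n)) c :
  form A c = \sum_i c 0 i *: (col i A *m (col i A)^T).
Proof.
apply/matrixP => k l; rewrite /form mul_mx_diag !mxE summxE;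
  apply: eq_bigr => i _.
by rewrite !mxE big_ord1 !mxE; ring.
Qed.

Lemma formM m n (A : 'M[R]_(m, n)) c (k l : 'I_m) :
  form A c k l = \sum_i c 0 i * A k i * A l i.
Proof.
rewrite formE summxE; apply: eq_bigr => i _.
by rewrite !mxE big_ord1 !mxE mulrA.
Qed.

Lemma form_is_linear m n (A : 'M[R]_(m, n)) a c d :
  form A (a *: c + d) = a *: form A c + form A d.
Proof.
by rewrite /form linearP /= mulmxDr mulmxDl -scalemxAr -scalemxAl.
Qed.

Lemma sigmaE m n (A : 'M[R]_(m, n)) Q :
  sigma A Q <-> exists2 c : 'rV[R]_n, forall i, 0 < c 0 i & Q = form A c.
Proof.
split=> -[c c0 ->].
  exists (\row_i c i) => [i|]; first by rewrite mxE.
  by rewrite formE; apply: eq_bigr => i _; rewrite mxE.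
by exists (fun i => c 0 i) => //; rewrite formE.
Qed.

Definition forms_free m n (A : 'M[R]_(m, n)) :=
  forall c, form A c = 0 -> c = 0.

Lemma forms_free_inj m n (A : 'M[R]_(m, n)) : forms_free A ->
  injective (form A).
Proof.
move=> ffA c d cd; apply/eqP; rewrite -subr_eq0; apply/eqP/ffA.
by rewrite addrC -scaleN1r form_is_linear cd scaleN1r addrC subrr.
Qed.

(** The generators need not lie in the open cone, but each of them is the difference of two of its
    points, so the span of the cone is the span of the generators. *)
Lemma cone_dim_free m n (A : 'M[R]_(m, n)) d :
  forms_free A -> cone_dim (sigma A) d <-> d = n.
Proof.
move=> ffA; pose F i : 'M[R]_m := form A (delta_mx 0 i).
have formF c : form A c = \sum_i c 0 i *: F i.
  have {1}-> : c = \sum_i c 0 i *: delta_mx 0 i by exact: row_sum_delta.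
  elim/big_rec2: _ => [|i y x _ IH]; last by rewrite form_is_linear IH.
  by rewrite /form linear0 mulmx0 mul0mx.
pose X := [tuple F i | i < n]; pose U := <<X>>%VS.
have FU i : F i \in U by apply: memv_span; apply/tnthP; exists i;
  rewrite tnth_mktuple.
have sU : sigma A `<=` [set Q | Q \in U].
  move=> Q /sigmaE[c _ ->] /=; rewrite formF; apply: memv_suml => i _.
  by rewrite memvZ.
have Umin (W : {vspace 'M[R]_m}) : sigma A `<=` [set Q | Q \in W] ->
  (U <= W)%VS.
  move=> sW; apply/span_subvP => _ /tnthP[i ->]; rewrite tnth_mktuple.
  have inW (c : 'rV[R]_n) : (forall i, 0 < c 0 i) -> form A c \in W.
    by move=> c0; apply: sW; apply/sigmaE; exists c.
  have -> : F i = form A (1 *: delta_mx 0 i + const_mx 1) - form A (const_mx 1).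
    by rewrite form_is_linear scale1r addrK.
  rewrite memvB // inW // => j; rewrite !mxE ?ltr01 //.
  by rewrite ltr_pwDr ?ltr01 // mul1r ler0n.
have dimU : \dim U = n.
  have /eqP-> : free X; last by rewrite size_tuple.
  apply/freeP => k k0 i; have kF : form A (\row_j k j) = 0.
    rewrite formF -[RHS]k0; apply: eq_bigr => j _.
    by rewrite mxE -tnth_nth tnth_mktuple.
  by move/ffA/rowP/(_ i): kF; rewrite !mxE.
split=> [[V [sV Vmin <-]]|->]; last by exists U.
by rewrite -dimU; apply/eqP; rewrite eqn_leq !dimvS ?Vmin ?Umin.
Qed.

Lemma GLZ_actE m n (X : 'M[int]_m) (A : 'M[R]_(m, n)) c :
  GLZ_act X (form A c) = form (real_mx X^T *m A) c.
Proof.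
by rewrite /GLZ_act /form /real_mx trmx_mul !map_trmx trmxK !mulmxA.
Qed.

Lemma GLZ_act_sigma m n (X : 'M[int]_m) (A : 'M[R]_(m, n)) :
  GLZ_act X @` sigma A = sigma (real_mx X^T *m A).
Proof.
apply/seteqP; split=> [_ [Q /sigmaE[c c0 ->] <-]|Q /sigmaE[c c0 ->]].
  by apply/sigmaE; exists c; rewrite // GLZ_actE.
by exists (form A c); [apply/sigmaE; exists c | rewrite GLZ_actE].
Qed.

(** The form v v^T does not see the sign of v, which absorbs the column signs left by
    [same_code_equiv]. *)
Lemma sigma_signs m n (A : 'M[R]_(m, n)) (d : 'rV[int]_n) :
  (forall j, d 0 j \in [:: 1;
    -1 : int]) -> sigma (A *m real_mx (diag_mx d)) = sigma A.
Proof.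
move=> sd; have E c : form (A *m real_mx (diag_mx d)) c = form A c.
  apply/matrixP => k l; rewrite !formM; apply: eq_bigr => i _.
  rewrite /real_mx map_diag_mx !mul_mx_diag !mxE.
  by have := sd i; rewrite !inE => /orP[] /eqP->; rewrite ?rmorphN1; ring.
by apply/seteqP; split=> Q /sigmaE[c c0 ->]; apply/sigmaE; exists c.
Qed.

Lemma sigma_colsub m n p (A : 'M[R]_(m, n)) (h : 'I_p -> 'I_n) :
  bijective h -> sigma (colsub h A) = sigma A.
Proof.
move=> [k hK kK]; have bh : {on [pred i | true],
  bijective h} by apply: onW_bij; exists k.
apply/seteqP; split=> Q /sigmaE[c c0 ->]; apply/sigmaE.
  exists (\row_i c 0 (k i)) => [i|]; first by rewrite mxE.
  apply/matrixP => x y; rewrite !formM [RHS](reindex h) //=.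
  by apply: eq_bigr => i _; rewrite !mxE hK.
exists (\row_i c 0 (h i)) => [i|]; first by rewrite mxE.
apply/matrixP => x y; rewrite !formM [LHS](reindex h) //=.
by apply: eq_bigr => i _; rewrite !mxE.
Qed.

Lemma GLZ_act1 m (s : set 'M[R]_m) : GLZ_act 1%:M @` s = s.
Proof.
have E Q : GLZ_act 1%:M Q = Q by rewrite /GLZ_act map_mx1 trmx1 mul1mx mulmx1.
by apply/seteqP; split=> [_ [Q sQ <-]|Q sQ]; [rewrite E|exists Q; rewrite ?E].
Qed.

Lemma GLZ_act_comp m (X Y : 'M[int]_m) (s : set 'M[R]_m) :
  GLZ_act Y @` (GLZ_act X @` s) = GLZ_act (X *m Y) @` s.
Proof.
rewrite image_comp; apply: eq_imagel => Q _ /=.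
by rewrite /GLZ_act map_mxM trmx_mul !mulmxA.
Qed.

Lemma GLZ_orbit_act m (X : 'M[int]_m) (s : set 'M[R]_m) : X \in unitmx ->
  GLZ_orbit (GLZ_act X @` s) = GLZ_orbit s.
Proof.
move=> uX; apply/seteqP; split=> t [Y uY ->].
  by exists (X *m Y); rewrite ?unitmx_mul ?uX // GLZ_act_comp.
exists (invmx X *m Y); rewrite ?unitmx_mul ?unitmx_inv ?uX //.
by rewrite GLZ_act_comp mulmxA mulmxV // mul1mx.
Qed.

Lemma forms_free_act m n (X : 'M[int]_m) (A : 'M[R]_(m, n)) : X \in unitmx ->
  forms_free A -> forms_free (real_mx X *m A).
Proof.
move=> uX ffA c Xc; apply: ffA.
have <- : form (real_mx (invmx X) *m (real_mx X *m A)) c = form A c.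
  by rewrite mulmxA /real_mx -map_mxM mulVmx // map_mx1 mul1mx.
move: Xc; set B := _ *m A => Bc.
have -> : form (real_mx (invmx X) *m B) c =
    real_mx (invmx X) *m form B c *m (real_mx (invmx X))^T.
  by rewrite /form trmx_mul !mulmxA.
by rewrite Bc mulmx0 mul0mx.
Qed.

Lemma forms_free_signs m n (A : 'M[R]_(m, n)) (d : 'rV[int]_n) :
  (forall j, d 0 j \in [:: 1; -1 : int]) ->
  forms_free A -> forms_free (A *m real_mx (diag_mx d)).
Proof.
move=> sd ffA c Ac; apply: ffA; rewrite -Ac; apply/matrixP => k l.
rewrite !formM; apply: eq_bigr => i _.
rewrite /real_mx map_diag_mx !mul_mx_diag !mxE.
by have := sd i; rewrite !inE => /orP[] /eqP->; rewrite ?rmorphN1; ring.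
Qed.

Lemma forms_free_colsub m n p (A : 'M[R]_(m, n)) (h : 'I_p -> 'I_n) :
  bijective h -> forms_free A -> forms_free (colsub h A).
Proof.
move=> [k hK kK] ffA c Ac.
have bh : {on [pred i | true], bijective h} by apply: onW_bij; exists k.
have /ffA/rowP c0 : form A (\row_i c 0 (k i)) = 0.
  rewrite -Ac; apply/matrixP => x y; rewrite !formM [LHS](reindex h) //=.
  by apply: eq_bigr => i _; rewrite !mxE hK.
by apply/rowP => i; have := c0 (h i); rewrite !mxE hK.
Qed.

(* A rank one form in the cone of [B] is a combination of the generators of [A]
   with nonnegative coefficients, so the kernel of the form is contained in the
   kernels of the generators occurring in it. *)
Lemma sigma_extremal m n p (A : 'M[R]_(m, n)) (B : 'M[R]_(m, p)) (j : 'I_p) k0 :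
  forms_free A -> sigma A = sigma B -> B k0 j != 0 ->
  exists i, exists mu, forall k, A k i = mu * B k j.
Proof.
move=> ffA AB Bj.
have inA (c : 'rV[R]_p) : (forall i, 0 < c 0 i) ->
  exists2 a : 'rV[R]_n, forall i, 0 < a 0 i & form B c = form A a.
  by move=> c0; apply/sigmaE; rewrite AB; apply/sigmaE; exists c.
pose one := const_mx 1 : 'rV[R]_p.
have tpos t : 0 < t -> forall i, 0 < (t *: delta_mx 0 j + one) 0 i.
  by move=> t0 i; rewrite !mxE ltr_pwDr ?ltr01 // mulr_ge0 ?ler0n // ltW.
have [a a0 Ea] := inA one (fun i => ltac:(rewrite mxE ltr01; exact isT)).
have [b b0 Eb] := inA _ (tpos 1 ltr01).
(* The generator [j] of [B] is a difference of two points of the cone; [d] holds its coordinates in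
   the generators of [A]. *)
have [d dE] : exists d : 'rV[R]_n, d = -1 *: a + b by exists (-1 *: a + b).
have Ed : form A d = form B (delta_mx 0 j).
  by rewrite dE form_is_linear -Ea -Eb form_is_linear scaleN1r scale1r addrC
    addrK.
have d_ge0 i : 0 <= d 0 i.
  rewrite leNgt; apply/negP => di.
  (* With this [t], a negative [d 0 i] makes the coordinate [a 0 i + t d 0 i] of a point of the open
     cone vanish. *)
  have t0 : 0 < a 0 i / - d 0 i by rewrite divr_gt0 ?a0 // oppr_gt0.
  have [e e0 Ee] := inA _ (tpos _ t0).
  move: Ee; rewrite form_is_linear -Ed Ea -form_is_linear =>
    /(forms_free_inj ffA) Ee.
  have := e0 i; rewrite -Ee !mxE invrN mulrN mulNr divfK ?lt_eqF //.
  by rewrite addNr ltxx.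
have Bdelta k l : form B (delta_mx 0 j) k l = B k j * B l j.
  rewrite formM (bigD1 j) //= big1 => [|i ij]; last first.
    by rewrite mxE (negPf ij) andbF !mul0r.
  by rewrite mxE !eqxx mul1r addr0.
have [i di] : exists i, d 0 i != 0.
  apply/existsP; apply: contraNT Bj; rewrite negb_exists => /forallP d0.
  have d00 : d = 0 by apply/rowP => i; rewrite mxE; apply/eqP;
    rewrite -[_ == _]negbK d0.
  have := Bdelta k0 k0; rewrite -Ed d00 formM big1 => [|i _].
    by move/esym/eqP; rewrite mulf_eq0 orbb.
  by rewrite mxE !mul0r.
exists i, (A k0 i / B k0 j) => l.
(* The value of column [i] of [A] on the vector [B l j e_k0 - B k0 j e_l], which is orthogonal to
   column [j] of [B]. The form vanishes on it, and so does each of its nonnegative terms. *)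
pose x i := B l j * A k0 i - B k0 j * A l i.
have : \sum_i d 0 i * x i ^+ 2 = 0.
  transitivity (B l j ^+ 2 * form A d k0 k0 - 2 * B l j * B k0 j * form A d k0 l
    + B k0 j ^+ 2 * form A d l l); last by rewrite Ed !Bdelta; ring.
  rewrite !formM !mulr_sumr -sumrB -big_split /=; apply: eq_bigr => q _.
  by rewrite /x; ring.
move/eqP; rewrite psumr_eq0 => [/allP/(_ i)|q _]; last first.
  by rewrite mulr_ge0 // sqr_ge0.
rewrite mem_index_enum => /(_ isT);
  rewrite mulf_eq0 (negPf di) sqrf_eq0 subr_eq0.
rewrite implyTb orFb => /eqP xi; apply: (mulfI Bj); rewrite -xi.
by field.
Qed.

End Cones.

(** * The cells correspond to the tabulated classes *)

Section Cells.
Variable R : realType.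
Variable g : nat.
Hypothesis g345 : g \in [:: 3; 4; 5].
Local Open Scope ring_scope.
Local Open Scope classical_set_scope.
Implicit Types (p q : seq N).

Definition class_cone p : set 'M[R]_g := sigma (real_mx R (class_mx g p)).

Lemma classes_ofP p : p \in classes_of g -> [/\ p \in classes, all (small g) p,
  uniq p & 0%num \notin p].
Proof.
by rewrite mem_filter => /andP[pg pC]; have [? _ ?] := class_wf pC.
Qed.

Lemma class_colnum_inj p : p \in classes_of g ->
  injective (colnum (class_mx g p)).
Proof.
move=> /classes_ofP[_ pg up _] i j; rewrite !colnum_class // => /eqP.
by rewrite nth_uniq // => /eqP/val_inj.
Qed.

Lemma class_admissible p : p \in classes_of g ->
  admissible (real_mx R (class_mx g p)).
Proof.
move=> pC'; have [pC pg up p0] := classes_ofP pC'.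
have tup := class_mx_tu g345 pC; split; first exact: tu_map.
  apply/simple_colnum => //; split=> [j|]; last exact: class_colnum_inj.
  by rewrite colnum_class //; apply: contraNneq p0 => <-; apply: mem_nth.
apply/(cographic_cut_code _ tup); have [V [a [b ab]]] := class_cutlike pC.
pose P j := nth 0%num p (j : 'I_(size p)).
have Pp j : P j \in p by apply: mem_nth.
have P_inj : injective P.
  by move=> i j /eqP; rewrite nth_uniq // => /eqP/val_inj.
have sumP (T : {set 'I_(size p)}) (T' : pred N) : (forall j,
  T' (P j) = (j \in T)) ->
    xorsum T' p = \big[N.lxor/0%num]_(j in T) P j.
  move=> T'E; rewrite /xorsum (big_nth 0%num) big_mkord.
  by apply: eq_bigl => j; rewrite T'E.
have codeP T : even_cols (class_mx g p) T <-> \big[N.lxor/0%num]_(j in T) P j =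
  0%num.
  rewrite even_cols_colnum //; under eq_bigr do rewrite colnum_class //.
  by split=> /eqP.
exists V, (fun j => a (P j)), (fun j => b (P j)) => T; rewrite codeP.
pose T' x := [exists j in T, P j == x].
have T'E j : T' (P j) = (j \in T).
  apply/existsP/idP => [[i /andP[iT /eqP/P_inj <-]]//|jT].
  by exists j; rewrite jT eqxx.
rewrite -(sumP T T') // ab; split=> -[f fP]; exists f.
  by apply/setP => j; rewrite inE -fP ?Pp // T'E.
move=> x /(nthP 0%num)[i ip <-]; rewrite -[nth _ _ _]/(P (Ordinal ip)) T'E fP.
by rewrite inE.
Qed.

Lemma forms_free_class p : p \in classes_of g ->
  forms_free (real_mx R (class_mx g p)).
Proof.
move=> pC'; have [pC pg _ _] := classes_ofP pC'; move=> c c0.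
suff cj j : c 0 j = 0 by apply/rowP => j; rewrite cj mxE.
apply: (class_forms_free pC (c := fun j => c 0 j)) => k l.
have [kg|gk] := ltnP k g; last first.
  rewrite big1 // => i _; rewrite mxE (bit_small (nth_small _ pg)) //.
  by rewrite mulr0 mul0r.
have [lg|gl] := ltnP l g; last first.
  rewrite big1 // => i _;
    rewrite [X in _ * X%:~R]mxE (bit_small (nth_small _ pg)) //.
  by rewrite mulr0.
have /matrixP/(_ (Ordinal kg) (Ordinal lg)) := c0; rewrite formM mxE => ckl.
by rewrite -[RHS]ckl; apply: eq_bigr => i _; rewrite !mxE.
Qed.

Lemma admissible_class n (A : 'M[R]_(g, n)) : admissible A ->
  exists q, [/\ q \in classes_of g, size q = n, forms_free A
    & GLZ_orbit (sigma A) = GLZ_orbit (class_cone q)].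
Proof.
case=> /tu_lift[Z tuZ ->{A}] simpleZ /(cographic_cut_code _ tuZ)[V [a [b ab]]].
have [nz inj] := (proj1 (simple_colnum R tuZ)) simpleZ.
pose s := [seq colnum Z j | j <- enum 'I_n].
have us : uniq s by rewrite map_inj_uniq ?enum_uniq.
have sg : all (small g) s by apply/allP => _ /mapP[j _ ->]; apply: num_small.
have s0 : 0%num \notin s.
  by apply/mapP => -[j _ /esym/eqP]; rewrite (negPf (nz j)).
have js j : colnum Z j \in s by rewrite map_f ?mem_enum.
have xorsumE (T : pred N) :
    xorsum T s = \big[N.lxor/0%num]_(j in [set j | T (colnum Z j)]%SET) colnum Z
      j.
  rewrite /xorsum big_map big_enum_cond /=; apply: eq_bigl => j.
  by rewrite inE.
have cut_s : cutlike s.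
  (* The end maps of [cutlike] are defined on all of [N]; [None] is their value off the point set,
     and it also covers an empty [V]. *)
  pose back (c : 'I_n -> V) x := omap c [pick j | colnum Z j == x].
  have backE c j : back c (colnum Z j) = Some (c j).
    rewrite /back; case: pickP => [i /eqP/inj->//|/(_ j)].
    by rewrite eqxx.
  exists (option V), (back a), (back b) => T; rewrite xorsumE.
  have -> : \big[N.lxor/0%num]_(j in [set j | T (colnum Z j)]%SET) colnum Z j =
    0%num <->
      even_cols Z [set j | T (colnum Z j)]%SET.
    by rewrite even_cols_colnum //; split=> /eqP.
  rewrite ab; split=> -[f fP].
    exists (oapp f false) => _ /mapP[j _ ->]; rewrite !backE /=.
    by move/setP/(_ j): fP; rewrite !inE.
  exists (fun x => f (Some x)); apply/setP => j; rewrite !inE fP //.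
  by rewrite !backE.
have [Y [q [qC qg lin Ysm sq]]] := classification g345 us sg s0 cut_s.
have qC' : q \in classes_of g by rewrite mem_filter qg.
have [_ _ uq _] := classes_ofP qC'.
have szq : size q = n.
  by rewrite -(perm_size sq) size_map /s size_map size_enum_ord.
have s5 : all (small 5) s by apply: sub_all sg => x; apply: small_le5.
have Yq j : Y (colnum Z j) \in q by rewrite -(perm_mem sq) map_f.
have ltq j : (index (Y (colnum Z j)) q < size q)%N by rewrite index_mem.
(* The position in [q] of the image of column [j]. The class matrix reordered by [h] reduces, column
   by column, to the images under [Y], and hence has the code of [Z]. *)
pose h j := Ordinal (ltq j).
have hE j : nth 0%num q (h j) = Y (colnum Z j) by rewrite nth_index.
have inj_h : injective h.
  move=> i j /(congr1 (fun k : 'I_(size q) => nth 0%num q k)); rewrite !hE.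
  by move=> Yij; apply: inj; apply: (xlinear_inj lin) Yij; apply: (allP s5).
have bij_h : bijective h by apply: inj_card_bij; rewrite // !card_ord szq.
have tuq := class_mx_tu g345 qC.
pose B := colsub h (class_mx g q); have tuB : tu B by apply: tu_colsub.
have numB j : colnum B j = Y (colnum Z j).
  rewrite -hE -(@colnum_class g) //; congr num.
  by apply/colP => i; rewrite !mxE.
have codeZB T : even_cols Z T = even_cols B T.
  rewrite !even_cols_colnum //;
    under [X in _ = (X == _)]eq_bigr do rewrite numB.
  rewrite -(big_morph Y (proj1 lin) (xlinear0 lin)).
  apply/eqP/eqP => [->|]; first exact: xlinear0 lin.
  apply: (proj2 lin); apply: small_big => j _.
  exact: (small_le5 g345 (num_small _)).
have [X [d [uX sd BE]]] := same_code_equiv tuZ tuB codeZB.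
have real_colsub : real_mx R B = colsub h (real_mx R (class_mx g q)).
  by apply/matrixP => i j; rewrite !mxE.
have real_B : real_mx R B = real_mx R X *m real_mx R Z *m real_mx R (diag_mx d).
  by rewrite BE /real_mx !map_mxM.
have dd : diag_mx d *m diag_mx d = 1%:M :> 'M[int]_n.
  apply/matrixP => i j; rewrite mul_diag_mx !mxE; case: eqP => _;
    rewrite ?mulr0 //.
  by have := sd i; rewrite !inE => /orP[] /eqP->.
exists q; split=> //.
  have -> : map_mx intr Z = real_mx R (invmx X) *m (real_mx R B *m real_mx R
    (diag_mx d)).
    rewrite real_B -!mulmxA -(map_mxM intr (diag_mx d)) dd /real_mx map_mx1
      mulmx1.
    by rewrite mulmxA -map_mxM mulVmx // map_mx1 mul1mx.
  apply: forms_free_act; rewrite ?unitmx_inv //; apply: forms_free_signs => //.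
  by rewrite real_colsub; apply: forms_free_colsub => //;
    apply: forms_free_class.
have -> : class_cone q = GLZ_act X^T @` sigma (real_mx R Z).
  rewrite /class_cone -(sigma_colsub _ bij_h) -real_colsub real_B sigma_signs
    //.
  by rewrite GLZ_act_sigma trmxK.
by rewrite GLZ_orbit_act // unitmx_tr.
Qed.

(** Mod 2, the transpose of [X] carries the points of [q] to points of [p]. The equal numbers of
    points, read off the dimension, make this a bijection, and the sum profiles of distinct classes
    differ. *)
Lemma class_cone_inj p q : p \in classes_of g -> q \in classes_of g ->
  GLZ_orbit (class_cone p) = GLZ_orbit (class_cone q) -> p = q.
Proof.
move=> pC' qC' pq; have [pC pg up p0] := classes_ofP pC'.
have [qC qg uq q0] := classes_ofP qC'.
have : GLZ_orbit (class_cone q) (class_cone p).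
  by rewrite -pq; exists 1%:M; rewrite ?unitmx1 // GLZ_act1.
case=> X uX; rewrite /class_cone GLZ_act_sigma.
set L := class_mx g p; set M := class_mx g q.
rewrite /real_mx -map_mxM -!/(real_mx R _); set B := X^T *m M => LB.
have uXT : X^T \in unitmx by rewrite unitmx_tr.
have ffL : forms_free (real_mx R L) by apply: forms_free_class.
have ffB : forms_free (real_mx R B).
  by rewrite /real_mx map_mxM; apply: forms_free_act => //;
    apply: forms_free_class.
have szpq : size p = size q.
  by apply/(cone_dim_free _ ffB); rewrite -LB; apply/cone_dim_free.
have col1 s (j : 'I_(size s)) : s \in classes_of g ->
  exists k, class_mx g s k j = 1.
  case/classes_ofP=> sC sg _ s0; pose x := nth 0%num s j.
  have xs : x \in s by apply: mem_nth.
  have [/existsP[k bk]|/negP nb] := boolP [exists k : 'I_g, bit x k].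
    by exists k; rewrite mxE -/x bk.
  exfalso; have x0 : x = 0%num.
    apply: (bit_inj (allP sg x xs) (small0 g)) => i ig; rewrite bit0.
    by apply/negbTE/negP => bi; apply: nb; apply/existsP; exists (Ordinal ig).
  by rewrite x0 (negPf s0) in xs.
pose Xb : 'M['F_2]_g := map_mx intr X^T.
pose Y x := num (Xb *m vec g x).
have linY : xlinear g Y.
  apply: mulmx_xlinear; rewrite unitmxE det_map_mx.
  by apply: rmorph_unit; rewrite -unitmxE.
have Yq j : Y (nth 0%num q (j : 'I_(size q))) \in p.
  have Bcol : col j (real_mx R B) != 0.
    apply/eqP => Bj0; have [k Mk] := col1 q j qC'.
    have Mj0 : col j M = 0.
      rewrite -[M](mulKmx uXT) -/B colE -mulmxA -colE.
      suff -> : col j B = 0 by rewrite mulmx0.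
      apply/colP => i; move/colP/(_ i): Bj0; rewrite !mxE => /eqP.
      by rewrite intr_eq0 => /eqP.
    by move/colP/(_ k): Mj0; rewrite mxE [RHS]mxE Mk.
  have [k0 Bk0] : exists k0, real_mx R B k0 j != 0.
    apply/existsP; apply: contraNT Bcol; rewrite negb_exists => /forallP B0.
    by apply/eqP/colP => i; rewrite [LHS]mxE [RHS]mxE; apply/eqP/negPn/B0.
  have [i [mu muE]] := sigma_extremal ffL LB Bk0.
  have [k Lk] := col1 p i pC'; have [l Ml] := col1 q j qC'.
  (* The factor [mu] between column [i] of [L] and column [j] of [B] is an integer: after applying
     the inverse of [X^T] it is an entry of an integral matrix, in a row where column [j] of [M] is
     1. It is a unit because column [i] of [L] also has an entry 1. *)
  pose z := (invmx X^T *m L) l i.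
  have zmu : z%:~R = mu.
    have Lcol : col i (real_mx R L) = mu *: col j (real_mx R B).
      by apply/colP => r; rewrite !mxE; have := muE r; rewrite !mxE.
    have LP : real_mx R (invmx X^T *m L) = real_mx R (invmx X^T) *m real_mx R L.
      exact: map_mxM.
    have MP : real_mx R M = real_mx R (invmx X^T) *m real_mx R B.
      by rewrite /real_mx -map_mxM /B mulKmx.
    have : col i (real_mx R (invmx X^T *m L)) = mu *: col j (real_mx R M).
      by rewrite LP MP ![col _ (_ *m _)]colE -!mulmxA -!colE Lcol scalemxAr.
    move/colP/(_ l); rewrite [LHS]mxE [RHS]mxE [col j _ _ _]mxE.
    by rewrite ![real_mx _ _ _ _]mxE -/z Ml mulr1.
  have muB : 1 = z * B k j.
    apply/eqP; rewrite -(eqr_int R) rmorphM /= zmu; apply/eqP.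
    by have := muE k; rewrite !real_mxE Lk.
  have z1 : z = 1 \/ z = -1.
    have : z \is a GRing.unit by apply/unitrPr; exists (B k j).
    by rewrite unit_int_sign => /orP[] /eqP->; [left|right].
  have LBi r : L r i = z * B r j.
    apply/eqP; rewrite -(eqr_int R) rmorphM /= zmu; apply/eqP.
    by have := muE r; rewrite !real_mxE.
  suff -> : Y (nth 0%num q j) = nth 0%num p i by apply: mem_nth.
  rewrite -(@colnum_class g p i) // /Y; congr num.
  have -> : vec g (nth 0%num q j) = col j (map_mx intr M).
    by apply/colP => r; rewrite !mxE; case: bit.
  rewrite /Xb colE mulmxA -colE -map_mxM -/B; apply/colP => r.
  transitivity ((B r j)%:~R : 'F_2); first by rewrite [LHS]mxE [LHS]mxE.
  transitivity ((L r i)%:~R : 'F_2); last by rewrite [RHS]mxE [RHS]mxE.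
  rewrite LBi; case: z1 => ->; rewrite ?mul1r // mulN1r rmorphN /=.
  by rewrite oppr_pchar2 // pchar_Fp.
have uYq : uniq (map Y q).
  rewrite map_inj_in_uniq // => x y xq yq.
  by apply: (xlinear_inj linY); apply: (allP qg).
have sub : {subset map Y q <= p}.
  by move=> _ /mapP[x /(nthP 0%num)[j jq <-] ->]; apply: (Yq (Ordinal jq)).
have [|_ e] := uniq_min_size uYq sub; first by rewrite size_map szpq.
have pqE : perm_eq (map Y q) p by apply: uniq_perm.
apply/esym/(sum_profile_inj g345 qC' pC').
by apply: (sum_profile_linear linY _ qg pqE) => x _; apply: num_small.
Qed.

Lemma schottky_cellsE : schottky_cells R g =
  (fun p => GLZ_orbit (class_cone p)) @` [set` classes_of g].
Proof.
apply/seteqP; split=> [_ [n [A [/admissible_class[q [qC _ _ Aq]] ->]]]|_ [p pC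
  <-]].
  by exists q; rewrite // Aq.
by exists (size p), (real_mx R (class_mx g p)); split=> //;
  apply: class_admissible.
Qed.

(** The forms are independent for every admissible matrix and not only for the representatives, so
    dimension [d] means [d] columns, that is, [d] points. *)
Lemma schottky_cells_dimE d : schottky_cells_dim R g d =
  (fun p => GLZ_orbit (class_cone p)) @` [set` [seq p <- classes_of g | size p
    == d]].
Proof.
apply/seteqP; split=> [C [n [A [/admissible_class[q [qC sq ffA Aq]] ->]]]|_ [p +
  <-]].
  move=> /(cone_dim_free _ ffA) dn.
  by exists q; rewrite ?Aq //= mem_filter sq dn eqxx.
rewrite /= mem_filter => /andP[/eqP pd pC];
  exists (size p), (real_mx R (class_mx g p)).
split=> //; first exact: class_admissible.
by apply/cone_dim_free => //; apply: forms_free_class.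
Qed.

Lemma classes_of_uniq : uniq (classes_of g).
Proof. exact: map_uniq (allP sum_profiles_uniq _ g345). Qed.

Lemma card_cells (l : seq (seq N)) : uniq l -> {subset l <= classes_of g} ->
  ((fun p => GLZ_orbit (class_cone p)) @` [set` l] #= `I_(size l))%card.
Proof.
move=> ul lC; have -> : [set` l] = nth [::] l @` `I_(size l).
  apply/seteqP; split=> [p pl|_ [i il <-]]; last exact: mem_nth.
  by exists (index p l); rewrite /= ?index_mem // nth_index.
rewrite image_comp; apply: inj_card_eq => i j /set_mem il /set_mem jl /= ij.
have /eqP : nth [::] l i = nth [::] l j.
  by apply: class_cone_inj ij; apply/lC/mem_nth.
by rewrite nth_uniq // => /eqP.
Qed.

End Cells.

Lemma classes_of_sizes :
  [&& size (classes_of 3) == 9, size (classes_of 4) == 25,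
    size (classes_of 5) == 92,
   all (fun d => size [seq p <- classes_of 3 | size p == d] ==
     nth 0 [:: 1; 1; 1; 2; 2; 1; 1] d) (iota 0 7),
   all (fun d => size [seq p <- classes_of 4 | size p == d] ==
     nth 0 [:: 1; 1; 1; 2; 3; 4; 5; 4; 2; 2] d) (iota 0 10) &
   all (fun d => size [seq p <- classes_of 5 | size p == d] ==
     nth 0 [:: 1; 1; 1; 2; 3; 5; 9; 12; 15; 17; 15; 7; 4] d) (iota 0 13)].
Proof. by vm_compute. Qed.

Local Open Scope classical_set_scope.
Local Open Scope card_scope.

Lemma card_schottky_cells (R : realType) g (s : seq nat) : g \in [:: 3; 4; 5] ->
  all (fun d => size [seq p <- classes_of g | size p == d] == nth 0 s d) (iota 0
    (size s)) ->
  schottky_cells R g #= `I_(size (classes_of g)) /\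
  forall d : nat, d < size s -> schottky_cells_dim R g d #= `I_(nth 0 s d).
Proof.
move=> g345 /allP sz; split;
  first by rewrite schottky_cellsE // card_cells ?classes_of_uniq.
move=> d ds; rewrite schottky_cells_dimE // -(eqP (sz d _)) ?mem_iota //.
apply: card_cells; rewrite ?filter_uniq ?classes_of_uniq // => p.
by rewrite mem_filter => /andP[].
Qed.

Theorem theorem6p4 (R : realType) :
  [/\ schottky_cells R 3 #= `I_9 /\
      (forall d : nat, (d <= 6)%N ->
         schottky_cells_dim R 3 d #=
           `I_(nth 0%N [:: 1; 1; 1; 2; 2; 1; 1] d)),
      schottky_cells R 4 #= `I_25 /\
      (forall d : nat, (d <= 9)%N ->
         schottky_cells_dim R 4 d #=
           `I_(nth 0%N [:: 1; 1; 1; 2; 3; 4; 5; 4; 2; 2] d))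
    & schottky_cells R 5 #= `I_92 /\
      (forall d : nat, (d <= 12)%N ->
         schottky_cells_dim R 5 d #=
           `I_(nth 0%N [:: 1; 1; 1; 2; 3; 5; 9; 12; 15; 17; 15; 7; 4] d))].
Proof.
have /and5P[/eqP n3 /eqP n4 /eqP n5 d3 /andP[d4 d5]] := classes_of_sizes.
have c3 := card_schottky_cells R (isT : 3 \in [:: 3; 4; 5]) d3.
have c4 := card_schottky_cells R (isT : 4 \in [:: 3; 4; 5]) d4.
have c5 := card_schottky_cells R (isT : 5 \in [:: 3; 4; 5]) d5.
by rewrite n3 in c3; rewrite n4 in c4; rewrite n5 in c5.
Qed.
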